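(* Let $(M,\bar g)$ be a weakly Einstein Riemannian four-manifold such that $\bar g$ is conformal to a Riemannian product of two surface metrics, that is, $M=\hat M\times\tilde M$ and $\bar g=(\hat g+\tilde g)/\psi^2$ for some Riemannian surfaces $(\hat M,\hat g)$, $(\tilde M,\tilde g)$ and some function $\psi:M\to\mathbb{R}\smallsetminus\{0\}$. Then every point of $M$ at which the Einstein tensor and the Weyl tensor of $\bar g$ are both nonzero has a neighborhood on which $\bar g$ is isometric to a metric of the form $(g+h)/\varphi^2$ on $\Sigma\times\Pi$, where $(\Sigma,g)$ and $(\Pi,h)$ are Riemannian surfaces with Gaussian curvatures $K$ and $c$, the curvature $c$ is constant, and $\varphi:\Sigma\to\mathbb{R}\smallsetminus\{0\}$ is a function such that, with $\Delta$ and $\nabla$ referring to $g$, either (i) $\Delta\varphi^{-1}=0$ and $2g(\nabla\varphi,\nabla\varphi)=(c-K)\varphi^2$ on $\Sigma$, or (ii) $2\nabla d\varphi=(\Delta\varphi)g$ and $(K+c)\varphi^2+\varphi\Delta\varphi=2g(\nabla\varphi,\nabla\varphi)$ on $\Sigma$.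
   Context: Manifolds are connected; all manifolds, metrics and functions are smooth. A Riemannian four-manifold $(M,g)$ with curvature tensor $R$ is weakly Einstein if, for some function $\phi$ on $M$, $R_{ikpq}R_j{}^{kpq}=\phi g_{ij}$. The Einstein tensor is the traceless Ricci tensor $\mathrm{e}=\mathrm{r}-\mathrm{s}g/4$, where $\mathrm{r}$ is the Ricci tensor and $\mathrm{s}$ the scalar curvature. $\nabla d\varphi$ is the Hessian and $\Delta\varphi=\mathrm{tr}_g\nabla d\varphi$. The symbols $g,h,\varphi$ (and $\hat g,\tilde g$) also denote pullbacks to the product manifolds. *)

(* Defs.v *)
(* MathComp-Analysis *)
From HB Require Import structures.
From mathcomp Require Import all_boot all_order all_algebra.
From mathcomp Require Import all_classical all_reals all_analysis.
Set Implicit Arguments.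
Unset Strict Implicit.
Unset Printing Implicit Defensive.
Import Order.TTheory GRing.Theory Num.Theory.
Import numFieldNormedType.Exports.
Local Open Scope classical_set_scope.
Local Open Scope ring_scope.

Definition pderiv {R : realType} {n : nat} {W : normedModType R}
    (f : 'rV[R]_n -> W) (k : 'I_n) (x : 'rV[R]_n) : W :=
  'D_(delta_mx 0 k) f x.

Fixpoint smooth_upto {R : realType} {n : nat} {W : normedModType R} (r : nat)
    (D : set 'rV[R]_n) (f : 'rV[R]_n -> W) : Prop :=
  (forall x, D x -> differentiable f x) /\
  (if r is r'.+1 then forall k, smooth_upto r' D (pderiv f k) else True).

(* Meant for open D: differentiability at the points of D is two-sided, and
   the values of f away from D do not matter. *)
Definition smooth_on {R : realType} {n : nat} {W : normedModType R}
    (D : set 'rV[R]_n) (f : 'rV[R]_n -> W) : Prop :=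
  forall r, smooth_upto r D f.

(* A space with an indexed family of charts [chart_map i], defined on
   [chart_dom i], and their inverses [chart_inv i]. The values outside
   [chart_dom i], respectively [chart_map i @` chart_dom i], are irrelevant. *)
Record charted (R : realType) (n : nat) := Charted {
  carrier :> topologicalType ;
  chart_index : Type ;
  chart_dom : chart_index -> set carrier ;
  chart_map : chart_index -> carrier -> 'rV[R]_n ;
  chart_inv : chart_index -> 'rV[R]_n -> carrier }.

Definition chart_im {R : realType} {n : nat} {M : charted R n}
    (i : chart_index M) : set 'rV[R]_n := chart_map i @` chart_dom i.

Definition is_chart {R : realType} {n : nat} (M : charted R n)
    (i : chart_index M) : Prop :=
  [/\ open (chart_dom i), open (chart_im i),
      (forall p, chart_dom i p -> chart_inv i (chart_map i p) = p),
      {within chart_dom i, continuous (chart_map i)} &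
      {within chart_im i, continuous (chart_inv i)}].

Definition is_manifold {R : realType} {n : nat} (M : charted R n) : Prop :=
  [/\ hausdorff_space M, @second_countable M & connected [set: M]] /\
  [/\ (forall p : M, exists i, chart_dom (c := M) i p),
      (forall i : chart_index M, is_chart i) &
      (forall i j : chart_index M,
         smooth_on (chart_map i @` (chart_dom i `&` chart_dom j))
           (chart_map j \o chart_inv i))].

Definition smooth_fun {R : realType} {n : nat} (M : charted R n)
    (f : M -> R) : Prop :=
  forall i : chart_index M, smooth_on (chart_im i) (f \o chart_inv i).

(* The coordinate expression of F in the charts i, j makes sense on this set. *)
Definition overlap {R : realType} {m n : nat} (M : charted R m)
    (N : charted R n) (U : set M) (F : M -> N)
    (i : chart_index M) (j : chart_index N) : set 'rV[R]_m :=
  chart_map i @` (U `&` chart_dom i `&` F @^-1` chart_dom j).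

Definition smooth_map_on {R : realType} {m n : nat} (M : charted R m)
    (N : charted R n) (U : set M) (F : M -> N) : Prop :=
  (forall p, U p -> {for p, continuous F}) /\
  (forall (i : chart_index M) (j : chart_index N),
     smooth_on (overlap U F i j) (chart_map j \o F \o chart_inv i)).

(* A metric is given by its component matrices in the charts; [is_metric] below
   imposes the transformation law. *)
Definition metric_comp {R : realType} {n : nat} (M : charted R n) : Type :=
  chart_index M -> 'rV[R]_n -> 'M[R]_n.

(* [g] on [U] is the pullback of [h] by [F]. The library's Jacobian acts on row
   vectors from the right: 'd f x v = v *m 'J f x. *)
Definition pullback_on {R : realType} {m n : nat} (M : charted R m)
    (N : charted R n) (U : set M) (F : M -> N)
    (g : metric_comp M) (h : metric_comp N) : Prop :=
  forall (i : chart_index M) (j : chart_index N) (x : 'rV[R]_m),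
    overlap U F i j x ->
    let f := chart_map j \o F \o chart_inv i in
    g i x = jacobian f x *m h j (f x) *m (jacobian f x)^T.

Definition is_metric {R : realType} {n : nat} (M : charted R n)
    (g : metric_comp M) : Prop :=
  (forall i : chart_index M,
     [/\ smooth_on (chart_im i) (g i),
         (forall x, chart_im i x -> (g i x)^T = g i x) &
         (forall x, chart_im i x -> forall v : 'rV[R]_n, v != 0 ->
            0 < (v *m g i x *m v^T) 0 0)]) /\
  pullback_on [set: M] idfun g g.

Definition riemannian_manifold {R : realType} {n : nat} (M : charted R n)
    (g : metric_comp M) : Prop :=
  is_manifold M /\ is_metric g.

(* F maps (U, g) isometrically onto (N, h), with inverse G. *)
Definition isometry_onto {R : realType} {n : nat} (M N : charted R n)
    (U : set M) (g : metric_comp M) (h : metric_comp N)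
    (F : M -> N) (G : N -> M) : Prop :=
  [/\ (forall p, U p -> G (F p) = p),
      (forall q, U (G q) /\ F (G q) = q),
      smooth_map_on U F,
      smooth_map_on [set: N] G &
      pullback_on U F g h].

Definition prod_charted {R : realType} {m n : nat} (M : charted R m)
    (N : charted R n) : charted R (m + n) :=
  {| carrier := (M * N)%type ;
     chart_index := (chart_index M * chart_index N)%type ;
     chart_dom := fun ij => chart_dom ij.1 `*` chart_dom ij.2 ;
     chart_map := fun ij p => row_mx (chart_map ij.1 p.1) (chart_map ij.2 p.2) ;
     chart_inv := fun ij x =>
       (chart_inv ij.1 (lsubmx x), chart_inv ij.2 (rsubmx x)) |}.

(* (g + h) / psi^2 on the product *)
Definition conformal_prod {R : realType} {m n : nat} {M : charted R m}
    {N : charted R n} (g : metric_comp M) (h : metric_comp N)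
    (psi : prod_charted M N -> R) : metric_comp (prod_charted M N) :=
  fun ij x =>
    (psi (chart_inv ij x) ^- 2) *:
      block_mx (g ij.1 (lsubmx x)) 0 0 (h ij.2 (rsubmx x)).

Definition ginv {R : realType} {n : nat} (g : 'rV[R]_n -> 'M[R]_n)
    (i j : 'I_n) (x : 'rV[R]_n) : R := invmx (g x) i j.

(* Gamma^k_ij *)
Definition christoffel {R : realType} {n : nat} (g : 'rV[R]_n -> 'M[R]_n)
    (k i j : 'I_n) (x : 'rV[R]_n) : R :=
  2^-1 * \sum_l ginv g k l x *
    (pderiv (fun y => g y j l) i x + pderiv (fun y => g y i l) j x
     - pderiv (fun y => g y i j) l x).

(* dx^a (R(d_c, d_d) d_b), with R(X,Y) = [nabla_X, nabla_Y] - nabla_[X,Y] *)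
Definition riemann_up {R : realType} {n : nat} (g : 'rV[R]_n -> 'M[R]_n)
    (a b c d : 'I_n) (x : 'rV[R]_n) : R :=
  pderiv (christoffel g a d b) c x - pderiv (christoffel g a c b) d x
  + \sum_m (christoffel g a c m x * christoffel g m d b x
            - christoffel g a d m x * christoffel g m c b x).

(* R_abcd, with the sign making R_abab positive on round spheres *)
Definition riemann {R : realType} {n : nat} (g : 'rV[R]_n -> 'M[R]_n)
    (a b c d : 'I_n) (x : 'rV[R]_n) : R :=
  \sum_m g x a m * riemann_up g m b c d x.

Definition ricci {R : realType} {n : nat} (g : 'rV[R]_n -> 'M[R]_n)
    (b d : 'I_n) (x : 'rV[R]_n) : R :=
  \sum_a \sum_c ginv g a c x * riemann g a b c d x.

Definition scal {R : realType} {n : nat} (g : 'rV[R]_n -> 'M[R]_n)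
    (x : 'rV[R]_n) : R :=
  \sum_b \sum_d ginv g b d x * ricci g b d x.

Definition einstein {R : realType} {n : nat} (g : 'rV[R]_n -> 'M[R]_n)
    (i j : 'I_n) (x : 'rV[R]_n) : R :=
  ricci g i j x - scal g x / n%:R * g x i j.

(* For n >= 3 *)
Definition weyl {R : realType} {n : nat} (g : 'rV[R]_n -> 'M[R]_n)
    (a b c d : 'I_n) (x : 'rV[R]_n) : R :=
  riemann g a b c d x
  - (g x a c * ricci g b d x - g x a d * ricci g b c x
     + g x b d * ricci g a c x - g x b c * ricci g a d x) / (n%:R - 2)
  + scal g x * (g x a c * g x b d - g x a d * g x b c)
      / ((n%:R - 1) * (n%:R - 2)).

(* R_ikpq R_j^kpq *)
Definition riemann_square {R : realType} {n : nat} (g : 'rV[R]_n -> 'M[R]_n)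
    (i j : 'I_n) (x : 'rV[R]_n) : R :=
  \sum_k \sum_p \sum_q \sum_k' \sum_p' \sum_q'
    ginv g k k' x * ginv g p p' x * ginv g q q' x
    * riemann g i k p q x * riemann g j k' p' q' x.

Definition gauss {R : realType} (g : 'rV[R]_2 -> 'M[R]_2) (x : 'rV[R]_2) : R :=
  riemann g 0 1 0 1 x / \det (g x).

Definition hessian {R : realType} {n : nat} (g : 'rV[R]_n -> 'M[R]_n)
    (f : 'rV[R]_n -> R) (x : 'rV[R]_n) : 'M[R]_n :=
  \matrix_(i, j) (pderiv (pderiv f j) i x
                  - \sum_k christoffel g k i j x * pderiv f k x).

Definition laplacian {R : realType} {n : nat} (g : 'rV[R]_n -> 'M[R]_n)
    (f : 'rV[R]_n -> R) (x : 'rV[R]_n) : R :=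
  \sum_i \sum_j ginv g i j x * hessian g f x i j.

(* g(nabla f, nabla f) *)
Definition grad_sqr {R : realType} {n : nat} (g : 'rV[R]_n -> 'M[R]_n)
    (f : 'rV[R]_n -> R) (x : 'rV[R]_n) : R :=
  \sum_i \sum_j ginv g i j x * pderiv f i x * pderiv f j x.

Definition weakly_einstein {R : realType} {n : nat} (M : charted R n)
    (g : metric_comp M) : Prop :=
  exists phi : M -> R, smooth_fun phi /\
    forall (i : chart_index M) (x : 'rV[R]_n), chart_im i x ->
      forall a b, riemann_square (g i) a b x = phi (chart_inv i x) * g i x a b.

(* Whether a tensor vanishes at p does not depend on the chart used. *)
Definition einstein_nonzero_at {R : realType} {n : nat} (M : charted R n)
    (g : metric_comp M) (p : M) : Prop :=
  exists i : chart_index M, chart_dom i p /\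
    exists a b, einstein (g i) a b (chart_map i p) != 0.

Definition weyl_nonzero_at {R : realType} {n : nat} (M : charted R n)
    (g : metric_comp M) (p : M) : Prop :=
  exists i : chart_index M, chart_dom i p /\
    exists a b c d, weyl (g i) a b c d (chart_map i p) != 0.

Definition gauss_constant {R : realType} (M : charted R 2) (g : metric_comp M)
    (c : R) : Prop :=
  forall (i : chart_index M) (x : 'rV[R]_2), chart_im i x ->
    gauss (g i) x = c.

(* Main.v *)
(* Let S = K1 + K2 be the sum of the Gaussian curvatures of the two factors. The curvature of the
   conformal metric is psi^-2 (R(g1 + g2) + (g1 + g2) o B), with o the Kulkarni-Nomizu product and
   B = Hess(psi) / psi - |d psi|^2 / (2 psi^2) (g1 + g2). With T = tr B, the weak Einstein condition in
   an adapted orthonormal frame says that S + 2T annihilates the mixed Hessian M of psi, that T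
   annihilates the traceless parts of the Hessians along the two factors, and that S + T annihilates
   q = (K1 - K2) psi + (Laplacian of psi along the first factor minus the one along the second). The
   Weyl tensor vanishes exactly where S does, and the Einstein tensor exactly where M, the traceless
   parts and q do. Hence near the given point T / S is a root of (1 + x)(1 + 2x) x, and is constant.

   If S + 2T = 0, differentiating the resulting equations along both factors leads to a contradiction.
   If S + T = 0 or T = 0 then M = 0, and differentiating once more shows that psi depends on one
   factor only; the other factor then has constant curvature, and what remains of the equations is
   (ii) when S + T = 0 and (i) when T = 0. *)
From HB Require Import structures.
From mathcomp Require Import all_boot all_order all_algebra.
From mathcomp Require Import all_classical all_reals all_analysis.
From mathcomp Require Import ring lra.
Require Import Defs.
Set Implicit Arguments.
Unset Strict Implicit.
Unset Printing Implicit Defensive.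
Import Order.TTheory GRing.Theory Num.Theory.
Import numFieldNormedType.Exports.
Local Open Scope classical_set_scope.
Local Open Scope ring_scope.

(** * Smooth functions *)

Section SmoothToolkit.
Context {R : realType}.

(** Curvature is computed in the commutative ring of smooth functions on an open set of coordinates:
    there tensor identities are polynomial identities in commuting derivations, and evaluation at a
    point restores order and division by nonzero values. The ring has zero divisors, so the cubic
    equation for T / S does not split by itself; hence the concern with its constancy. The domain is
    a ball for the sup norm, which is convex and a product of two discs: functions without
    derivatives are constant on it, and the coordinates of two points recombine into a third point.
    When M = 0, the recombination turns the pointwise vanishing of products of derivatives along the
    two factors into the vanishing of one differential everywhere. When S + 2T = 0 and psi varies
    along both factors, the equations carry an integrability condition, whose derivatives give (2 l
    - psi S)^2 = 0 with l the Laplacian of psi plus psi S; this makes the gradient vanish. The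
    Einstein and Weyl tensors may be known to be nonzero in different charts; invariance of the
    Gaussian curvature carries S from one to the other. *)

Lemma open_near_eq (T : topologicalType) (U : Type) (D : set T) (f g : T -> U) x :
  open D -> (forall y, D y -> f y = g y) -> D x -> {near x, f =1 g}.
Proof.
move=> oD fg Dx.
have : nbhs x D by apply: open_nbhs_nbhs.
by apply: filterS => y Dy; apply: fg.
Qed.

(** The zero map serves as the differential. Locality of differentiability follows by writing g = f
    + (g - f); it is needed because smoothness on a set ignores the values elsewhere. *)
Lemma differentiable_near0 (V W : normedModType R) (h : V -> W) x :
  (\forall y \near x, h y = 0) -> differentiable h x.
Proof.
move=> h0; have hx : h x = 0 by exact: nbhs_singleton h0.
have eqo : h \o shift x = cst (h x) + (\0 : V -> W) +o_ 0 id.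
  apply/eqaddoP => e e0; rewrite hx.
  have : \forall y \near 0, h (y + x) = 0 by move: h0; rewrite (near_shift 0 x) subr0.
  apply: filterS => y /= hy.
  by rewrite !fctE /= hy addr0 subr0 normr0 mulr_ge0 // ltW.
have d0 : 'd h x = (\0 : V -> W) :> (V -> W).
  by apply: diff_unique eqo; exact: cst_continuous.
apply/diff_locallyP; split; last by rewrite d0.
by rewrite d0; exact: cst_continuous.
Qed.

Lemma differentiable_near (V W : normedModType R) (f g : V -> W) x :
  {near x, f =1 g} -> differentiable f x -> differentiable g x.
Proof.
move=> fg df; have -> : g = f + (g - f) by apply/funext => y; rewrite !fctE addrC subrK.
apply: differentiableD => //; apply: differentiable_near0.
by apply: filterS fg => y e; rewrite !fctE e subrr.
Qed.

Section OnOpen.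
Context {n : nat} {D : set 'rV[R]_n}.
Hypothesis oD : open D.

Lemma pderiv_eq_on (W : normedModType R) (f g : 'rV[R]_n -> W) k x :
  (forall y, D y -> f y = g y) -> D x -> pderiv f k x = pderiv g k x.
Proof. by move=> fg Dx; exact/near_eq_derive/(open_near_eq oD). Qed.

(** Openness of [D] lets equality on [D] pass to the partial derivatives. *)
Lemma smooth_upto_eq (W : normedModType R) r (f g : 'rV[R]_n -> W) :
  (forall y, D y -> f y = g y) -> smooth_upto r D f -> smooth_upto r D g.
Proof.
elim: r f g => [|r IH] f g fg /= [df sf]; split=> //.
- by move=> x Dx; apply: differentiable_near (df x Dx); exact: open_near_eq oD _ _.
- by move=> x Dx; apply: differentiable_near (df x Dx); exact: open_near_eq oD _ _.
- by move=> k; apply: IH (sf k) => y Dy; exact: pderiv_eq_on.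
Qed.

Lemma smooth_uptoW (W : normedModType R) r (f : 'rV[R]_n -> W) :
  smooth_upto r.+1 D f -> smooth_upto r D f.
Proof.
elim: r f => [|r IH] f [df sf] //=; split=> // k.
by apply: IH; exact: sf.
Qed.

Lemma smooth_upto_cst (W : normedModType R) r (w : W) :
  smooth_upto r D (fun _ : 'rV[R]_n => w).
Proof.
elim: r w => [|r IH] w /=; split=> //.
move=> k; have -> : pderiv (fun=> w) k = (fun _ : 'rV[R]_n => 0 : W); last exact: IH.
by apply/funext => x; exact: derive_cst.
Qed.

Lemma smooth_uptoD (W : normedModType R) r (f g : 'rV[R]_n -> W) :
  smooth_upto r D f -> smooth_upto r D g -> smooth_upto r D (fun x => f x + g x).
Proof.
elim: r f g => [|r IH] f g /= [df sf] [dg sg]; split=> //.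
- by move=> x Dx; apply: differentiableD; [exact: df|exact: dg].
- by move=> x Dx; apply: differentiableD; [exact: df|exact: dg].
- move=> k; apply: smooth_upto_eq (IH _ _ (sf k) (sg k)) => y Dy.
  by rewrite /pderiv [RHS](@deriveD _ _ _ f g) //; apply: diff_derivable; [exact: df|exact: dg].
Qed.

Lemma smooth_uptoM r (f g : 'rV[R]_n -> R) :
  smooth_upto r D f -> smooth_upto r D g -> smooth_upto r D (fun x => f x * g x).
Proof.
elim: r f g => [|r IH] f g sf' sg'; have [df sf] := sf'; have [dg sg] := sg'; split=> //.
- by move=> x Dx; apply: differentiableM; [exact: df|exact: dg].
- by move=> x Dx; apply: differentiableM; [exact: df|exact: dg].
- move=> k; have := smooth_uptoD (IH _ _ (smooth_uptoW sf') (sg k)) (IH _ _ (smooth_uptoW sg') (sf k)).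
  apply: smooth_upto_eq => y Dy.
  by rewrite /pderiv [RHS](@deriveM _ _ f g) //; apply: diff_derivable; [exact: df|exact: dg].
Qed.

(** The derivative of 1/f is -(1/f)^2 f', so order r + 1 of the inverse only calls for its order
    r. *)
Lemma smooth_uptoV r (f : 'rV[R]_n -> R) : (forall x, D x -> f x != 0) ->
  smooth_upto r D f -> smooth_upto r D (fun x => (f x)^-1).
Proof.
move=> f0; elim: r => [|r IH] sf'; have [df sf] := sf'; split=> //.
- by move=> x Dx; apply: differentiableV; [exact: df|exact: f0].
- by move=> x Dx; apply: differentiableV; [exact: df|exact: f0].
- move=> k; have sV := IH (smooth_uptoW sf').
  have := smooth_uptoM (smooth_upto_cst r (-1 : R)) (smooth_uptoM (smooth_uptoM sV sV) (sf k)).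
  apply: smooth_upto_eq => y Dy.
  rewrite /pderiv [RHS](@deriveV _ _ f); [|exact: f0|by apply: diff_derivable; exact: df].
  by rewrite -expr2 mulN1r exprVn scaleNr.
Qed.

Lemma smooth_upto_sum (W : normedModType R) r (I : Type) (s : seq I) (f : I -> 'rV[R]_n -> W) :
  (forall i, smooth_upto r D (f i)) -> smooth_upto r D (fun x => \sum_(i <- s) f i x).
Proof.
move=> sf; elim: s => [|i s IH].
  by under eq_fun do rewrite big_nil; exact: smooth_upto_cst.
by under eq_fun do rewrite big_cons; exact: smooth_uptoD.
Qed.

Lemma differentiable_mx m p (f : 'rV[R]_n -> 'M[R]_(m, p)) x :
  (forall i j, differentiable (fun y => f y i j) x) -> differentiable f x.
Proof.
move=> df; have -> : f = \sum_i \sum_j (fun y => f y i j *: delta_mx i j).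
  apply/funext => y; rewrite [LHS]matrix_sum_delta fct_sumE.
  by apply: eq_bigr => i _; rewrite fct_sumE.
apply: differentiable_sum => i; apply: differentiable_sum => j.
exact: differentiableZl.
Qed.

Lemma differentiable_entry m p (f : 'rV[R]_n -> 'M[R]_(m, p)) x i j :
  differentiable f x -> differentiable (fun y => f y i j) x.
Proof.
move=> df; apply: (@differentiable_comp _ _ _ _ f (fun M : 'M[R]_(m, p) => M i j)) => //.
exact: differentiable_coord.
Qed.

Lemma pderiv_entry m p (f : 'rV[R]_n -> 'M[R]_(m, p)) x k i j :
  differentiable f x -> pderiv f k x i j = pderiv (fun y => f y i j) k x.
Proof.
by move=> df; rewrite /pderiv derive_mx ?mxE //; exact: diff_derivable.
Qed.

(** Metrics and coordinate changes are matrix-valued, whereas the ring of functions below is built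
    from scalar ones. *)
Lemma smooth_upto_mx m p r (f : 'rV[R]_n -> 'M[R]_(m, p)) :
  (forall i j, smooth_upto r D (fun y => f y i j)) <-> smooth_upto r D f.
Proof.
elim: r f => [|r IH] f; split.
- by move=> sf; split=> // x Dx; apply: differentiable_mx => i j; exact: (sf i j).1.
- by move=> [df _] i j; split=> // x Dx; apply: differentiable_entry; exact: df.
- move=> sf; have df x : D x -> differentiable f x.
    by move=> Dx; apply: differentiable_mx => i j; exact: (sf i j).1.
  split=> // k; apply/IH => i j; apply: smooth_upto_eq ((sf i j).2 k) => y Dy.
  by rewrite pderiv_entry //; exact: df.
- move=> [df sf] i j; split; first by move=> x Dx; apply: differentiable_entry; exact: df.
  move=> k; apply: smooth_upto_eq ((IH _).2 (sf k) i j) => y Dy.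
  by rewrite pderiv_entry //; exact: df.
Qed.

End OnOpen.

Lemma smooth_upto_subset n (D D' : set 'rV[R]_n) (W : normedModType R) r (f : 'rV[R]_n -> W) :
  D' `<=` D -> smooth_upto r D f -> smooth_upto r D' f.
Proof.
move=> DD; elim: r f => [|r IH] f [df sf]; split=> //.
- by move=> x /DD; exact: df.
- by move=> x /DD; exact: df.
- by move=> k; apply: IH; exact: sf.
Qed.

Lemma pderiv_comp m n (h : 'rV[R]_n -> R) (f : 'rV[R]_m -> 'rV[R]_n) k x :
  differentiable f x -> differentiable h (f x) ->
  pderiv (h \o f) k x = \sum_j pderiv h j (f x) * pderiv (fun y => f y 0 j) k x.
Proof.
move=> df dh; have dhf := differentiable_comp df dh.
have -> : pderiv (h \o f) k x = 'd h (f x) (pderiv f k x).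
  by rewrite /pderiv deriveE // diff_comp //= [in RHS]deriveE.
rewrite [in LHS](row_sum_delta (pderiv f k x)) linear_sum.
apply: eq_bigr => j _; rewrite linearZ /= -pderiv_entry // /pderiv [in RHS](deriveE _ dh).
exact: mulrC.
Qed.

(** By the chain rule, a partial derivative of the composite is a sum of products of partial
    derivatives of h, composed with f, and of partial derivatives of f. The induction therefore
    varies h and keeps f. *)
Lemma smooth_upto_comp m n (D : set 'rV[R]_m) (D' : set 'rV[R]_n)
    (h : 'rV[R]_n -> R) (f : 'rV[R]_m -> 'rV[R]_n) r :
  open D -> open D' -> (forall x, D x -> D' (f x)) ->
  smooth_upto r D' h -> smooth_upto r D f -> smooth_upto r D (h \o f).
Proof.
move=> oD oD' fD; elim: r h => [|r IH] h sh' sf'.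
- have [dh sh] := sh'; have [df sf] := sf'; split=> // x Dx.
  by apply: differentiable_comp; [exact: df|apply: dh; exact: fD].
- have [dh sh] := sh'; have [df sf] := sf'; split=> [x Dx|k].
    by apply: differentiable_comp; [exact: df|apply: dh; exact: fD].
  have hc y : D y -> \sum_j (pderiv h j \o f) y * pderiv (fun y => f y 0 j) k y = pderiv (h \o f) k y.
    by move=> Dy; rewrite pderiv_comp //; [exact: df|apply: dh; exact: fD].
  apply: (smooth_upto_eq oD hc); apply: (smooth_upto_sum oD) => j.
  apply: (smooth_uptoM oD); first by apply: IH (sh j) (smooth_uptoW sf').
  by apply: ((smooth_upto_mx oD r.+1 f).2 sf' 0 j).2.
Qed.

End SmoothToolkit.

(** * Symmetry of second derivatives *)

Section Schwarz.
Context {R : realType}.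

(** The difference quotients of the restriction to the line and of f along u are the same function
    of the increment. *)
Lemma is_derive_line (V W : normedModType R) (f : V -> W) (w u : V) (s : R) (df : W) :
  is_derive (s *: u + w) u f df -> is_derive s (1 : R) (fun t : R => f (t *: u + w)) df.
Proof.
have e : (fun h : R => h^-1 *: ((f \o shift (s *: u + w)) (h *: u) - f (s *: u + w)))
   = (fun h : R => h^-1 *: (((fun t : R => f (t *: u + w)) \o shift s) (h *: (1 : R)) - f (s *: u + w))).
  by apply/funext => h /=; rewrite [h *: 1]mulr1 scalerDl addrA.
case=> df1 df2; split; first by move: df1; rewrite /derivable e.
by rewrite -df2 /derive e.
Qed.

(** The mean value theorem in the direction u, applied to the difference of f along two parallel
    segments, leaves a difference of two values of ['D_u f] near x, which the differential of
    ['D_u f] at x approximates. *)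
Lemma second_difference (V : normedModType R) (f : V -> R) (D : set V) (x u v : V) :
  open D -> D x -> (forall y, D y -> differentiable f y) ->
  differentiable ('D_u f) x -> forall e : R, 0 < e ->
  exists2 d : R, 0 < d & forall h, 0 < h < d ->
    `|f (h *: u + h *: v + x) - f (h *: u + x) - f (h *: v + x) + f x
      - h ^+ 2 * 'D_v ('D_u f) x| <= e * h ^+ 2.
Proof.
move=> oD Dx df dF e e0; set F := 'D_u f in dF *.
(* h C bounds |xi u| + |xi u + h v| whenever 0 <= xi <= h; the summand 1 makes C positive. *)
set C := 2 * `|u| + `|v| + 1; have C0 : 0 < C.
  by rewrite /C ltr_wpDl // addr_ge0 // mulr_ge0.
have eC0 : 0 < e / C by rewrite divr_gt0.
have [r r0 Dr] : exists2 r : R, 0 < r & forall w, `|w| < r -> D (w + x).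
  have [r /= r0 rD] : nbhs_ball x D by rewrite nbhs_ballE; exact: open_nbhs_nbhs.
  exists r => // w wr; apply: rD; rewrite -ball_normE /ball_ /=.
  by rewrite opprD addrC subrK normrN.
have [r' r'0 Fr] : exists2 r' : R, 0 < r' & forall w, `|w| < r' ->
    `|F (w + x) - F x - 'd F x w| <= e / C * `|w|.
  have /eqaddoP /(_ _ eC0) := diff_locally dF.
  move=> /nbhs_ballP[r' /= r'0 rH]; exists r' => // w wr.
  have /rH : ball (0 : V) r' w by rewrite -ball_normE /ball_ /= sub0r normrN.
  by rewrite !fctE opprD addrA.
pose d := Num.min r r' / C; exists d.
  by rewrite divr_gt0 // lt_min r0.
move=> h /andP[h0 hd].
have small s : 0 <= s <= h -> `|s *: u| < Num.min r r' /\ `|s *: u + h *: v| < Num.min r r'.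
  move=> /andP[s0 sh]; have hC : h * C < Num.min r r' by rewrite -ltr_pdivlMr.
  have h1 : `|s *: u| <= h * `|u| by rewrite normrZ (ger0_norm s0) ler_wpM2r.
  have h2 : `|h *: v| = h * `|v| by rewrite normrZ (gtr0_norm h0).
  have ? := normr_ge0 u; have ? := normr_ge0 v.
  have hu : 0 <= h * `|u| by rewrite mulr_ge0 // ltW.
  have hv : 0 <= h * `|v| by rewrite mulr_ge0 // ltW.
  have hCE : h * C = 2 * (h * `|u|) + h * `|v| + h by rewrite /C; ring.
  split; first by apply: le_lt_trans hC; rewrite hCE; lra.
  apply: le_lt_trans hC; apply: le_trans (ler_normD _ _) _; rewrite hCE h2; lra.
(* The second difference is [phi h - phi 0]. *)
pose phi (s : R) : R := f (s *: u + (h *: v + x)) - f (s *: u + x).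
pose phi' (s : R) : R := F (s *: u + (h *: v + x)) - F (s *: u + x).
have dphi s : 0 <= s <= h -> is_derive s (1 : R) phi (phi' s).
  move=> /small[]; rewrite !lt_min => /andP[/Dr D1 _] /andP[/Dr D2 _].
  rewrite -addrA in D2.
  by apply: is_deriveB; apply: is_derive_line; apply: derivableP; apply: diff_derivable; exact: df.
have [||xi xih phiE] := @MVT _ phi phi' 0 h h0.
- by move=> s; rewrite in_itv /= => /andP[s0 sh]; apply: dphi; rewrite !ltW.
- apply: derivable_within_continuous => s; rewrite in_itv /= => sh.
  by have [] := dphi s sh.
move: xih; rewrite in_itv /= => /andP[xi0 xih].
have sxi : 0 <= xi <= h by rewrite !ltW.
have [] := small xi sxi; rewrite !lt_min => /andP[_ s1] /andP[_ s2].
have := Fr _ s1; have := Fr _ s2; rewrite -(addrA (xi *: u)) => e1 e2.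
have n1 : `|xi *: u| <= h * `|u| by rewrite normrZ (gtr0_norm xi0) ler_wpM2r // ltW.
have n2 : `|xi *: u + h *: v| <= h * `|u| + h * `|v|.
  by apply: le_trans (ler_normD _ _) _; rewrite lerD // normrZ (gtr0_norm h0).
have -> : f (h *: u + h *: v + x) - f (h *: u + x) - f (h *: v + x) + f x = phi' xi * h.
  move: phiE; rewrite /phi !scale0r !add0r subr0 => <-; rewrite -(addrA (h *: u)); ring.
have -> : phi' xi * h - h ^+ 2 * 'D_v F x =
   h * ((F (xi *: u + (h *: v + x)) - F x - 'd F x (xi *: u + h *: v))
       - (F (xi *: u + x) - F x - 'd F x (xi *: u))).
  have lin : 'd F x (xi *: u + h *: v) = 'd F x (xi *: u) + h * 'd F x v.
    by rewrite linearD [X in _ + X]linearZ.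
  by rewrite deriveE // lin /phi'; ring.
rewrite normrM (gtr0_norm h0) expr2 mulrCA ler_pM2l //.
apply: le_trans (ler_normB _ _) _; apply: le_trans (lerD e1 e2) _.
rewrite -mulrDr -mulrA ler_pM2l // mulrC ler_pdivrMr //.
have ? := normr_ge0 u; have ? := normr_ge0 v.
have -> : h * C = 2 * (h * `|u|) + h * `|v| + h by rewrite /C; ring.
lra.
Qed.

Lemma approx_twice (A P Q s e : R) : 0 < s ->
  `|A - s * P| <= e / 2 * s -> `|A - s * Q| <= e / 2 * s -> `|P - Q| <= e.
Proof.
move=> s0 h1 h2; rewrite -(ler_pM2l s0) -[X in X * `|_|](gtr0_norm s0) -normrM.
have -> : s * (P - Q) = (A - s * Q) - (A - s * P) by ring.
apply: le_trans (ler_normB _ _) _; apply: le_trans (lerD h2 h1) _; lra.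
Qed.

(** The second difference is symmetric in u and v, so h^2 times either iterated derivative
    approximates the same number. *)
Lemma schwarz (V : normedModType R) (f : V -> R) (D : set V) (x u v : V) :
  open D -> D x -> (forall y, D y -> differentiable f y) ->
  differentiable ('D_u f) x -> differentiable ('D_v f) x ->
  'D_v ('D_u f) x = 'D_u ('D_v f) x.
Proof.
move=> oD Dx df du dv; apply/eqP; rewrite -subr_eq0 -normr_le0.
apply/ler_addgt0Pr => e e0; rewrite add0r.
have e20 : 0 < e / 2 by rewrite divr_gt0.
have [d1 d10 H1] := second_difference v oD Dx df du e20.
have [d2 d20 H2] := second_difference u oD Dx df dv e20.
pose h := Num.min d1 d2 / 2.
have hm : 0 < Num.min d1 d2 by rewrite lt_min d10.
have h0 : 0 < h by rewrite divr_gt0.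
have hlt : h < Num.min d1 d2 by rewrite /h; lra.
move: (hlt); rewrite lt_min => /andP[h1 h2].
have {}H1 := H1 h; have {}H2 := H2 h; move: H1 H2; rewrite h0 h1 h2 => /(_ isT) H1 /(_ isT).
rewrite [h *: v + h *: u]addrC => H2.
have h20 : 0 < h ^+ 2 by rewrite exprn_gt0.
rewrite [_ - f (h *: v + x) - f (h *: u + x)]addrAC in H2.
exact: approx_twice h20 H1 H2.
Qed.

Lemma pderivC n (D : set 'rV[R]_n) (f : 'rV[R]_n -> R) x k l :
  open D -> D x -> smooth_upto 2 D f ->
  pderiv (pderiv f k) l x = pderiv (pderiv f l) k x.
Proof.
by move=> oD Dx [df sf]; exact: (schwarz oD Dx df ((sf k).1 x Dx) ((sf l).1 x Dx)).
Qed.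

End Schwarz.

(** * The ring of smooth functions on a domain *)

Section SmoothRing.
Context {R : realType} {n : nat}.

(* Nonemptiness makes 1 differ from 0 in the ring below. *)
Record odom := Odom {
  dom :> set 'rV[R]_n ;
  dom_open : open dom ;
  dom_neq0 : dom !=set0 }.

(* Extension by 0 outside D makes Leibniz equality the same as equality on D. *)
Record sfun (D : odom) := SFun {
  sfval :> 'rV[R]_n -> R ;
  sfval_smooth : smooth_on D sfval ;
  sfval_out : forall x, ~ dom D x -> sfval x = 0 }.

Context {D : odom}.
Implicit Types f g h : sfun D.

Lemma sfunP f g : (forall x, dom D x -> f x = g x) -> f = g.
Proof.
case: f g => f sf f0 [g sg g0] /= fg.
have e : f = g.
  by apply/funext => x; have [/fg//|nD] := pselect (dom D x); rewrite f0 ?g0.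
by subst g; rewrite (Prop_irrelevance sf sg) (Prop_irrelevance f0 g0).
Qed.

Definition cut (f : 'rV[R]_n -> R) (x : 'rV[R]_n) : R := if `[< dom D x >] then f x else 0.

Lemma cutE (f0 : 'rV[R]_n -> R) x : dom D x -> cut f0 x = f0 x.
Proof. by move=> Dx; rewrite /cut asboolT. Qed.

Lemma cut_out (f0 : 'rV[R]_n -> R) x : ~ dom D x -> cut f0 x = 0.
Proof. by move=> Dx; rewrite /cut asboolF. Qed.

Lemma cut_smooth (f0 : 'rV[R]_n -> R) : smooth_on D f0 -> smooth_on D (cut f0).
Proof.
by move=> sf r; apply: smooth_upto_eq (sf r) => [|y Dy]; [exact: dom_open|rewrite cutE].
Qed.

Definition mksf (f0 : 'rV[R]_n -> R) (sf : smooth_on D f0) : sfun D := SFun (cut_smooth sf) (@cut_out f0).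

Lemma mksfE (f0 : 'rV[R]_n -> R) (sf : smooth_on D f0) x : dom D x -> mksf sf x = f0 x.
Proof. exact: cutE. Qed.

HB.instance Definition _ := gen_eqMixin (sfun D).
HB.instance Definition _ := gen_choiceMixin (sfun D).

Let oD := @dom_open D.

Fact sf_cst_subproof (c : R) : smooth_on D (fun=> c).
Proof. by move=> r; exact: smooth_upto_cst. Qed.
Fact sf_add_subproof f g : smooth_on D (fun x => f x + g x).
Proof. by move=> r; apply: (smooth_uptoD oD); exact: sfval_smooth. Qed.
Fact sf_mul_subproof f g : smooth_on D (fun x => f x * g x).
Proof. by move=> r; apply: (smooth_uptoM oD); exact: sfval_smooth. Qed.
(** Negation is written as multiplication by the constant -1, so that its smoothness is that of a
    product. *)
Fact sf_opp_subproof f : smooth_on D (fun x => -1 * f x).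
Proof.
by move=> r; apply: (smooth_uptoM oD); [exact: smooth_upto_cst|exact: sfval_smooth].
Qed.
Definition sf_cst c := mksf (sf_cst_subproof c).
Definition sf_add f g := mksf (sf_add_subproof f g).
Definition sf_mul f g := mksf (sf_mul_subproof f g).
Definition sf_opp f := mksf (sf_opp_subproof f).
(** A nonzero function may still be a zero divisor; cancelling a factor in the ring calls for
    membership in this set. *)
Definition sf_unit : {pred sfun D} := fun f => `[< forall x, dom D x -> f x != 0 >].
Fact sf_inv_subproof f : sf_unit f -> smooth_on D (fun x => (f x)^-1).
Proof.
by move=> /asboolP uf r; apply: (smooth_uptoV oD); [exact: uf|exact: sfval_smooth].
Qed.
(** Off the units the inverse is the identity, the default value that the structure of a unit ring
    demands. *)
Definition sf_inv f : sfun D :=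
  match pselect (sf_unit f) with
  | left uf => mksf (sf_inv_subproof uf)
  | right _ => f
  end.

Fact sf_addA : associative sf_add.
Proof. by move=> f g h; apply: sfunP => x Dx; rewrite !mksfE // addrA. Qed.
Fact sf_addC : commutative sf_add.
Proof. by move=> f g; apply: sfunP => x Dx; rewrite !mksfE // addrC. Qed.
Fact sf_add0 : left_id (sf_cst 0) sf_add.
Proof. by move=> f; apply: sfunP => x Dx; rewrite !mksfE // add0r. Qed.
Fact sf_addN : left_inverse (sf_cst 0) sf_opp sf_add.
Proof. by move=> f; apply: sfunP => x Dx; rewrite !mksfE // mulN1r addNr. Qed.
HB.instance Definition _ := GRing.isZmodule.Build (sfun D) sf_addA sf_addC sf_add0 sf_addN.

Fact sf_mulA : associative sf_mul.
Proof. by move=> f g h; apply: sfunP => x Dx; rewrite !mksfE // mulrA. Qed.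
Fact sf_mulC : commutative sf_mul.
Proof. by move=> f g; apply: sfunP => x Dx; rewrite !mksfE // mulrC. Qed.
Fact sf_mul1 : left_id (sf_cst 1) sf_mul.
Proof. by move=> f; apply: sfunP => x Dx; rewrite !mksfE // mul1r. Qed.
Fact sf_mulD : left_distributive sf_mul sf_add.
Proof. by move=> f g h; apply: sfunP => x Dx; rewrite !mksfE // mulrDl. Qed.
Fact sf_1neq0 : sf_cst 1 != 0.
Proof.
apply/eqP => e; have [x Dx] := @dom_neq0 D.
have : sf_cst 1 x = sf_cst 0 x by rewrite e.
by rewrite !mksfE // => /eqP; rewrite oner_eq0.
Qed.
HB.instance Definition _ := GRing.Zmodule_isComNzRing.Build (sfun D)
  sf_mulA sf_mulC sf_mul1 sf_mulD sf_1neq0.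

Fact sf_mulVx : {in sf_unit, left_inverse 1 sf_inv *%R}.
Proof.
move=> f uf; rewrite /sf_inv; case: pselect => // u; apply: sfunP => x Dx.
rewrite [LHS]mksfE // !mksfE // mulVf //.
by move: uf => /asboolP; apply.
Qed.
Fact sf_unitPl f g : g * f = 1 -> sf_unit f.
Proof.
move=> gf; apply/asboolP => x Dx; apply/eqP => f0.
have : (g * f : sfun D) x = (1 : sfun D) x by rewrite gf.
by rewrite [LHS]mksfE // [RHS]mksfE // f0 mulr0 => /esym/eqP; rewrite oner_eq0.
Qed.
Fact sf_invr_out : {in [predC sf_unit], sf_inv =1 id}.
Proof. by move=> f; rewrite inE /sf_inv; case: pselect => // + /negP. Qed.
HB.instance Definition _ := GRing.ComNzRing_hasMulInverse.Build (sfun D)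
  sf_mulVx sf_unitPl sf_invr_out.

Lemma sf_unitP f : reflect (forall x, dom D x -> f x != 0) (f \is a GRing.unit).
Proof. exact: asboolP. Qed.

(** The proof of membership is an argument because at a point outside [D] every function takes the
    value 0, and evaluation there does not preserve 1. *)
Definition ev x (Dx : dom D x) f : R := f x.

Fact ev_zmod x (Dx : dom D x) : zmod_morphism (ev Dx).
Proof. by move=> f g; rewrite /ev [LHS]mksfE // mksfE // mulN1r. Qed.
Fact ev_monoid x (Dx : dom D x) : monoid_morphism (ev Dx).
Proof. by split=> [|f g]; rewrite /ev [LHS]mksfE. Qed.
HB.instance Definition _ x (Dx : dom D x) := GRing.isZmodMorphism.Build _ _ (ev Dx) (ev_zmod Dx).
HB.instance Definition _ x (Dx : dom D x) := GRing.isMonoidMorphism.Build _ _ (ev Dx) (ev_monoid Dx).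

Lemma sfun_evP f g : (forall x (Dx : dom D x), ev Dx f = ev Dx g) -> f = g.
Proof. by move=> fg; apply: sfunP => x Dx; exact: fg. Qed.

Fact pd_subproof k f : smooth_on D (pderiv f k).
Proof. by move=> r; exact: (sfval_smooth f r.+1).2. Qed.
Definition pd k f : sfun D := mksf (pd_subproof k f).

Lemma pdD k f g : pd k (f + g) = pd k f + pd k g.
Proof.
apply: sfunP => x Dx; rewrite mksfE // [RHS]mksfE // !mksfE //.
rewrite (@pderiv_eq_on _ _ _ oD _ _ (f \+ g)) //; last by move=> y Dy; exact: mksfE.
by apply: deriveD; apply: diff_derivable; exact: (sfval_smooth _ 0).1.
Qed.

Lemma pdM k f g : pd k (f * g) = pd k f * g + f * pd k g.
Proof.
apply: sfunP => x Dx; rewrite mksfE // [RHS]mksfE // [in RHS]mksfE // !mksfE //.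
rewrite (@pderiv_eq_on _ _ _ oD _ _ (f \* g)) //; last by move=> y Dy; exact: mksfE.
rewrite /pderiv [LHS](@deriveM _ _ f g); [|by apply: diff_derivable; exact: (sfval_smooth _ 0).1..].
by rewrite addrC [_ *: _]mulrC.
Qed.

Lemma pdC k l f : pd k (pd l f) = pd l (pd k f).
Proof.
apply: sfunP => x Dx.
have pdpd i j : pd i (pd j f) x = pderiv (pderiv f j) i x.
  rewrite [LHS]mksfE //.
  by apply: (pderiv_eq_on oD) Dx => y Dy; rewrite [LHS]mksfE.
have C : pderiv (pderiv f l) k x = pderiv (pderiv f k) l x.
  by apply: (@pderivC R n (dom D) f x l k oD Dx); have := @sfval_smooth D f 2.
exact: etrans (pdpd k l) (etrans C (esym (pdpd l k))).
Qed.

End SmoothRing.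
Arguments odom : clear implicits.
Arguments ev : simpl never.

(* Coordinate vector fields are only used through these rules, so tensor identities are proved
   over an arbitrary commutative ring with commuting derivations. *)
Record dfam (S : comUnitRingType) (n : nat) := Dfam {
  dv :> 'I_n -> S -> S ;
  dvD : forall k f g, dv k (f + g) = dv k f + dv k g ;
  dvM : forall k f g, dv k (f * g) = dv k f * g + f * dv k g ;
  dvC : forall k l f, dv k (dv l f) = dv l (dv k f) }.

(** The map [e] selects coordinate directions: all of them, or those along one factor of a
    product. *)
Definition pdfam (R : realType) n (D : odom R n) m (e : 'I_m -> 'I_n) : dfam (sfun D) m :=
  @Dfam (sfun D) m (fun k => pd (e k)) (fun k => @pdD R n D (e k)) (fun k => @pdM R n D (e k))
    (fun k l => @pdC R n D (e k) (e l)).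

(** * Curvature over a ring with derivations *)

Section Derivations.
Context {S : comUnitRingType} {n : nat} (d : dfam S n).

Lemma dv0 k : d k 0 = 0.
Proof. by apply: (addIr (d k 0)); rewrite -dvD !add0r. Qed.

Lemma dvN k f : d k (- f) = - d k f.
Proof. by apply: (addIr (d k f)); rewrite -dvD !addNr dv0. Qed.

Lemma dvB k f g : d k (f - g) = d k f - d k g.
Proof. by rewrite dvD dvN. Qed.

Lemma dv1 k : d k 1 = 0.
Proof. by apply: (addIr (d k 1)); rewrite -{3}[1]mulr1 dvM mulr1 mul1r add0r. Qed.

Lemma dvMn k f m : d k (f *+ m) = d k f *+ m.
Proof. by elim: m => [|m IH]; rewrite ?mulr0n ?dv0 // !mulrS dvD IH. Qed.

Lemma dv_nat k m : d k m%:R = 0.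
Proof. by rewrite dvMn dv1 mul0rn. Qed.

Lemma dvV k f : f \is a GRing.unit -> d k f^-1 = - (f^-1 * f^-1 * d k f).
Proof.
move=> uf; have : d k (f * f^-1) = 0 by rewrite mulrV // dv1.
rewrite dvM => /(congr1 (fun x => f^-1 * x)); rewrite mulr0 mulrDr [f^-1 * (f * _)]mulrA mulVr // mul1r.
by move/(canRL (addKr _)); rewrite addr0 => ->; rewrite mulrCA mulrA mulrC; ring.
Qed.

(** In both cases 2^-1 is a constant: if 2 is not a unit, its inverse is 2 by convention. *)
Lemma dv_half k : d k (2^-1) = 0.
Proof.
have [u2|nu2] := boolP ((2 : S) \is a GRing.unit).
  by rewrite dvV // dv_nat mulr0 oppr0.
by rewrite invr_out // dv_nat.
Qed.

Lemma dv_sum (I : Type) (s : seq I) k (F : I -> S) :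
  d k (\sum_(i <- s) F i) = \sum_(i <- s) d k (F i).
Proof. by elim: s => [|i s IH]; rewrite ?big_nil ?dv0 // !big_cons dvD IH. Qed.

End Derivations.

Section AlgebraicCurvature.
Context {S : comUnitRingType} {n : nat} (d : dfam S n).
Implicit Types (G : 'M[S]_n) (f : S).

(** The arguments are components of covectors, hence the inverse matrix. *)
Definition ip G (X Y : 'I_n -> S) : S := \sum_m \sum_l invmx G m l * X m * Y l.

(* Christoffel symbols with the upper index lowered into the first place. *)
Definition chl G (a i j : 'I_n) : S :=
  2^-1 * (d i (G j a) + d j (G i a) - d a (G i j)).

Definition chr G (k i j : 'I_n) : S :=
  2^-1 * \sum_l invmx G k l * (d i (G j l) + d j (G i l) - d l (G i j)).

Definition rup G (a b c e : 'I_n) : S :=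
  d c (chr G a e b) - d e (chr G a c b)
  + \sum_m (chr G a c m * chr G m e b - chr G a e m * chr G m c b).

Definition rie G (a b c e : 'I_n) : S := \sum_m G a m * rup G m b c e.

Definition hes G f (i j : 'I_n) : S := d i (d j f) - \sum_k chr G k i j * d k f.

Definition lap G f : S := \sum_i \sum_j invmx G i j * hes G f i j.

Definition gsq G f : S := ip G (d^~ f) (d^~ f).

Section Fixed.
Variable G : 'M[S]_n.
Hypotheses (uG : G \in unitmx) (sG : forall i j, G i j = G j i).
Hypothesis (u2 : (2 : S) \is a GRing.unit).

Lemma ipDl X X' Y : ip G (fun m => X m + X' m) Y = ip G X Y + ip G X' Y.
Proof.
rewrite /ip -big_split /=; apply: eq_bigr => i _; rewrite -big_split /=.
by apply: eq_bigr => j _; ring.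
Qed.

Lemma ipZl c X Y : ip G (fun m => c * X m) Y = c * ip G X Y.
Proof.
rewrite /ip mulr_sumr; apply: eq_bigr => i _; rewrite mulr_sumr.
by apply: eq_bigr => j _; ring.
Qed.

Lemma invmx_sym i j : invmx G i j = invmx G j i.
Proof.
have /matrixP/(_ i j) : invmx G = (invmx G)^T.
  by rewrite trmx_inv; congr invmx; apply/matrixP => a b; rewrite mxE sG.
by rewrite mxE.
Qed.

Lemma ipC X Y : ip G X Y = ip G Y X.
Proof.
rewrite /ip exchange_big; apply: eq_bigr => i _; apply: eq_bigr => j _.
by rewrite invmx_sym; ring.
Qed.

Lemma ipDr X Y Y' : ip G X (fun m => Y m + Y' m) = ip G X Y + ip G X Y'.
Proof. by rewrite ipC ipDl !(ipC X). Qed.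

Lemma ipZr c X Y : ip G X (fun m => c * Y m) = c * ip G X Y.
Proof. by rewrite ipC ipZl (ipC X). Qed.

Lemma ip_sumr X Y : ip G X Y = \sum_m (\sum_l invmx G m l * Y l) * X m.
Proof.
apply: eq_bigr => i _; rewrite mulr_suml; apply: eq_bigr => j _; ring.
Qed.

Lemma ip_metric a Y : ip G (fun m => G m a) Y = Y a.
Proof.
rewrite /ip exchange_big /=.
transitivity (\sum_j (G *m invmx G) a j * Y j).
  apply: eq_bigr => j _; rewrite mxE mulr_suml; apply: eq_bigr => i _.
  by rewrite sG mulrAC mulrC [invmx G i j * _]mulrC mulrA [X in X * _]mulrC; ring.
rewrite mulmxV // (bigD1 a) //= big1 ?addr0 ?mxE ?eqxx ?mul1r // => j ja.
by rewrite mxE eq_sym (negPf ja) mul0r.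
Qed.

Lemma chrE k i j : chr G k i j = \sum_l invmx G k l * chl G l i j.
Proof. by rewrite /chr mulr_sumr; apply: eq_bigr => l _; rewrite /chl; ring. Qed.

Lemma chlE a i j : chl G a i j = \sum_k G a k * chr G k i j.
Proof.
rewrite -(ip_metric a (fun l => chl G l i j)) ip_sumr; apply: eq_bigr => k _.
by rewrite chrE mulrC sG.
Qed.

Lemma chlC a i j : chl G a i j = chl G a j i.
Proof. by rewrite /chl (sG i j); ring. Qed.

Lemma chrC k i j : chr G k i j = chr G k j i.
Proof. by rewrite !chrE; apply: eq_bigr => l _; rewrite chlC. Qed.

Lemma half2 (x : S) : 2^-1 * (x + x) = x.
Proof. by rewrite -mulr2n -[x *+ 2]mulr_natl mulKr. Qed.

Lemma dG k i j : d k (G i j) = chl G i k j + chl G j k i.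
Proof.
rewrite /chl (sG k i) (sG k j) (sG j i) -{1}(half2 (d k (G i j))); ring.
Qed.

Lemma sum_chr_ip X i j : \sum_m chr G m i j * X m = ip G X (fun l => chl G l i j).
Proof. by rewrite ip_sumr; apply: eq_bigr => k _; rewrite chrE. Qed.

(** With lowered Christoffel symbols no derivative of the inverse metric occurs. Moving G inside a
    derivative costs dG, the sum of two lowered symbols; one of them cancels the original quadratic
    term, and the other forms the inner product with the opposite sign. *)
Lemma rieE a b c e : rie G a b c e =
  d c (chl G a e b) - d e (chl G a c b)
  + ip G (fun m => chl G m e a) (fun m => chl G m c b)
  - ip G (fun m => chl G m c a) (fun m => chl G m e b).
Proof.
have first x y : \sum_m G a m * d x (chr G m y b) =
    d x (chl G a y b) - \sum_m d x (G a m) * chr G m y b.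
  rewrite chlE dv_sum -sumrB; apply: eq_bigr => m _; rewrite dvM; ring.
have second x y : \sum_m G a m * (\sum_k chr G m x k * chr G k y b) =
    \sum_k chl G a x k * chr G k y b.
  under eq_bigr do rewrite mulr_sumr.
  rewrite exchange_big; apply: eq_bigr => k _ /=; rewrite chlE mulr_suml.
  by apply: eq_bigr => m _; rewrite mulrA.
have third x y : \sum_k chl G a x k * chr G k y b - \sum_k d x (G a k) * chr G k y b =
    - ip G (fun m => chl G m x a) (fun m => chl G m y b).
  rewrite -sum_chr_ip -sumrB -sumrN; apply: eq_bigr => k _; rewrite dG; ring.
have -> : rie G a b c e =
  \sum_m G a m * d c (chr G m e b) - \sum_m G a m * d e (chr G m c b)
  + (\sum_m G a m * (\sum_k chr G m c k * chr G k e b)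
     - \sum_m G a m * (\sum_k chr G m e k * chr G k c b)).
  rewrite -!sumrB -big_split /=; apply: eq_bigr => m _.
  by rewrite /rup sumrB; ring.
have t1 := third c e; have t2 := third e c.
rewrite !first !second; move: t1 t2.
move/(canRL (subrK _)) => ->; move/(canRL (subrK _)) => ->; ring.
Qed.

(** After adding the two sides, the derivative terms form the commutator of two derivations on
    [G a b], and the quadratic ones cancel by the symmetry of [ip]. *)
Lemma rie_antisym a b c e : rie G a b c e = - rie G b a c e.
Proof.
rewrite !rieE (ipC _ (fun m => chl G m c b)) (ipC _ (fun m => chl G m e b)).
have D x y : d x (chl G a y b) + d x (chl G b y a) = d x (d y (G a b)).
  by rewrite -dvD dG.
have := D c e; have := D e c; rewrite (dvC d c e) => <- /(canRL (addrK _)) ->; ring.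
Qed.

Lemma rie_antisymr a b c e : rie G a b c e = - rie G a b e c.
Proof. by rewrite !rieE; ring. Qed.

End Fixed.
End AlgebraicCurvature.

Definition dsub (S : comUnitRingType) m n (d : dfam S n) (e : 'I_m -> 'I_n) : dfam S m :=
  @Dfam S m (fun k => d (e k)) (fun k => dvD d (e k)) (fun k => dvM d (e k))
    (fun k l => dvC d (e k) (e l)).

(** * Conformal change of the metric *)

Section Conformal.
Context {S : comUnitRingType} {n : nat} (d : dfam S n) (G : 'M[S]_n).
Hypotheses (uG : G \in unitmx) (sG : forall i j, G i j = G j i).
Hypothesis (u2 : (2 : S) \is a GRing.unit).
Variable psi : S.
Hypothesis upsi : psi \is a GRing.unit.
Let w := psi^-1.
Let Gb := w ^+ 2 *: G.

(* The tensor B with R(G / psi^2) = psi^-2 (R(G) + G o B), o being the Kulkarni-Nomizu product. *)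
Definition cschouten (i j : 'I_n) : S :=
  w * hes d G psi i j - 2^-1 * (w ^+ 2 * gsq d G psi) * G i j.

Let uw : w ^+ 2 \is a GRing.unit. Proof. by rewrite unitrX // unitrV. Qed.
Let psiw : psi * w = 1. Proof. exact: mulrV. Qed.

Lemma conformal_unitmx : Gb \in unitmx.
Proof. by rewrite unitmxZ. Qed.

Lemma conformal_sym i j : Gb i j = Gb j i.
Proof. by rewrite !mxE sG. Qed.

Lemma ip_conformal X Y : ip Gb X Y = psi ^+ 2 * ip G X Y.
Proof.
rewrite /ip mulr_sumr; apply: eq_bigr => i _; rewrite mulr_sumr; apply: eq_bigr => j _.
by rewrite (invmxZ conformal_unitmx) mxE -exprVn invrK; ring.
Qed.

(** The differential of log psi, in which the change of the Christoffel symbols is linear. *)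
Let u i := w * d i psi.

Let dw i : d i w = - (w * u i).
Proof. by rewrite dvV // /u mulrA. Qed.

Let du i j : d i (u j) = w * d i (d j psi) - u i * u j.
Proof. by rewrite /u dvM dw /u; ring. Qed.

Lemma chl_conformal a i j :
  chl d Gb a i j = w ^+ 2 * (chl d G a i j + (- u i * G j a + (- u j * G i a + u a * G i j))).
Proof.
rewrite /chl !mxE !expr2 !dvM !dw.
have -> : forall x y z, 2^-1 * (((- (w * u i) * w + w * - (w * u i)) * G j a + w * w * x)
     + ((- (w * u j) * w + w * - (w * u j)) * G i a + w * w * y)
     - ((- (w * u a) * w + w * - (w * u a)) * G i j + w * w * z)) =
   w * w * (2^-1 * (x + y - z)) + w * w * ((2^-1 * 2) * (- u i * G j a + (- u j * G i a + u a * G i j))).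
  by move=> x y z; ring.
by rewrite mulVr // mul1r -mulrDr.
Qed.

Let ipl (X Y v : 'I_n -> S) p q r x y :
  ip G (fun m => X m + (p * G m x + (q * G m y + r * v m))) Y =
  ip G X Y + (p * Y x + (q * Y y + r * ip G v Y)).
Proof. by rewrite 3!ipDl 3!ipZl 2!(ip_metric uG sG). Qed.

Let ip_expand (X Y v : 'I_n -> S) p q r p' q' r' x y z t :
  ip G (fun m => X m + (p * G m x + (q * G m y + r * v m)))
       (fun m => Y m + (p' * G m z + (q' * G m t + r' * v m))) =
  ip G X Y + (p' * X z + (q' * X t + r' * ip G X v))
  + (p * (Y x + (p' * G x z + (q' * G x t + r' * v x)))
   + (q * (Y y + (p' * G y z + (q' * G y t + r' * v y)))
   + r * (ip G Y v + (p' * v z + (q' * v t + r' * ip G v v))))).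
Proof.
rewrite (ipl X _ v p q r x y) (ipC sG X) (ipl Y X v p' q' r' z t).
rewrite (ipC sG v (fun m => Y m + (p' * G m z + (q' * G m t + r' * v m)))) (ipl Y v v p' q' r' z t).
by rewrite (ipC sG v X) (ipC sG Y X).
Qed.

Let dexp (X p q r x y z : S) k :
  d k (w ^+ 2 * (X + (- p * x + (- q * y + r * z)))) =
  w ^+ 2 * (d k X - (d k p * x + p * d k x) - (d k q * y + q * d k y) + (d k r * z + r * d k z)
     - 2 * u k * (X + (- p * x + (- q * y + r * z)))).
Proof. by rewrite expr2 !(dvM, dvD, dvN) dw; ring. Qed.

Lemma rie_conformal a b c e :
  rie d Gb a b c e = w ^+ 2 *
   (rie d G a b c e + (G a c * cschouten b e + G b e * cschouten a c
                     - G a e * cschouten b c - G b c * cschouten a e)).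
Proof.
rewrite (rieE d conformal_unitmx conformal_sym u2) (rieE d uG sG u2) !ip_conformal.
have quad x y z t : ip G (fun m => chl d Gb m x y) (fun m => chl d Gb m z t) =
  w ^+ 2 * (w ^+ 2 * ip G
    (fun m => chl d G m x y + (- u x * G m y + (- u y * G m x + G x y * u m)))
    (fun m => chl d G m z t + (- u z * G m t + (- u t * G m z + G z t * u m)))).
  rewrite -[in RHS]ipZl -[in RHS]ipZr //.
  by congr (ip G _ _); apply/funext => m; rewrite chl_conformal !(sG _ m) [u m * _]mulrC.
rewrite !quad !ip_expand !chl_conformal.
have cs i j : cschouten i j = w * d i (d j psi) - ip G (fun l => chl d G l i j) u
      - 2^-1 * ip G u u * G i j.
  have e1 : ip G (fun l => chl d G l i j) u = w * ip G (d^~ psi) (fun l => chl d G l i j).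
    by rewrite /u ipZr // ipC.
  have e2 : ip G u u = w * (w * ip G (d^~ psi) (d^~ psi)) by rewrite /u ipZl ipZr.
  by rewrite /cschouten /hes sum_chr_ip // /gsq e1 e2; ring.
rewrite !cs !dexp !du.
have C1 := chlC d sG.
have psi2 : psi ^+ 2 * (w ^+ 2 * w ^+ 2) = w ^+ 2.
  by rewrite mulrA -exprMn psiw expr1n mul1r.
have quad2 x : psi ^+ 2 * (w ^+ 2 * (w ^+ 2 * x)) = w ^+ 2 * x.
  by rewrite -[in RHS]psi2; ring.
rewrite !quad2 !(dG d sG u2).
(* From here on the Christoffel symbols are arbitrary quantities symmetric in the last two indices.
   Once every symmetric pair of indices is brought into one order, a polynomial identity remains. *)
move: C1; generalize (chl d G) => X C1.
have fC i j : (fun m => X m i j) = (fun m => X m j i) by apply/funext => m.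
rewrite ?(fC b a) ?(fC c a) ?(fC e a) ?(fC c b) ?(fC e b) ?(fC e c).
rewrite ?(C1 _ b a) ?(C1 _ c a) ?(C1 _ e a) ?(C1 _ c b) ?(C1 _ e b) ?(C1 _ e c).
rewrite ?(sG b a) ?(sG c a) ?(sG e a) ?(sG c b) ?(sG e b) ?(sG e c).
rewrite ?(dvC d b a) ?(dvC d c a) ?(dvC d e a) ?(dvC d c b) ?(dvC d e b) ?(dvC d e c).
(* Half of |u|^2 becomes a variable; otherwise the identity would rest on 2 * 2^-1 = 1, which is no
   identity of commutative rings. *)
set q := 2^-1 * ip G u u.
have uh : ip G u u = q + q by rewrite /q -mulrDr half2.
rewrite !uh; move: q uh => q _.
by ring.
Qed.

End Conformal.

(** * Covariant derivatives of covectors *)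

Section MetricCompat.
Context {S : comUnitRingType} {n : nat} (d : dfam S n) (G : 'M[S]_n).
Hypotheses (uG : G \in unitmx) (sG : forall i j, G i j = G j i).
Hypothesis (u2 : (2 : S) \is a GRing.unit).

Definition cov (X : 'I_n -> S) (i j : 'I_n) : S := d i (X j) - \sum_k chr d G k i j * X k.

Lemma invmx_solve (v : 'I_n -> S) k : \sum_l invmx G k l * (\sum_m G l m * v m) = v k.
Proof.
under eq_bigr do rewrite mulr_sumr.
rewrite exchange_big /=.
transitivity (\sum_l (invmx G *m G) k l * v l).
  by apply: eq_bigr => l _; rewrite mxE mulr_suml; apply: eq_bigr => a _; rewrite mulrA.
rewrite mulVmx // (bigD1 k) //= big1 ?addr0 ?mxE ?eqxx ?mul1r // => l lk.
by rewrite mxE eq_sym (negPf lk) mul0r.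
Qed.

Lemma dv_mulmx (d' : dfam S n) k (A B : 'M[S]_n) i j :
  d' k ((A *m B) i j) = \sum_l (d' k (A i l) * B l j + A i l * d' k (B l j)).
Proof. by rewrite mxE dv_sum; apply: eq_bigr => l _; rewrite dvM. Qed.

(** Differentiation of G G^-1 = 1, the derivative of G being a sum of two lowered Christoffel
    symbols. *)
Lemma dv_invmx k i j : d k (invmx G i j) =
  - (\sum_l chr d G i k l * invmx G l j + \sum_l invmx G i l * chr d G j k l).
Proof.
have dv_one a b : d k ((1%:M : 'M[S]_n) a b) = 0.
  by rewrite mxE; case: (a == b); rewrite ?dv0 ?dv1.
have eq1 a : \sum_l G a l * d k (invmx G l j) = - \sum_l d k (G a l) * invmx G l j.
  have := dv_one a j; rewrite -(mulmxV uG) dv_mulmx big_split /= addrC.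
  by move/eqP; rewrite addr_eq0 => /eqP.
have : \sum_a invmx G i a * (\sum_l G a l * d k (invmx G l j)) = d k (invmx G i j).
  exact: invmx_solve.
move=> <-; under eq_bigr do rewrite eq1 mulrN mulr_sumr.
rewrite sumrN; congr (- _).
have -> : \sum_a \sum_l invmx G i a * (d k (G a l) * invmx G l j) =
   \sum_a \sum_l invmx G i a * chl d G a k l * invmx G l j
   + \sum_a \sum_l invmx G i a * (invmx G j l * chl d G l k a).
  rewrite -big_split /=; apply: eq_bigr => a _; rewrite -big_split /=; apply: eq_bigr => l _.
  by rewrite (dG d sG u2) (invmx_sym sG l j); ring.
congr (_ + _).
  rewrite exchange_big /=; apply: eq_bigr => l _.
  by rewrite chrE mulr_suml.
by apply: eq_bigr => a _; rewrite chrE mulr_sumr.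
Qed.

(** The connection is metric: the derivative of the inverse metric supplies exactly the Christoffel
    terms of the two covariant derivatives. *)
Lemma dv_ip k X Y : d k (ip G X Y) = ip G (cov X k) Y + ip G X (cov Y k).
Proof.
have -> : d k (ip G X Y) =
   ip G (fun i => d k (X i)) Y + ip G X (fun i => d k (Y i))
   + \sum_i \sum_j d k (invmx G i j) * X i * Y j.
  rewrite /ip dv_sum -!big_split /=; apply: eq_bigr => i _.
  rewrite dv_sum -!big_split /=; apply: eq_bigr => j _.
  by rewrite !dvM; ring.
have covE Z : cov Z k = (fun j => d k (Z j) + (-1) * \sum_l chr d G l k j * Z l).
  by apply/funext => j; rewrite /cov; ring.
rewrite !covE (ipDl G) (ipDr sG) (ipZl G) (ipZr sG).
suff -> : \sum_i \sum_j d k (invmx G i j) * X i * Y j =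
   - ip G (fun j => \sum_l chr d G l k j * X l) Y - ip G X (fun j => \sum_l chr d G l k j * Y l).
  by ring.
rewrite /ip.
under eq_bigr do under eq_bigr do rewrite dv_invmx mulNr mulNr.
under eq_bigr do rewrite sumrN.
rewrite sumrN -opprD; congr (- _).
have -> : \sum_i \sum_j (\sum_l chr d G i k l * invmx G l j + \sum_l invmx G i l * chr d G j k l) * X i * Y j
  = \sum_i \sum_j \sum_l chr d G i k l * invmx G l j * X i * Y j
   + \sum_i \sum_j \sum_l invmx G i l * chr d G j k l * X i * Y j.
  rewrite -big_split /=; apply: eq_bigr => i _; rewrite -big_split /=; apply: eq_bigr => j _.
  by rewrite !mulrDl !mulr_suml.
congr (_ + _).
  under eq_bigr do rewrite exchange_big /=.
  rewrite exchange_big /=; apply: eq_bigr => l _; rewrite exchange_big /=; apply: eq_bigr => j _.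
  by rewrite mulr_sumr mulr_suml; apply: eq_bigr => i _; ring.
apply: eq_bigr => i _; rewrite exchange_big; apply: eq_bigr => l _ /=.
by rewrite mulr_sumr; apply: eq_bigr => j _; ring.
Qed.

Lemma hesC f i j : hes d G f i j = hes d G f j i.
Proof. by rewrite /hes dvC; congr (_ - _); apply: eq_bigr => k _; rewrite chrC. Qed.

(** The Ricci identity for df, with the Christoffel terms from the covariant derivative of the
    Hessian moved to the right-hand side. *)
Lemma hes_comm f b c e :
  d c (hes d G f e b) - d e (hes d G f c b) =
  \sum_k (chr d G k c b * hes d G f e k - chr d G k e b * hes d G f c k)
  - \sum_k rup d G k b c e * d k f.
Proof.
have ddf i j : d i (d j f) = hes d G f i j + \sum_k chr d G k i j * d k f.
  by rewrite /hes subrK.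
rewrite {1 2}/hes !dvB !dv_sum (dvC d c e).
have E x y : \sum_k d x (chr d G k y b * d k f) =
   \sum_k (d x (chr d G k y b) * d k f + chr d G k y b * hes d G f x k)
   + \sum_m (\sum_k chr d G m x k * chr d G k y b) * d m f.
  under eq_bigr do rewrite dvM ddf mulrDr addrA.
  rewrite big_split /=; congr (_ + _).
  under eq_bigr do rewrite mulr_sumr.
  rewrite exchange_big /=; apply: eq_bigr => m _; rewrite mulr_suml.
  by apply: eq_bigr => k _; ring.
rewrite !E !opprD.
have -> : \sum_k rup d G k b c e * d k f =
  \sum_k d c (chr d G k e b) * d k f - \sum_k d e (chr d G k c b) * d k f
  + \sum_m (\sum_k chr d G m c k * chr d G k e b) * d m f
  - \sum_m (\sum_k chr d G m e k * chr d G k c b) * d m f.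
  rewrite -sumrB -big_split -sumrB /=; apply: eq_bigr => k _; rewrite /rup sumrB; ring.
rewrite sumrB !big_split /=; ring.
Qed.

End MetricCompat.

(** * Surfaces *)

Section Dim2.
Context {S : comUnitRingType} (d : dfam S 2) (G : 'M[S]_2).
Hypotheses (uG : G \in unitmx) (sG : forall i j, G i j = G j i).
Hypothesis (u2 : (2 : S) \is a GRing.unit).

Definition gau : S := rie d G 0 1 0 1 / \det G.

Lemma ord2P (i : 'I_2) : i = 0 \/ i = 1.
Proof. by case: i => [[|[|//]] p]; [left|right]; apply: val_inj. Qed.

Lemma det2 (A : 'M[S]_2) : \det A = A 0 0 * A 1 1 - A 0 1 * A 1 0.
Proof.
rewrite (expand_det_row _ 0) big_ord_recl big_ord1 /cofactor !det_mx11 !mxE /=.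
have -> : lift 0 0 = 1 :> 'I_2 by exact: val_inj.
have -> : lift 1 0 = 0 :> 'I_2 by exact: val_inj.
by rewrite expr0 expr1; ring.
Qed.

Lemma eqN0 (x : S) : x = - x -> x = 0.
Proof.
by move/eqP; rewrite -addr_eq0 -mulr2n -mulr_natl => /eqP /(congr1 ( *%R 2^-1)); rewrite mulKr // mulr0.
Qed.

(** Antisymmetry in each of the two pairs of indices leaves a single component. *)
Lemma rie_dim2 a b c e : rie d G a b c e = gau * (G a c * G b e - G a e * G b c).
Proof.
have uD : \det G \is a GRing.unit by [].
have R01 : rie d G 0 1 0 1 = gau * (G 0 0 * G 1 1 - G 0 1 * G 1 0).
  by rewrite -det2 /gau divrK.
have A := rie_antisym d uG sG u2; have B := rie_antisymr d uG sG u2.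
have A0 i k l : rie d G i i k l = 0 by apply: eqN0; exact: A.
have B0 i k l : rie d G k l i i = 0 by apply: eqN0; exact: B.
case: (ord2P a) (ord2P b) (ord2P c) (ord2P e) => -> [] -> [] -> [] ->;
  rewrite ?(A0, B0); try ring;
  rewrite ?(A 1 0) ?(B _ _ 1 0) R01; ring.
Qed.

(** For the one-form v = du + K df, the Ricci identity reads v_c G_eb = v_e G_cb. With c and e the
    two distinct indices, this says that both components of v multiplied by det G vanish. *)
Lemma umbilic_grad f u : (forall i j, hes d G f i j = u * G i j) ->
  forall i, d i u = - (gau * d i f).
Proof.
move=> H.
have cod c e b : (d c u + gau * d c f) * G e b = (d e u + gau * d e f) * G c b.
  have := hes_comm d G f b c e.
  have -> : \sum_k rup d G k b c e * d k f = gau * (G b e * d c f - G b c * d e f).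
    have -> : \sum_k rup d G k b c e * d k f = ip G (fun m => rie d G m b c e) (d^~ f).
      rewrite (ipC sG) ip_sumr; apply: eq_bigr => k _; congr (_ * _).
      by rewrite invmx_solve.
    have -> : (fun m => rie d G m b c e) =
        (fun m => gau * G b e * G m c + (- gau * G b c) * G m e).
      by apply/funext => m; rewrite rie_dim2; ring.
    by rewrite (ipDl G) !(ipZl G) !(ip_metric uG sG); ring.
  have chl_u i j k : \sum_l chr d G l i j * (u * G k l) = u * chl d G k i j.
    by rewrite (chlE d uG sG) mulr_sumr; apply: eq_bigr => l _; ring.
  rewrite !H !dvM sumrB.
  under [X in _ = X - _ - _]eq_bigr do rewrite H.
  under [X in _ = _ - X - _]eq_bigr do rewrite H.
  rewrite !chl_u !(dG d sG u2) (chlC d sG b e c) (sG b e) (sG b c) => E.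
  apply/eqP; rewrite -subr_eq0; apply/eqP.
  move/eqP: E; rewrite -subr_eq0 => /eqP E; rewrite -[RHS]E; ring.
have z x : x * \det G = 0 -> x = 0.
  by move=> /(congr1 (fun y => y / \det G)); rewrite mul0r mulrK.
have c0 := cod 0 1 0; have c1 := cod 0 1 1.
suff E i : d i u + gau * d i f = 0.
  by move=> i; apply/eqP; rewrite -addr_eq0; apply/eqP; exact: E.
move: c0 c1; set v0 := d 0 u + _; set v1 := d 1 u + _ => c0 c1.
case: (ord2P i) => ->; apply: z; rewrite det2 -/v0 -/v1.
  transitivity (G 0 0 * (v0 * G 1 1) - G 0 1 * (v0 * G 1 0)); first by ring.
  by rewrite c0 c1; ring.
transitivity (G 1 1 * (v1 * G 0 0) - G 1 0 * (v1 * G 0 1)); first by ring.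
by rewrite -c0 -c1; ring.
Qed.

End Dim2.

(** * Riemannian products *)

Section Product.
Context {S : comUnitRingType} {m n : nat} (d : dfam S (m + n)).
Variables (G1 : 'M[S]_m) (G2 : 'M[S]_n).
Hypotheses (uG1 : G1 \in unitmx) (sG1 : forall i j, G1 i j = G1 j i).
Hypotheses (uG2 : G2 \in unitmx) (sG2 : forall i j, G2 i j = G2 j i).
Hypothesis (u2 : (2 : S) \is a GRing.unit).
Let l := @lshift m n.
Let r := @rshift m n.
Hypothesis h1 : forall k i j, d (r k) (G1 i j) = 0.
Hypothesis h2 : forall k i j, d (l k) (G2 i j) = 0.
Let dl := dsub d l.
Let dr := dsub d r.
Let G := block_mx G1 0 0 G2.

Lemma prod_unitmx : G \in unitmx.
Proof. by rewrite unitmxE det_ublock unitrM -!unitmxE uG1. Qed.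

Lemma prodEll i j : G (l i) (l j) = G1 i j. Proof. exact: block_mxEul. Qed.
Lemma prodElr i j : G (l i) (r j) = 0. Proof. by rewrite [LHS]block_mxEur mxE. Qed.
Lemma prodErl i j : G (r i) (l j) = 0. Proof. by rewrite [LHS]block_mxEdl mxE. Qed.
Lemma prodErr i j : G (r i) (r j) = G2 i j. Proof. exact: block_mxEdr. Qed.
Definition prodE := (prodEll, prodElr, prodErl, prodErr).

Lemma prod_sym i j : G i j = G j i.
Proof. by case: (split_ordP i) => k ->; case: (split_ordP j) => k' ->; rewrite !prodE // ?sG1 ?sG2. Qed.

Lemma prod_invmx : invmx G = block_mx (invmx G1) 0 0 (invmx G2).
Proof. by rewrite /G invmx_block_diag // prod_unitmx. Qed.

Lemma ip_prod X Y : ip G X Y = ip G1 (X \o l) (Y \o l) + ip G2 (X \o r) (Y \o r).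
Proof.
rewrite /ip prod_invmx big_split_ord /=; congr (_ + _); apply: eq_bigr => i _; rewrite big_split_ord /=.
  rewrite [X in _ + X]big1 ?addr0 => [|j _]; last by rewrite block_mxEur mxE !mul0r.
  by apply: eq_bigr => j _; rewrite block_mxEul.
rewrite [X in X + _]big1 ?add0r => [|j _]; last by rewrite block_mxEdl mxE !mul0r.
by apply: eq_bigr => j _; rewrite block_mxEdr.
Qed.

Lemma chl_lll a i j : chl d G (l a) (l i) (l j) = chl dl G1 a i j.
Proof. by rewrite /chl !prodE. Qed.
Lemma chl_rrr a i j : chl d G (r a) (r i) (r j) = chl dr G2 a i j.
Proof. by rewrite /chl !prodE. Qed.
Lemma chl_llr a i j : chl d G (l a) (l i) (r j) = 0.
Proof. by rewrite /chl !prodE h1 !dv0; ring. Qed.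
Lemma chl_lrl a i j : chl d G (l a) (r i) (l j) = 0.
Proof. by rewrite /chl !prodE h1 !dv0; ring. Qed.
Lemma chl_rll a i j : chl d G (r a) (l i) (l j) = 0.
Proof. by rewrite /chl !prodE h1 !dv0; ring. Qed.
Lemma chl_lrr a i j : chl d G (l a) (r i) (r j) = 0.
Proof. by rewrite /chl !prodE h2 !dv0; ring. Qed.
Lemma chl_rlr a i j : chl d G (r a) (l i) (r j) = 0.
Proof. by rewrite /chl !prodE h2 !dv0; ring. Qed.
Lemma chl_rrl a i j : chl d G (r a) (r i) (l j) = 0.
Proof. by rewrite /chl !prodE h2 !dv0; ring. Qed.
Definition chl_prod := (chl_lll, chl_rrr, chl_llr, chl_lrl, chl_rll, chl_lrr, chl_rlr, chl_rrl).

Lemma ip0 k (H : 'M[S]_k) X Y : (forall i, Y i = 0) -> ip H X Y = 0.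
Proof. by move=> Y0; rewrite /ip big1 // => i _; rewrite big1 // => j _; rewrite Y0 mulr0. Qed.
Lemma ip00 k (H : 'M[S]_k) X Y : (forall i j, X i * Y j = 0) -> ip H X Y = 0.
Proof. by move=> Y0; rewrite /ip big1 // => i _; rewrite big1 // => j _; rewrite -mulrA Y0 mulr0. Qed.

Lemma eq_ip k (H : 'M[S]_k) X X' Y Y' : X =1 X' -> Y =1 Y' -> ip H X Y = ip H X' Y'.
Proof. by move=> /funext -> /funext ->. Qed.

Let ipE := (rieE d prod_unitmx prod_sym u2).

Lemma rie_llll a b c e : rie d G (l a) (l b) (l c) (l e) = rie dl G1 a b c e.
Proof.
rewrite ipE (rieE dl uG1 sG1 u2) !chl_prod !ip_prod.
rewrite [X in _ + (_ + X) - _]ip0 => [|i]; last by rewrite /= chl_prod.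
rewrite [X in _ - (_ + X)]ip0 => [|i]; last by rewrite /= chl_prod.
by rewrite !addr0; congr (_ + _ - _); apply: eq_ip => i /=; rewrite chl_prod.
Qed.

Lemma rie_rrrr a b c e : rie d G (r a) (r b) (r c) (r e) = rie dr G2 a b c e.
Proof.
rewrite ipE (rieE dr uG2 sG2 u2) !chl_prod !ip_prod.
rewrite [X in _ + (X + _) - _]ip0 => [|i]; last by rewrite /= chl_prod.
rewrite [X in _ - (X + _)]ip0 => [|i]; last by rewrite /= chl_prod.
by rewrite !add0r; congr (_ + _ - _); apply: eq_ip => i /=; rewrite chl_prod.
Qed.

Let dchl1 k a i j : d (r k) (chl dl G1 a i j) = 0.
Proof. by rewrite /chl dvM dv_half !dvB !dvD !(dvC _ (r k)) !h1 !dv0; ring. Qed.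
Let dchl2 k a i j : d (l k) (chl dr G2 a i j) = 0.
Proof. by rewrite /chl dvM dv_half !dvB !dvD !(dvC _ (l k)) !h2 !dv0; ring. Qed.

Definition same_side (a b : 'I_(m + n)) : bool := (a < m)%N == (b < m)%N.

(** Mixed Christoffel symbols vanish, and the symbols of each factor are constant along the
    other. *)
Lemma rie_mixed a b c e : ~~ [&& same_side a b, same_side b c & same_side c e] ->
  rie d G a b c e = 0.
Proof.
rewrite /same_side; case: (split_ordP a) => a' ->; case: (split_ordP b) => b' ->;
  case: (split_ordP c) => c' ->; case: (split_ordP e) => e' ->;
  rewrite /= ?ltn_ord ?[(m + _ < m)%N]ltnNge ?leq_addr //= => _;
  rewrite ipE !chl_prod !ip_prod ?dv0 ?dchl1 ?dchl2;
  rewrite !ip00 ?oppr0 ?subr0 ?addr0 ?subr0 //; move=> i j /=; rewrite !chl_prod ?mul0r ?mulr0 //.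
Qed.

Lemma hes_ll f i j : hes d G f (l i) (l j) = hes dl G1 f i j.
Proof.
rewrite /hes (sum_chr_ip d G) (sum_chr_ip dl G1) ip_prod.
rewrite [X in _ - (_ + X)]ip0 => [|k]; last by rewrite /= chl_prod.
by rewrite addr0; congr (_ - _); apply: eq_ip => k //=; rewrite chl_prod.
Qed.
Lemma hes_rr f i j : hes d G f (r i) (r j) = hes dr G2 f i j.
Proof.
rewrite /hes (sum_chr_ip d G) (sum_chr_ip dr G2) ip_prod.
rewrite [X in _ - (X + _)]ip0 => [|k]; last by rewrite /= chl_prod.
by rewrite add0r; congr (_ - _); apply: eq_ip => k //=; rewrite chl_prod.
Qed.
Lemma hes_lr f i j : hes d G f (l i) (r j) = d (l i) (d (r j) f).
Proof.
rewrite /hes (sum_chr_ip d G) ip_prod.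
by rewrite !ip0 => [|k|k]; rewrite ?addr0 ?subr0 //= chl_prod.
Qed.

Lemma gsq_prod f : gsq d G f = gsq dl G1 f + gsq dr G2 f.
Proof. by rewrite /gsq ip_prod. Qed.

End Product.

(** * Curvature-type tensors at a point *)

Lemma big_ord2 (V : nmodType) (F : 'I_2 -> V) : \sum_i F i = F 0 + F 1.
Proof. by rewrite big_ord_recl big_ord1; congr (_ + F _); apply: val_inj. Qed.

Section Pointwise.
Context {R : realType}.

Section Contractions.
Context {n : nat}.
Implicit Types (g P : 'M[R]_n) (T : 'I_n -> 'I_n -> 'I_n -> 'I_n -> R).

Definition rsqT g T (i j : 'I_n) : R :=
  \sum_k \sum_p \sum_q \sum_k' \sum_p' \sum_q'
    invmx g k k' * invmx g p p' * invmx g q q' * T i k p q * T j k' p' q'.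

(** Components of T in the frame formed by the rows of P. *)
Definition frameT P T (a b c e : 'I_n) : R :=
  \sum_a' P a a' * \sum_b' P b b' * \sum_c' P c c' * \sum_e' P e e' * T a' b' c' e'.

Lemma contract_frame P (X Y : 'I_n -> R) :
  \sum_k \sum_k' (P^T *m P) k k' * (X k * Y k') =
  \sum_m (\sum_k P m k * X k) * (\sum_k P m k * Y k).
Proof.
under eq_bigr do under eq_bigr do rewrite mxE mulr_suml.
under eq_bigr do rewrite exchange_big /=.
rewrite exchange_big /=; apply: eq_bigr => m _.
rewrite big_distrl /=; apply: eq_bigr => k _; rewrite big_distrr /=.
by apply: eq_bigr => k' _; rewrite mxE; ring.
Qed.

(** The hypothesis says that the rows of P are orthonormal up to scale. Each of the three
    contractions with the inverse metric contributes a factor s and becomes a sum over frame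
    indices. *)
Lemma rsqT_frame P g (s : R) T i j : invmx g = s *: (P^T *m P) ->
  \sum_a \sum_b P i a * P j b * rsqT g T a b =
  s ^+ 3 * \sum_k \sum_p \sum_q frameT P T i k p q * frameT P T j k p q.
Proof.
move=> gE.
(* [F1], [F2] and [F3] pass to the frame in one, two and three slots; the contractions are carried
   out from the innermost outwards. *)
pose M := P^T *m P; pose F1 (A : 'I_n -> R) m := \sum_k P m k * A k.
have c1 (J : finType) (A B : 'I_n -> J -> R) :
    \sum_k \sum_k' M k k' * (\sum_j A k j * B k' j) =
    \sum_m \sum_j F1 (A^~ j) m * F1 (B^~ j) m.
  under eq_bigr do under eq_bigr do rewrite mulr_sumr.
  under eq_bigr do rewrite exchange_big /=.
  rewrite exchange_big [RHS]exchange_big /=; apply: eq_bigr => y _.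
  exact: contract_frame.
pose F2 (A : 'I_n -> 'I_n -> R) p q := F1 (fun p' => F1 (A p') q) p.
pose F3 (A : 'I_n -> 'I_n -> 'I_n -> R) k p q := F1 (fun k' => F2 (A k') p q) k.
have rsqE a b : rsqT g T a b = s ^+ 3 * \sum_k \sum_p \sum_q F3 (T a) k p q * F3 (T b) k p q.
  have -> : rsqT g T a b = s ^+ 3 * \sum_k \sum_k' M k k' * (\sum_p \sum_p' M p p' *
      (\sum_q \sum_q' M q q' * (T a k p q * T b k' p' q'))).
    rewrite mulr_sumr; apply: eq_bigr => k _.
    under eq_bigr do rewrite exchange_big /=.
    rewrite exchange_big mulr_sumr /=; apply: eq_bigr => k' _.
    rewrite 2!mulr_sumr; apply: eq_bigr => p _.
    rewrite exchange_big 2!mulr_sumr /=; apply: eq_bigr => p' _.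
    rewrite !mulr_sumr; apply: eq_bigr => q _; rewrite !mulr_sumr; apply: eq_bigr => q' _.
    by rewrite gE !mxE -/M; ring.
  congr (_ * _).
  have e2 (A B : 'I_n -> 'I_n -> R) :
     \sum_p \sum_p' M p p' * (\sum_q \sum_q' M q q' * (A p q * B p' q')) =
     \sum_t F2 A t.1 t.2 * F2 B t.1 t.2.
    under eq_bigr do under eq_bigr do rewrite contract_frame.
    by rewrite c1 pair_bigA.
  under eq_bigr do under eq_bigr do rewrite e2.
  rewrite (c1 _ (fun k t => F2 (T a k) t.1 t.2) (fun k t => F2 (T b k) t.1 t.2)).
  by apply: eq_bigr => k _; rewrite pair_bigA.
under eq_bigr do under eq_bigr do rewrite rsqE.
have e3 a b : \sum_k \sum_p \sum_q F3 (T a) k p q * F3 (T b) k p q =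
    \sum_t F3 (T a) t.1.1 t.1.2 t.2 * F3 (T b) t.1.1 t.1.2 t.2.
  by rewrite pair_bigA pair_bigA.
under eq_bigr do under eq_bigr do rewrite e3.
have -> : \sum_k \sum_p \sum_q frameT P T i k p q * frameT P T j k p q =
    \sum_t frameT P T i t.1.1 t.1.2 t.2 * frameT P T j t.1.1 t.1.2 t.2.
  by rewrite pair_bigA pair_bigA.
under eq_bigr do under eq_bigr do rewrite mulrCA mulr_sumr.
under eq_bigr do rewrite -mulr_sumr exchange_big.
rewrite -mulr_sumr exchange_big /=; congr (_ * _); apply: eq_bigr => t _.
rewrite /frameT big_distrl /=; apply: eq_bigr => a _; rewrite big_distrr /=.
by apply: eq_bigr => b _; rewrite /F3 /F2 /F1; ring.
Qed.

Lemma frameTD P T T' a b c e :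
  frameT P (fun a b c e => T a b c e + T' a b c e) a b c e =
  frameT P T a b c e + frameT P T' a b c e.
Proof.
rewrite /frameT -big_split /=; apply: eq_bigr => a' _; rewrite -mulrDr; congr (_ * _).
rewrite -big_split /=; apply: eq_bigr => b' _; rewrite -mulrDr; congr (_ * _).
rewrite -big_split /=; apply: eq_bigr => c' _; rewrite -mulrDr; congr (_ * _).
by rewrite -big_split /=; apply: eq_bigr => e' _; rewrite -mulrDr.
Qed.

Lemma frameTZ P (s : R) T a b c e :
  frameT P (fun a b c e => s * T a b c e) a b c e = s * frameT P T a b c e.
Proof.
rewrite /frameT mulr_sumr; apply: eq_bigr => a' _; rewrite mulrCA; congr (_ * _).
rewrite mulr_sumr; apply: eq_bigr => b' _; rewrite mulrCA; congr (_ * _).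
rewrite mulr_sumr; apply: eq_bigr => c' _; rewrite mulrCA; congr (_ * _).
by rewrite mulr_sumr; apply: eq_bigr => e' _; rewrite mulrCA.
Qed.

Lemma frameT_prod P (X Y : 'M[R]_n) a b c e :
  frameT P (fun a b c e => X a c * Y b e) a b c e = (P *m X *m P^T) a c * (P *m Y *m P^T) b e.
Proof.
have sand (Z : 'M[R]_n) i j : (P *m Z *m P^T) i j = \sum_k P i k * \sum_l P j l * Z k l.
  rewrite mxE; under eq_bigr do rewrite !mxE mulr_suml.
  rewrite exchange_big; apply: eq_bigr => k _; rewrite mulr_sumr; apply: eq_bigr => l _ /=; ring.
rewrite !sand /frameT mulr_suml; apply: eq_bigr => a' _.
rewrite -mulrA; congr (_ * _); rewrite mulr_sumr; apply: eq_bigr => b' _.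
rewrite mulrCA; congr (_ * _).
rewrite mulr_suml; apply: eq_bigr => c' _; rewrite -mulrA; congr (_ * _).
by rewrite mulr_sumr; apply: eq_bigr => e' _; ring.
Qed.

Lemma frameT_prod2 P (X Y : 'M[R]_n) a b c e :
  frameT P (fun a b c e => X a e * Y b c) a b c e = (P *m X *m P^T) a e * (P *m Y *m P^T) b c.
Proof.
rewrite -(frameT_prod P X Y a b e c) /frameT; apply: eq_bigr => a' _; congr (_ * _).
apply: eq_bigr => b' _; congr (_ * _).
under eq_bigr do rewrite mulr_sumr; rewrite exchange_big; apply: eq_bigr => c' _ /=.
by rewrite mulr_sumr; apply: eq_bigr => e' _; rewrite mulrCA.
Qed.
End Contractions.
End Pointwise.

(** * The square of the curvature in an adapted frame *)

Section FourDim.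
Context {R : realType}.

(* In an orthonormal frame adapted to the splitting, indices 0, 1 belong to the first factor and
   2, 3 to the second. *)
Definition dlow (a c : nat) : R := if (a == c) && (a < 2)%N then 1 else 0.
Definition dhigh (a c : nat) : R := if (a == c) && (2 <= a)%N then 1 else 0.
Definition dfull (a c : nat) : R := if a == c then 1 else 0.

(** Frame components of the curvature of the product plus the Kulkarni-Nomizu product of the metric
    with b. Indices are natural numbers, so that the entries of the three metrics compute at
    concrete indices. *)
Definition tform (k1 k2 : R) (b : nat -> nat -> R) (x y z t : nat) : R :=
  k1 * (dlow x z * dlow y t - dlow x t * dlow y z)
  + k2 * (dhigh x z * dhigh y t - dhigh x t * dhigh y z)
  + (dfull x z * b y t + dfull y t * b x z - dfull x t * b y z - dfull y z * b x t).

Definition tsq k1 k2 b (x y : nat) : R :=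
  \sum_(k < 4) \sum_(p < 4) \sum_(q < 4) tform k1 k2 b x k p q * tform k1 k2 b y k p q.

Section Sym.
Variables (k1 k2 : R) (b : nat -> nat -> R).
Hypothesis sb : forall m n, b m n = b n m.
Let t := b 0%N 0%N + b 1%N 1%N + b 2%N 2%N + b 3%N 3%N.

(** Applied to products of two curvature components, antisymmetric in p and q: six pairs instead of
    sixteen keep the expansions below small enough for [ring]. *)
Lemma sum_sym_pairs (F : nat -> nat -> R) : (forall p q, F p q = F q p) ->
  (forall p, F p p = 0) ->
  \sum_(p < 4) \sum_(q < 4) F p q = 2 * (F 0%N 1%N + F 0%N 2%N + F 0%N 3%N
     + F 1%N 2%N + F 1%N 3%N + F 2%N 3%N).
Proof.
move=> sF F0; rewrite !big_ord_recl !big_ord0 /= /bump /= !F0 (sF 1%N 0%N) (sF 2%N 0%N).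
by rewrite (sF 3%N 0%N) (sF 2%N 1%N) (sF 3%N 1%N) (sF 3%N 2%N); ring.
Qed.

Lemma tsq_pairs x y : tsq k1 k2 b x y =
  \sum_(k < 4) 2 * (\sum_(u <- [:: (0, 1); (0, 2); (0, 3); (1, 2); (1, 3); (2, 3)]%N)
    tform k1 k2 b x k u.1 u.2 * tform k1 k2 b y k u.1 u.2).
Proof.
apply: eq_bigr => k _.
rewrite (@sum_sym_pairs (fun p q => tform k1 k2 b x k p q * tform k1 k2 b y k p q)).
- by rewrite !big_cons big_nil /=; ring.
- by move=> p q; rewrite /tform; ring.
- by move=> p; rewrite /tform; ring.
Qed.

Ltac expand_tsq :=
  rewrite !tsq_pairs !big_ord_recl !big_ord0 !big_cons !big_nil /= /bump /= /tform /dlow /dhigh /dfull /=;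
  rewrite ?(sb 1%N 0%N) ?(sb 2%N 0%N) ?(sb 3%N 0%N) ?(sb 2%N 1%N) ?(sb 3%N 1%N) ?(sb 3%N 2%N) /t;
  move: (b 0%N 0%N) (b 0%N 1%N) (b 0%N 2%N) (b 0%N 3%N) (b 1%N 1%N) (b 1%N 2%N) (b 1%N 3%N)
    (b 2%N 2%N) (b 2%N 3%N) (b 3%N 3%N) => x0 x1 x2 x3 x4 x5 x6 x7 x8 x9.

(** The nine identities from here to [tsq_tr] are the components of the traceless part of the
    square, which range over a nine-dimensional space. Each factors into one of t, k1 + k2 + 2t, k1
    + k2 + t and a quantity linear in b, k1, k2. *)
Lemma tsq01 : tsq k1 k2 b 0 1 = 4 * t * b 0%N 1%N.
Proof. expand_tsq; ring. Qed.
Lemma tsq23 : tsq k1 k2 b 2 3 = 4 * t * b 2%N 3%N.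
Proof. expand_tsq; ring. Qed.
Lemma tsq02 : tsq k1 k2 b 0 2 = 2 * (k1 + k2 + 2 * t) * b 0%N 2%N.
Proof. expand_tsq; ring. Qed.
Lemma tsq03 : tsq k1 k2 b 0 3 = 2 * (k1 + k2 + 2 * t) * b 0%N 3%N.
Proof. expand_tsq; ring. Qed.
Lemma tsq12 : tsq k1 k2 b 1 2 = 2 * (k1 + k2 + 2 * t) * b 1%N 2%N.
Proof. expand_tsq; ring. Qed.
Lemma tsq13 : tsq k1 k2 b 1 3 = 2 * (k1 + k2 + 2 * t) * b 1%N 3%N.
Proof. expand_tsq; ring. Qed.
Lemma tsq00_11 : tsq k1 k2 b 0 0 - tsq k1 k2 b 1 1 = 4 * t * (b 0%N 0%N - b 1%N 1%N).
Proof. expand_tsq; ring. Qed.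
Lemma tsq22_33 : tsq k1 k2 b 2 2 - tsq k1 k2 b 3 3 = 4 * t * (b 2%N 2%N - b 3%N 3%N).
Proof. expand_tsq; ring. Qed.
Lemma tsq_tr : tsq k1 k2 b 0 0 + tsq k1 k2 b 1 1 - tsq k1 k2 b 2 2 - tsq k1 k2 b 3 3 =
  4 * (k1 + k2 + t) * (k1 - k2 + (b 0%N 0%N + b 1%N 1%N - b 2%N 2%N - b 3%N 3%N)).
Proof. expand_tsq; ring. Qed.
End Sym.

(** Gram-Schmidt: the rows of P are (1, 0) and (-G01, G00) divided by their lengths r and q, where
    r^2 = G00 and q^2 = G00 det G. *)
Lemma frame_exists (G : 'M[R]_2) : (forall i j, G i j = G j i) ->
  (forall v : 'rV[R]_2, v != 0 -> 0 < (v *m G *m v^T) 0 0) ->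
  exists P : 'M[R]_2, P *m G *m P^T = 1%:M.
Proof.
move=> sG pG.
have quad (x y : R) : ((\row_(j < 2) (if j == 0 then x else y)) *m G *m
    (\row_(j < 2) (if j == 0 then x else y))^T) 0 0 =
    x * (x * G 0 0 + y * G 0 1) + y * (x * G 0 1 + y * G 1 1).
  rewrite mxE big_ord2 !mxE !big_ord2 !mxE /= (sG 1 0); ring.
have nz (x y : R) : (x != 0) || (y != 0) -> (\row_(j < 2) (if j == 0 then x else y)) != 0.
  move=> h; apply/eqP => /matrixP e; have := e 0 0; have := e 0 1.
  by rewrite !mxE /= => y0 x0; move: h; rewrite x0 y0 eqxx.
have E0 : 0 < G 0 0.
  have := pG _ (nz 1 0 _); rewrite quad oner_eq0 => /(_ isT); congr (0 < _); ring.
have D0 : 0 < G 0 0 * G 1 1 - G 0 1 * G 0 1.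
  have := pG _ (nz (- G 0 1) (G 0 0) _); rewrite quad (gt_eqF E0) orbT => /(_ isT).
  have -> : - G 0 1 * (- G 0 1 * G 0 0 + G 0 0 * G 0 1) + G 0 0 * (- G 0 1 * G 0 1 + G 0 0 * G 1 1)
     = G 0 0 * (G 0 0 * G 1 1 - G 0 1 * G 0 1) by ring.
  by rewrite pmulr_rgt0.
pose D := G 0 0 * G 1 1 - G 0 1 * G 0 1.
have [r r0 rE] : exists2 r, 0 < r & r * r = G 0 0.
  by exists (Num.sqrt (G 0 0)); rewrite ?sqrtr_gt0 // -expr2 sqr_sqrtr // ltW.
have [q q0 qE] : exists2 q, 0 < q & q * q = G 0 0 * D.
  have ED : 0 < G 0 0 * D by rewrite mulr_gt0.
  by exists (Num.sqrt (G 0 0 * D)); rewrite ?sqrtr_gt0 // -expr2 sqr_sqrtr // ltW.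
have rn : r != 0 by rewrite gt_eqF.
have qn : q != 0 by rewrite gt_eqF.
pose Q (i j : 'I_2) : R := if i == 0 then (if j == 0 then r^-1 else 0)
   else (if j == 0 then - G 0 1 / q else G 0 0 / q).
exists (\matrix_(i, j) Q i j); apply/matrixP => i j.
rewrite mxE big_ord2 !mxE !big_ord2 !mxE (sG 1 0).
have q2 : (q * q)^-1 * (G 0 0 * D) = 1 by rewrite qE mulVf // -qE mulf_neq0.
have r2 : (r * r)^-1 * G 0 0 = 1 by rewrite rE mulVf // gt_eqF.
case: (ord2P i) => ->; case: (ord2P j) => ->; rewrite /Q /=.
- by rewrite -[RHS]r2; field; rewrite rn.
- by field; rewrite rn qn.
- by field; rewrite rn qn.
- by rewrite -[RHS]q2 /D; field; rewrite qn.
Qed.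

Lemma invmx_frame n (P G : 'M[R]_n) : P *m G *m P^T = 1%:M ->
  P \in unitmx /\ invmx G = P^T *m P.
Proof.
move=> e; have uP : P \in unitmx by have [] := mulmx1_unit (etrans (mulmxA _ _ _) e).
split=> //; have e' : P^T *m P *m G = 1%:M.
  apply: (can_inj (mulmxK (_ : P^T \in unitmx))); first by rewrite unitmx_tr.
  by rewrite -2!mulmxA e mul1mx mulmx1.
have uG : G \in unitmx by have [] := mulmx1_unit e'.
by rewrite -[RHS]mulmx1 -(mulmxV uG) mulmxA e' mul1mx.
Qed.

Let lin_a (T x y : R) : 0 = 4 * T * (x - y) -> T * (2 * x - (x + y) * 1) = 0.
Proof. lra. Qed.
Let lin_b (T x y : R) : 0 = 4 * T * (x - y) -> T * (2 * y - (x + y) * 1) = 0.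
Proof. lra. Qed.
Let lin_c (T z w : R) : 4 * T * z = 0 -> T * (2 * z - w * 0) = 0.
Proof. lra. Qed.
Let lin_d (T z : R) : 2 * T * z = 0 -> T * z = 0.
Proof. lra. Qed.
Let lin_e (F T S x y z t : R) : F + F - F - F = 4 * T * (S + (x + y - z - t)) -> T * (S + ((x + y) - (z + t))) = 0.
Proof. lra. Qed.

Section Trichotomy.
Variables (G1 G2 : 'M[R]_2) (B : 'M[R]_(2 + 2)) (k1 k2 s f : R).
Hypotheses (sG1 : forall i j, G1 i j = G1 j i) (sG2 : forall i j, G2 i j = G2 j i).
Hypothesis pG1 : forall v : 'rV[R]_2, v != 0 -> 0 < (v *m G1 *m v^T) 0 0.
Hypothesis pG2 : forall v : 'rV[R]_2, v != 0 -> 0 < (v *m G2 *m v^T) 0 0.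
Hypothesis sB : forall i j, B i j = B j i.
Hypothesis s0 : s != 0.
Let L : 'M[R]_(2 + 2) := block_mx G1 0 0 0.
Let H : 'M[R]_(2 + 2) := block_mx 0 0 0 G2.
Let G : 'M[R]_(2 + 2) := block_mx G1 0 0 G2.

Definition curv_form (a b c e : 'I_(2 + 2)) : R :=
  s * (k1 * (L a c * L b e - L a e * L b c) + k2 * (H a c * H b e - H a e * H b c)
   + (G a c * B b e + G b e * B a c - G a e * B b c - G b c * B a e)).

Hypothesis weak : forall a b, rsqT (s *: G) curv_form a b = f * (s *: G) a b.
Let b1 : R := \tr (invmx G1 *m ulsubmx B).
Let b2 : R := \tr (invmx G2 *m drsubmx B).

(** In a frame orthonormal for both factors the hypothesis makes the square a multiple of the
    identity. Its nine traceless components vanish, and conjugation by the frame turns them back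
    into equations between matrices. *)
Lemma weak_trichotomy :
  [/\ (k1 + k2 + 2 * (b1 + b2)) *: ursubmx B = 0,
      (b1 + b2) *: (2 *: ulsubmx B - b1 *: G1) = 0,
      (b1 + b2) *: (2 *: drsubmx B - b2 *: G2) = 0 &
      (k1 + k2 + (b1 + b2)) * (k1 - k2 + (b1 - b2)) = 0].
Proof.
have [P1 e1] := frame_exists sG1 pG1; have [P2 e2] := frame_exists sG2 pG2.
have [uP1 i1] := invmx_frame e1; have [uP2 i2] := invmx_frame e2.
pose P : 'M[R]_(2 + 2) := block_mx P1 0 0 P2.
have PT : P^T = block_mx P1^T 0 0 P2^T by rewrite /P tr_block_mx !trmx0.
have sand (X Y : 'M[R]_2) : P *m block_mx X 0 0 Y *m P^T =
    block_mx (P1 *m X *m P1^T) 0 0 (P2 *m Y *m P2^T).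
  by rewrite PT /P !mulmx_block !(mulmx0, mul0mx, addr0, add0r).
have P1i : P1 *m 0 *m P1^T = 0 by rewrite mulmx0 mul0mx.
have P2i : P2 *m 0 *m P2^T = 0 by rewrite mulmx0 mul0mx.
have LE a c : (P *m L *m P^T) a c = dlow a c.
  rewrite sand e1 P2i; case: (split_ordP a) => i ->; case: (split_ordP c) => j ->;
    rewrite ?block_mxEul ?block_mxEur ?block_mxEdl ?block_mxEdr !mxE;
    by case: (ord2P i) => ->; case: (ord2P j) => ->.
have HE a c : (P *m H *m P^T) a c = dhigh a c.
  rewrite sand e2 P1i; case: (split_ordP a) => i ->; case: (split_ordP c) => j ->;
    rewrite ?block_mxEul ?block_mxEur ?block_mxEdl ?block_mxEdr !mxE;
    by case: (ord2P i) => ->; case: (ord2P j) => ->.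
have GE a c : (P *m G *m P^T) a c = dfull a c.
  rewrite sand e1 e2; case: (split_ordP a) => i ->; case: (split_ordP c) => j ->;
    rewrite ?block_mxEul ?block_mxEur ?block_mxEdl ?block_mxEdr !mxE;
    by case: (ord2P i) => ->; case: (ord2P j) => ->.
have PG1 : P *m G *m P^T = 1%:M.
  by rewrite sand e1 e2 -scalar_mx_block.
have [uP iG] := invmx_frame PG1.
(* [inord] makes the components functions of natural numbers, as [tform] expects; at indices below 4
   it loses nothing. *)
pose b (m n : nat) : R := (P *m B *m P^T) (inord m : 'I_4) (inord n : 'I_4).
have bE (a c : 'I_(2 + 2)) : (P *m B *m P^T) a c = b a c.
  by rewrite /b !(@inord_val 3).
have sb m n : b m n = b n m.
  have /matrixP e : (P *m B *m P^T)^T = P *m B *m P^T.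
    rewrite !trmx_mul trmxK mulmxA; congr (_ *m _ *m _).
    by apply/matrixP => i j; rewrite mxE sB.
  by rewrite /b -e mxE.
have frE (i k p q : 'I_(2 + 2)) : frameT P curv_form i k p q = s * tform k1 k2 b i k p q.
  have -> : curv_form = fun a b c e => s * ((k1 * (L a c * L b e) + (- k1) * (L a e * L b c)
     + (k2 * (H a c * H b e) + (- k2) * (H a e * H b c)))
     + (G a c * B b e + B a c * G b e + ((-1) * (G a e * B b c) + (-1) * (B a e * G b c)))).
    by apply/funext => x; apply/funext => y; apply/funext => z; apply/funext => t; rewrite /curv_form; ring.
  rewrite frameTZ !frameTD !frameTZ.
  rewrite !(frameT_prod, frameT_prod2) !LE !HE !GE !bE /tform; congr (s * _); ring.
have sinv : invmx (s *: G) = s^-1 *: (P^T *m P).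
  by rewrite invmxZ ?iG // unitmxZ ?unitfE //; have [] := mulmx1_unit (etrans (mulmxA _ _ _) PG1) => _; rewrite unitmx_mul => /andP[].
have tsqE (i j : 'I_(2 + 2)) : tsq k1 k2 b i j = f * s ^+ 2 * dfull i j.
  have := rsqT_frame curv_form i j sinv.
  have weakE a c : rsqT (s *: G) curv_form a c = f * (s * G a c) by rewrite weak !mxE.
  under eq_bigr do under eq_bigr do rewrite weakE.
  have -> : \sum_a \sum_b P i a * P j b * (f * (s * G a b)) = f * s * dfull i j.
    have -> : dfull i j = \sum_a \sum_c P i a * G a c * P j c.
      rewrite -GE mxE exchange_big; apply: eq_bigr => x _ /=.
      by rewrite [P^T x j]mxE [(P *m G) i x]mxE mulr_suml.
    rewrite mulr_sumr; apply: eq_bigr => x _; rewrite mulr_sumr; apply: eq_bigr => y _; ring.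
  have -> : \sum_k \sum_p \sum_q frameT P curv_form i k p q * frameT P curv_form j k p q =
      s ^+ 2 * tsq k1 k2 b i j.
    rewrite /tsq mulr_sumr; apply: eq_bigr => k _; rewrite mulr_sumr; apply: eq_bigr => p _.
    by rewrite mulr_sumr; apply: eq_bigr => q _; rewrite !frE; ring.
  move=> /(congr1 (fun y => s * y)) e; transitivity (s * (s^-1 ^+ 3 * (s ^+ 2 * tsq k1 k2 b i j))).
    by field.
  by rewrite -e; ring.
pose X1 := P1 *m ulsubmx B *m P1^T; pose X2 := P2 *m drsubmx B *m P2^T.
pose Y := P1 *m ursubmx B *m P2^T.
have PBP : P *m B *m P^T = block_mx X1 Y (P2 *m dlsubmx B *m P1^T) X2.
  by rewrite PT -[in LHS](submxK B) /P !mulmx_block !(mulmx0, mul0mx, addr0, add0r).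
have X1E (i j : 'I_2) : X1 i j = b i j.
  by rewrite -[LHS](block_mxEul X1 Y (P2 *m dlsubmx B *m P1^T) X2) -PBP bE.
have X2E (i j : 'I_2) : X2 i j = b (2 + i)%N (2 + j)%N.
  by rewrite -[LHS](block_mxEdr X1 Y (P2 *m dlsubmx B *m P1^T) X2) -PBP bE.
have YE (i j : 'I_2) : Y i j = b i (2 + j)%N.
  by rewrite -[LHS](block_mxEur X1 Y (P2 *m dlsubmx B *m P1^T) X2) -PBP bE.
have b1E : b1 = b 0%N 0%N + b 1%N 1%N.
  rewrite /b1 i1 -mulmxA mxtrace_mulC -[LHS]/(\tr X1).
  by rewrite /mxtrace big_ord2 !X1E.
have b2E : b2 = b 2%N 2%N + b 3%N 3%N.
  rewrite /b2 i2 -mulmxA mxtrace_mulC -[LHS]/(\tr X2).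
  by rewrite /mxtrace big_ord2 !X2E.
have tq (i j : 'I_4) : tsq k1 k2 b i j = f * s ^+ 2 * dfull i j by exact: tsqE.
have t4 : b1 + b2 = b 0%N 0%N + b 1%N 1%N + b 2%N 2%N + b 3%N 3%N by rewrite b1E b2E; ring.
have q (i j : nat) (hi : (i < 4)%N) (hj : (j < 4)%N) := tq (Ordinal hi) (Ordinal hj).
have q01 := q 0%N 1%N isT isT; have q23 := q 2%N 3%N isT isT.
have q02 := q 0%N 2%N isT isT; have q03 := q 0%N 3%N isT isT.
have q12 := q 1%N 2%N isT isT; have q13 := q 1%N 3%N isT isT.
have q00 := q 0%N 0%N isT isT; have q11 := q 1%N 1%N isT isT.
have q22 := q 2%N 2%N isT isT; have q33 := q 3%N 3%N isT isT.
move: q00 q11 q22 q33 q01 q23 q02 q03 q12 q13; rewrite /dfull /= !mulr0 mulr1 => q00 q11 q22 q33.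
rewrite tsq01 // tsq23 // tsq02 // tsq03 // tsq12 // tsq13 // -t4 => q01 q23 q02 q03 q12 q13.
have := tsq00_11 k1 k2 sb; rewrite q00 q11 subrr -t4 => d01.
have := tsq22_33 k1 k2 sb; rewrite q22 q33 subrr -t4 => d23.
have := tsq_tr k1 k2 sb; rewrite q00 q11 q22 q33 -t4 => dtr.
(* An equation between frame components is one between the matrices themselves, the frames being
   invertible. *)
have inj (A P' Q' : 'M[R]_2) : P' \in unitmx -> Q' \in unitmx -> P' *m A *m Q'^T = 0 -> A = 0.
  move=> uP' uQ' /(congr1 (fun Z => invmx P' *m Z *m invmx Q'^T)).
  by rewrite !mulmx0 mul0mx !mulmxA mulVmx // mul1mx mulmxK // unitmx_tr.
have m2P (A : 'M[R]_2) : A 0 0 = 0 -> A 0 1 = 0 -> A 1 0 = 0 -> A 1 1 = 0 -> A = 0.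
  move=> *; apply/matrixP => i j; rewrite !mxE.
  by case: (ord2P i) => ->; case: (ord2P j) => ->.
have ent (Z : 'M[R]_2) (c x : R) i j :
  (c *: (2 *: Z - x *: 1%:M)) i j = c * (2 * Z i j - x * (i == j)%:R) by rewrite !mxE.
have entY (Z : 'M[R]_2) (c : R) i j : (c *: Z) i j = c * Z i j by rewrite !mxE.
split.
- move: (b1 + b2) q02 q03 q12 q13 => T q02 q03 q12 q13; apply: (inj _ _ _ uP1 uP2); rewrite -scalemxAr -scalemxAl -/Y.
  have [y00 y01 y10 y11] : [/\ Y 0 0 = b 0%N 2%N, Y 0 1 = b 0%N 3%N, Y 1 0 = b 1%N 2%N & Y 1 1 = b 1%N 3%N].
    by split; rewrite YE.
  by apply: m2P; rewrite entY ?(y00, y01, y10, y11); apply: lin_d.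
- move: (b1 + b2) q01 d01 => T q01 d01; apply: (inj _ _ _ uP1 uP1); rewrite -scalemxAr -scalemxAl mulmxBr mulmxBl -2!scalemxAr -2!scalemxAl e1 -/X1.
  have [x00 x01 x10 x11] : [/\ X1 0 0 = b 0%N 0%N, X1 0 1 = b 0%N 1%N, X1 1 0 = b 0%N 1%N & X1 1 1 = b 1%N 1%N].
    by split; rewrite X1E // sb.
  by apply: m2P; rewrite ent ?(x00, x01, x10, x11) b1E; [exact: lin_a d01|exact: lin_c q01|exact: lin_c q01|exact: lin_b d01].
- move: (b1 + b2) q23 d23 => T q23 d23; apply: (inj _ _ _ uP2 uP2); rewrite -scalemxAr -scalemxAl mulmxBr mulmxBl -2!scalemxAr -2!scalemxAl e2 -/X2.
  have [x00 x01 x10 x11] : [/\ X2 0 0 = b 2%N 2%N, X2 0 1 = b 2%N 3%N, X2 1 0 = b 2%N 3%N & X2 1 1 = b 3%N 3%N].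
    by split; rewrite X2E // sb.
  by apply: m2P; rewrite ent ?(x00, x01, x10, x11) b2E; [exact: lin_a d23|exact: lin_c q23|exact: lin_c q23|exact: lin_b d23].
- by have := lin_e dtr; rewrite -b1E -b2E.
Qed.
End Trichotomy.
End FourDim.

(** * Ricci, Einstein and Weyl tensors at a point *)

Section PointwiseTensors.
Context {R : realType}.

(** This contraction and the next three depend only on the values of the metric and the curvature at
    one point; [ricci], [scal], [einstein] and [weyl] reduce to them by conversion. *)
Definition ricT n (g : 'M[R]_n) (T : 'I_n -> 'I_n -> 'I_n -> 'I_n -> R) (b d : 'I_n) : R :=
  \sum_a \sum_c invmx g a c * T a b c d.

Definition scaT n (g : 'M[R]_n) (T : 'I_n -> 'I_n -> 'I_n -> 'I_n -> R) : R :=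
  \sum_b \sum_d invmx g b d * ricT g T b d.

Definition einT n (g : 'M[R]_n) (T : 'I_n -> 'I_n -> 'I_n -> 'I_n -> R) (i j : 'I_n) : R :=
  ricT g T i j - scaT g T / n%:R * g i j.

Definition weyT n (g : 'M[R]_n) (T : 'I_n -> 'I_n -> 'I_n -> 'I_n -> R) (a b c d : 'I_n) : R :=
  T a b c d
  - (g a c * ricT g T b d - g a d * ricT g T b c
     + g b d * ricT g T a c - g b c * ricT g T a d) / (n%:R - 2)
  + scaT g T * (g a c * g b d - g a d * g b c) / ((n%:R - 1) * (n%:R - 2)).

Section FourDimTensors.
Variables (G1 G2 : 'M[R]_2) (B : 'M[R]_(2 + 2)) (k1 k2 s : R).
Hypotheses (sG1 : forall i j, G1 i j = G1 j i) (sG2 : forall i j, G2 i j = G2 j i).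
Hypotheses (uG1 : G1 \in unitmx) (uG2 : G2 \in unitmx).
Hypothesis sB : forall i j, B i j = B j i.
Hypothesis s0 : s != 0.
Let L : 'M[R]_(2 + 2) := block_mx G1 0 0 0.
Let H : 'M[R]_(2 + 2) := block_mx 0 0 0 G2.
Let G : 'M[R]_(2 + 2) := block_mx G1 0 0 G2.
Let T := curv_form G1 G2 B k1 k2 s.
Let b1 : R := \tr (invmx G1 *m ulsubmx B).
Let b2 : R := \tr (invmx G2 *m drsubmx B).

Let uG : G \in unitmx. Proof. by rewrite block_diag_mx_unit uG1. Qed.

Let sG i j : G i j = G j i.
Proof.
have : G^T = G by rewrite /G tr_block_mx !trmx0; congr block_mx; apply/matrixP => x y; rewrite mxE.
by move=> /matrixP/(_ i j); rewrite mxE.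
Qed.

Let tr1 n (g X : 'M[R]_n) : (forall i j, X i j = X j i) ->
  \sum_a \sum_c invmx g a c * X a c = \tr (invmx g *m X).
Proof.
by move=> sX; rewrite /mxtrace; apply: eq_bigr => a _; rewrite mxE; apply: eq_bigr => c _; rewrite sX.
Qed.

Let cross (X Y : 'M[R]_(2 + 2)) b d : (forall i j, Y i j = Y j i) ->
  \sum_a \sum_c invmx G a c * (X a d * Y b c) = (Y *m invmx G *m X) b d.
Proof.
move=> sY; rewrite mxE; apply: eq_bigr => a _; rewrite mxE mulr_suml; apply: eq_bigr => c _.
have -> : invmx G a c = invmx G c a.
  have /matrixP/(_ c a) : (invmx G)^T = invmx G.
    by rewrite trmx_inv; congr invmx; apply/matrixP => x y; rewrite mxE sG.
  by rewrite mxE.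
ring.
Qed.

Let sL i j : L i j = L j i.
Proof.
have : L^T = L by rewrite /L tr_block_mx !trmx0; congr block_mx; apply/matrixP => x y; rewrite mxE.
by move=> /matrixP/(_ i j); rewrite mxE.
Qed.
Let sH i j : H i j = H j i.
Proof.
have : H^T = H by rewrite /H tr_block_mx !trmx0; congr block_mx; apply/matrixP => x y; rewrite mxE.
by move=> /matrixP/(_ i j); rewrite mxE.
Qed.

Let iG : invmx G = block_mx (invmx G1) 0 0 (invmx G2).
Proof. exact: invmx_block_diag. Qed.

Let GLH i j : G i j = L i j + H i j.
Proof.
have -> : G = L + H by rewrite /L /H add_block_mx !addr0 add0r.
by rewrite [LHS]mxE.
Qed.

Let trB : \tr (invmx G *m B) = b1 + b2.
Proof.
rewrite iG -[in LHS](submxK B) mulmx_block !(mul0mx, addr0, add0r).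
by rewrite mxtrace_block.
Qed.

(** The Ricci contraction of the Kulkarni-Nomizu product of G and B is (n - 2) B + (tr B) G, hence
    the coefficient 2. The scale s cancels against the inverse metric. *)
Lemma ric_curv_form b d : ricT (s *: G) T b d =
  k1 * L b d + k2 * H b d + 2 * B b d + (b1 + b2) * G b d.
Proof.
have -> : ricT (s *: G) T b d =
   k1 * (\sum_a \sum_c invmx G a c * L a c) * L b d - k1 * (\sum_a \sum_c invmx G a c * (L a d * L b c))
   + k2 * (\sum_a \sum_c invmx G a c * H a c) * H b d - k2 * (\sum_a \sum_c invmx G a c * (H a d * H b c))
   + (\sum_a \sum_c invmx G a c * G a c) * B b d + (\sum_a \sum_c invmx G a c * B a c) * G b d
   - (\sum_a \sum_c invmx G a c * (G a d * B b c)) - (\sum_a \sum_c invmx G a c * (B a d * G b c)).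
  rewrite /ricT /= !(mulr_suml, mulr_sumr) -!(sumrB, big_split) /=; apply: eq_bigr => a _.
  rewrite !(mulr_suml, mulr_sumr) -!(sumrB, big_split) /=; apply: eq_bigr => c _.
  rewrite invmxZ ?unitmxZ ?unitfE // mxE /T /curv_form -/G -/L -/H.
  by field.
rewrite !tr1 // !cross // trB.
have -> : \tr (invmx G *m L) = 2.
  by rewrite iG mulmx_block !(mul0mx, mulmx0, addr0, add0r) mulVmx // mxtrace_block mxtrace0 mxtrace1 addr0.
have -> : \tr (invmx G *m H) = 2.
  by rewrite iG mulmx_block !(mul0mx, mulmx0, addr0, add0r) mulVmx // mxtrace_block mxtrace0 mxtrace1 add0r.
have -> : L *m invmx G *m L = L.
  by rewrite iG !mulmx_block !(mul0mx, mulmx0, addr0, add0r) mulmxV // mul1mx.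
have -> : H *m invmx G *m H = H.
  by rewrite iG !mulmx_block !(mul0mx, mulmx0, addr0, add0r) mulmxV // mul1mx.
rewrite mulVmx // mxtrace1 mulmxKV // mulmxV // mul1mx.
by ring.
Qed.

(** The coefficient 6 is 2 + 4, from the traces of 2 B and of (tr B) G. *)
Lemma scal_curv_form : scaT (s *: G) T = s^-1 * (2 * (k1 + k2) + 6 * (b1 + b2)).
Proof.
have -> : scaT (s *: G) T = s^-1 * (k1 * (\sum_a \sum_c invmx G a c * L a c)
   + k2 * (\sum_a \sum_c invmx G a c * H a c) + 2 * (\sum_a \sum_c invmx G a c * B a c)
   + (b1 + b2) * (\sum_a \sum_c invmx G a c * G a c)).
  rewrite /scaT; under eq_bigr do under eq_bigr do rewrite ric_curv_form.
  move: (b1 + b2) => t.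
  rewrite !(mulr_suml, mulr_sumr) -!(sumrB, big_split) /= mulr_sumr; apply: eq_bigr => a _.
  rewrite !(mulr_suml, mulr_sumr) -!(sumrB, big_split) /= ?mulr_sumr; apply: eq_bigr => c _.
  by rewrite invmxZ ?unitmxZ ?unitfE // mxE; ring.
rewrite !tr1 // trB.
have -> : \tr (invmx G *m L) = 2.
  by rewrite iG mulmx_block !(mul0mx, mulmx0, addr0, add0r) mulVmx // mxtrace_block mxtrace0 mxtrace1 addr0.
have -> : \tr (invmx G *m H) = 2.
  by rewrite iG mulmx_block !(mul0mx, mulmx0, addr0, add0r) mulVmx // mxtrace_block mxtrace0 mxtrace1 add0r.
rewrite mulVmx // mxtrace1; ring.
Qed.

(** The terms in B are a Kulkarni-Nomizu product with the metric and drop out of the Weyl tensor.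
    What is left is that of the product of two surfaces, proportional to k1 + k2. *)
Lemma weyl_curv_form0 : k1 + k2 = 0 -> forall a b c d, weyT (s *: G) T a b c d = 0.
Proof.
move=> /(canRL (addKr _)); rewrite addr0 => kE a b c d.
have sGE x y : (s *: G) x y = s * G x y by rewrite [LHS]mxE.
rewrite /weyT scal_curv_form !ric_curv_form !sGE /T /curv_form -/G -/L -/H !GLH kE.
have -> : (2 + 2)%:R = 4 :> R by [].
by field.
Qed.

(** With t = b1 + b2, the Ricci tensor is k1 + b1 + t times the first metric plus k2 + b2 + t times
    the second; the last hypothesis makes the two coefficients equal. *)
Lemma einstein_curv_form0 : ursubmx B = 0 -> 2 *: ulsubmx B = b1 *: G1 ->
  2 *: drsubmx B = b2 *: G2 -> k1 - k2 + (b1 - b2) = 0 ->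
  forall i j, einT (s *: G) T i j = 0.
Proof.
move=> B12 B11 B22 e i j.
have B21 : dlsubmx B = 0.
  by apply/matrixP => x y; move/matrixP: B12 => /(_ y x); rewrite !mxE sB.
have BE : 2 * B i j = b1 * L i j + b2 * H i j.
  have : 2 *: B = b1 *: L + b2 *: H.
    rewrite -[in LHS](submxK B) !scale_block_mx add_block_mx B12 B21 B11 B22.
    by rewrite !scaler0 !addr0 !add0r.
  by move=> /matrixP/(_ i j); rewrite !mxE.
have sGE x y : (s *: G) x y = s * G x y by rewrite [LHS]mxE.
rewrite /einT scal_curv_form ric_curv_form BE sGE GLH.
have -> : (2 + 2)%:R = 4 :> R by [].
have -> : k1 = k2 - (b1 - b2) by rewrite -[LHS]subr0 -e; ring.
by field.
Qed.

End FourDimTensors.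
End PointwiseTensors.

(** * Coordinate expressions and the ring *)

Section Bridge.
Context {R : realType} {N n : nat} (D : odom R N).
Variables (proj : 'rV[R]_N -> 'rV[R]_n) (e : 'I_n -> 'I_N).
Hypothesis projE : forall z k (h : R),
  proj (h *: delta_mx 0 (e k) + z) = h *: delta_mx 0 k + proj z.

(* F represents the function f, pulled back along the coordinate projection proj. *)
Definition rep (f : 'rV[R]_n -> R) (F : sfun D) : Prop :=
  forall z (Dz : dom D z), f (proj z) = ev Dz F.

Let dd : dfam (sfun D) n := pdfam D e.

Lemma unit2 : (2 : sfun D) \is a GRing.unit.
Proof.
apply/sf_unitP => x Dx; rewrite -[_ x]/(ev Dx 2) rmorph_nat.
by rewrite pnatr_eq0.
Qed.

Lemma ev_half z (Dz : dom D z) : ev Dz (2^-1) = 2^-1.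
Proof. by rewrite rmorphV ?rmorph_nat //; exact: unit2. Qed.

(** By [projE], the difference quotients of f at proj z and of its pullback at z are the same
    function. *)
Lemma rep_pd f F k : rep f F -> rep (pderiv f k) (dd k F).
Proof.
move=> fF z Dz; have -> : ev Dz (dd k F) = pderiv F (e k) z by exact: mksfE.
transitivity (pderiv (f \o proj) (e k) z); last first.
  by apply: (pderiv_eq_on (@dom_open _ _ D)) Dz => y Dy; exact: fF.
have E : (fun h : R => h^-1 *: ((f \o shift (proj z)) (h *: (delta_mx 0 k : 'rV[R]_n)) - f (proj z))) =
  (fun h : R => h^-1 *: (((f \o proj) \o shift z) (h *: delta_mx 0 (e k)) - (f \o proj) z)).
  by apply/funext => h /=; rewrite projE.
by rewrite /pderiv /derive E.
Qed.

Variables (g : 'rV[R]_n -> 'M[R]_n) (G : 'M[sfun D]_n).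
Hypothesis uG : G \in unitmx.
Hypothesis gG : forall i j, rep (fun y => g y i j) (G i j).

Lemma ev_metric z (Dz : dom D z) : map_mx (ev Dz) G = g (proj z).
Proof. by apply/matrixP => i j; rewrite mxE (gG i j Dz). Qed.

Lemma metric_unit z (Dz : dom D z) : g (proj z) \in unitmx.
Proof.
rewrite -(ev_metric Dz); have : map_mx (ev Dz) G *m map_mx (ev Dz) (invmx G) = 1%:M.
  by rewrite -map_mxM mulmxV // map_mx1.
by case/mulmx1_unit.
Qed.

Lemma rep_ginv i j : rep (ginv g i j) (invmx G i j).
Proof.
move=> z Dz; rewrite /ginv -(ev_metric Dz).
have uz : map_mx (ev Dz) G \in unitmx by rewrite (ev_metric Dz); exact: metric_unit.
have <- : map_mx (ev Dz) (invmx G) = invmx (map_mx (ev Dz) G).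
  rewrite -[RHS]mulmx1 -(map_mx1 (ev Dz)) -(mulmxV uG) map_mxM mulmxA mulVmx //.
  by rewrite mul1mx.
by rewrite mxE.
Qed.

Lemma rep_christoffel k i j : rep (christoffel g k i j) (chr dd G k i j).
Proof.
move=> z Dz; rewrite /christoffel /chr rmorphM /= ev_half rmorph_sum /=; congr (_ * _).
apply: eq_bigr => l _; rewrite rmorphM rmorphB rmorphD /= (rep_ginv k l Dz).
by rewrite (rep_pd i (gG j l) Dz) (rep_pd j (gG i l) Dz) (rep_pd l (gG i j) Dz).
Qed.

Lemma rep_curvature_formula (C : 'I_n -> 'I_n -> 'I_n -> 'rV[R]_n -> R) (X : 'I_n -> 'I_n -> 'I_n -> sfun D)
    a b c d : (forall i j k, rep (C i j k) (X i j k)) ->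
  rep (fun x => pderiv (C a d b) c x - pderiv (C a c b) d x
        + \sum_m (C a c m x * C m d b x - C a d m x * C m c b x))
      (dd c (X a d b) - dd d (X a c b) + \sum_m (X a c m * X m d b - X a d m * X m c b)).
Proof.
move=> CX z Dz; rewrite rmorphD rmorphB rmorph_sum /=.
rewrite (rep_pd c (CX a d b) Dz) (rep_pd d (CX a c b) Dz).
by congr (_ + _); apply: eq_bigr => m _; rewrite rmorphB !rmorphM /= !(CX _ _ _ z Dz).
Qed.

Lemma rep_riemann_up a b c d : rep (riemann_up g a b c d) (rup dd G a b c d).
Proof. exact: rep_curvature_formula rep_christoffel. Qed.

Lemma rep_sumM (I : finType) (f h : I -> 'rV[R]_n -> R) (F H : I -> sfun D) :
  (forall i, rep (f i) (F i)) -> (forall i, rep (h i) (H i)) ->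
  rep (fun x => \sum_i f i x * h i x) (\sum_i F i * H i).
Proof.
move=> fF hH z Dz; rewrite rmorph_sum; apply: eq_bigr => m _ /=.
by rewrite rmorphM /= (fF m z Dz) (hH m z Dz).
Qed.

Lemma rep_riemann a b c d : rep (riemann g a b c d) (rie dd G a b c d).
Proof. exact: rep_sumM (gG a) (fun m => rep_riemann_up m b c d). Qed.

Lemma rep_sum2M (I : finType) (f h : I -> I -> 'rV[R]_n -> R) (F H : I -> I -> sfun D) :
  (forall i j, rep (f i j) (F i j)) -> (forall i j, rep (h i j) (H i j)) ->
  rep (fun x => \sum_i \sum_j f i j x * h i j x) (\sum_i \sum_j F i j * H i j).
Proof.
move=> fF hH z Dz; rewrite rmorph_sum; apply: eq_bigr => m _ /=.
exact: rep_sumM (fF m) (hH m) z Dz.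
Qed.

Lemma rep_mul f h F H : rep f F -> rep h H -> rep (fun x => f x * h x) (F * H).
Proof. by move=> fF hH z Dz; rewrite rmorphM /= (fF z Dz) (hH z Dz). Qed.

Lemma rep_sub f h F H : rep f F -> rep h H -> rep (fun x => f x - h x) (F - H).
Proof. by move=> fF hH z Dz; rewrite rmorphB /= (fF z Dz) (hH z Dz). Qed.

Lemma rep_hessian f F i j : rep f F -> rep (fun x => hessian g f x i j) (hes dd G F i j).
Proof.
move=> fF z Dz; rewrite mxE.
exact: (rep_sub (rep_pd i (rep_pd j fF))
  (rep_sumM (fun k => rep_christoffel k i j) (fun k => rep_pd k fF)) Dz).
Qed.

Lemma rep_laplacian f F : rep f F -> rep (laplacian g f) (lap dd G F).
Proof. by move=> fF; exact: rep_sum2M rep_ginv (fun i j => rep_hessian i j fF). Qed.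

Lemma rep_grad_sqr f F : rep f F -> rep (grad_sqr g f) (gsq dd G F).
Proof.
move=> fF; exact: (rep_sum2M (fun i j => rep_mul (rep_ginv i j) (rep_pd i fF)) (fun i j => rep_pd j fF)).
Qed.

End Bridge.

Lemma rep_gauss (R : realType) N (D : odom R N) (proj : 'rV[R]_N -> 'rV[R]_2) (e : 'I_2 -> 'I_N)
    (projE : forall z k (h : R), proj (h *: delta_mx 0 (e k) + z) = h *: delta_mx 0 k + proj z)
    (g : 'rV[R]_2 -> 'M[R]_2) (G : 'M[sfun D]_2) : G \in unitmx ->
    (forall i j, rep proj (fun y => g y i j) (G i j)) ->
  rep proj (gauss g) (gau (pdfam D e) G).
Proof.
move=> uG gG z Dz; rewrite /gauss /gau rmorphM /= rmorphV; last by [].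
rewrite (rep_riemann projE uG gG _ _ _ _ Dz); congr (_ / _).
by rewrite -(ev_metric gG Dz) det_map_mx.
Qed.

(** * Consequences of the weak Einstein condition *)

Section CommutingFamilies.
Context {S : comUnitRingType} {n : nat}.
Variables (d : dfam S n) (d0 : S -> S) (G : 'M[S]_n).
Hypothesis d0D : forall f g, d0 (f + g) = d0 f + d0 g.
Hypothesis d0M : forall f g, d0 (f * g) = d0 f * g + f * d0 g.
Hypothesis d0C : forall k f, d0 (d k f) = d k (d0 f).
Hypothesis uG : G \in unitmx.
Hypothesis d0G : forall i j, d0 (G i j) = 0.
Hypothesis d0half : d0 2^-1 = 0.

Let d00 : d0 0 = 0.
Proof. by apply: (addIr (d0 0)); rewrite -d0D !add0r. Qed.

Let d0N f : d0 (- f) = - d0 f.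
Proof. by apply: (addIr (d0 f)); rewrite -d0D !addNr d00. Qed.

Let d0_sum (I : Type) (s : seq I) (F : I -> S) : d0 (\sum_(i <- s) F i) = \sum_(i <- s) d0 (F i).
Proof. by elim: s => [|i s IH]; rewrite ?big_nil ?d00 // !big_cons d0D IH. Qed.

Let d01 : d0 1 = 0.
Proof. by apply: (addIr (d0 1)); rewrite -{3}[1]mulr1 d0M mulr1 mul1r add0r. Qed.

Let d0M0 x y : d0 x = 0 -> d0 y = 0 -> d0 (x * y) = 0.
Proof. by move=> x0 y0; rewrite d0M x0 y0 mul0r mulr0 addr0. Qed.

(** Differentiation of G G^-1 = 1, where G is constant. *)
Lemma transverse_invmx i j : d0 (invmx G i j) = 0.
Proof.
have eq0 a : \sum_l G a l * d0 (invmx G l j) = 0.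
  have : d0 ((1%:M : 'M[S]_n) a j) = 0 by rewrite mxE; case: (a == j); rewrite ?d00 ?d01.
  rewrite -(mulmxV uG) mxE d0_sum => e; rewrite -[RHS]e; apply: eq_bigr => l _.
  by rewrite d0M d0G mul0r add0r.
rewrite -(invmx_solve uG (fun l => d0 (invmx G l j)) i) big1 // => l _.
by rewrite eq0 mulr0.
Qed.

Lemma transverse_chr k i j : d0 (chr d G k i j) = 0.
Proof.
rewrite /chr d0M d0half mul0r add0r d0_sum big1 ?mulr0 // => l _.
rewrite d0M transverse_invmx mul0r add0r !d0D d0N !d0C !d0G !dv0.
by rewrite oppr0 !addr0 mulr0.
Qed.

Lemma transverse_rie a b c e : d0 (rie d G a b c e) = 0.
Proof.
rewrite /rie d0_sum big1 // => m _; rewrite d0M d0G mul0r add0r /rup !d0D d0N !d0C.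
rewrite !transverse_chr !dv0 oppr0 !add0r d0_sum big1 ?mulr0 // => k _.
by rewrite d0D d0N (d0M0 (transverse_chr m c k) (transverse_chr k e b))
  (d0M0 (transverse_chr m e k) (transverse_chr k c b)) oppr0 addr0.
Qed.

Lemma transverse_ip X Y : d0 (ip G X Y) = ip G (fun i => d0 (X i)) Y + ip G X (fun i => d0 (Y i)).
Proof.
rewrite /ip d0_sum -big_split /=; apply: eq_bigr => i _; rewrite d0_sum -big_split /=.
by apply: eq_bigr => j _; rewrite !d0M transverse_invmx; ring.
Qed.

Lemma transverse_cov X i j : d0 (cov d G X i j) = cov d G (fun k => d0 (X k)) i j.
Proof.
rewrite /cov d0D d0N d0C d0_sum; congr (_ - _); apply: eq_bigr => k _.
by rewrite d0M transverse_chr mul0r add0r.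
Qed.

Lemma transverse_hes f i j : d0 (hes d G f i j) = hes d G (d0 f) i j.
Proof. by rewrite [LHS]transverse_cov /hes /cov d0C; congr (_ - _); apply: eq_bigr => k _; rewrite d0C. Qed.

Lemma transverse_lap f : d0 (lap d G f) = lap d G (d0 f).
Proof.
rewrite /lap d0_sum; apply: eq_bigr => i _; rewrite d0_sum; apply: eq_bigr => j _.
by rewrite d0M transverse_invmx mul0r add0r transverse_hes.
Qed.

Lemma lap_const f : (forall k, d k f = 0) -> lap d G f = 0.
Proof.
move=> f0; rewrite /lap big1 // => i _; rewrite big1 // => j _.
by rewrite /hes f0 dv0 big1 ?subr0 ?mulr0 // => k _; rewrite f0 mulr0.
Qed.

End CommutingFamilies.

(** The derivation is applied to K det G = R_0101: both det G and R_0101 are constant, and det G is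
    invertible. *)
Lemma transverse_gau (S : comUnitRingType) (d : dfam S 2) (d0 : S -> S) (G : 'M[S]_2) :
  (forall f g, d0 (f + g) = d0 f + d0 g) ->
  (forall f g, d0 (f * g) = d0 f * g + f * d0 g) ->
  (forall k f, d0 (d k f) = d k (d0 f)) -> G \in unitmx ->
  (forall i j, d0 (G i j) = 0) -> d0 2^-1 = 0 -> d0 (gau d G) = 0.
Proof.
move=> d0D d0M d0C uG d0G dh.
have d00 : d0 0 = 0 by apply: (addIr (d0 0)); rewrite -d0D !add0r.
have uD : \det G \is a GRing.unit by [].
have dD : d0 (\det G) = 0.
  have e : d0 (G 0 0 * G 1 1) = d0 (\det G) + d0 (G 0 1 * G 1 0) by rewrite det2 -d0D subrK.
  by move: e; rewrite !d0M !d0G !mul0r !mulr0 !addr0.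
have : d0 (gau d G * \det G) = 0.
  by rewrite /gau divrK // (transverse_rie d0D d0M d0C uG d0G dh).
rewrite d0M dD mulr0 addr0 => /(congr1 (fun y => y / \det G)).
by rewrite mul0r mulrK.
Qed.

(** * Derivatives along one factor of the equations of the three cases *)

Section TypeEquations.
Context {S : comUnitRingType} (d1 d2 : dfam S 2) (G1 G2 : 'M[S]_2) (psi : S).
Hypothesis d12 : forall i a f, d1 i (d2 a f) = d2 a (d1 i f).
Hypotheses (uG1 : G1 \in unitmx) (sG1 : forall i j, G1 i j = G1 j i).
Hypotheses (uG2 : G2 \in unitmx) (sG2 : forall i j, G2 i j = G2 j i).
Hypotheses (d2G1 : forall a i j, d2 a (G1 i j) = 0) (d1G2 : forall i a b, d1 i (G2 a b) = 0).
Hypothesis u2 : (2 : S) \is a GRing.unit.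
Hypothesis upsi : psi \is a GRing.unit.

Let K1 := gau d1 G1.
Let K2 := gau d2 G2.
Let f1 i := d1 i psi.
Let f2 a := d2 a psi.
Let A := lap d1 G1 psi.
Let Bq := lap d2 G2 psi.
Let P := gsq d1 G1 psi.
Let Q := gsq d2 G2 psi.
Let M i a := d1 i (d2 a psi).

Lemma side_gau i : d1 i K2 = 0.
Proof. exact: transverse_gau (dvD d1 i) (dvM d1 i) (d12 i) uG2 (d1G2 i) (dv_half d1 i). Qed.

Lemma side_gsq i : d1 i P = 2 * ip G1 (hes d1 G1 psi i) f1.
Proof.
rewrite /P /gsq (dv_ip d1 uG1 sG1 u2) [X in _ + X](ipC sG1).
have -> : cov d1 G1 (d1^~ psi) i = hes d1 G1 psi i by [].
by rewrite -/f1; ring.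
Qed.

Lemma side_gsq_other i : d1 i Q = 2 * ip G2 (M i) f2.
Proof.
rewrite /Q /gsq (transverse_ip (dvD d1 i) (dvM d1 i) uG2 (d1G2 i)).
by rewrite [X in _ + X](ipC sG2); ring.
Qed.

Lemma side_lap_other i : d1 i Bq = lap d2 G2 (f1 i).
Proof. exact: (transverse_lap (dvD d1 i) (dvM d1 i) (d12 i) uG2 (d1G2 i) (dv_half d1 i)). Qed.

Lemma half_hes : (forall i j, 2 * hes d1 G1 psi i j = A * G1 i j) ->
  forall i j, hes d1 G1 psi i j = 2^-1 * A * G1 i j.
Proof. by move=> h i j; rewrite -mulrA -h mulKr. Qed.

(** This is [umbilic_grad] with u = A / 2. *)
Lemma side_umbilic : (forall i j, 2 * hes d1 G1 psi i j = A * G1 i j) ->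
  forall i, d1 i A = - (2 * K1 * f1 i).
Proof.
move=> /half_hes h i; have := umbilic_grad uG1 sG1 u2 h i.
rewrite dvM dv_half mul0r add0r => /(congr1 ( *%R 2)); rewrite mulVKr // => ->.
by rewrite -/K1 -/(f1 i); ring.
Qed.

Lemma side_ip_umbilic : (forall i j, 2 * hes d1 G1 psi i j = A * G1 i j) ->
  forall i X, 2 * ip G1 (hes d1 G1 psi i) X = A * X i.
Proof.
move=> /half_hes h i X.
have -> : hes d1 G1 psi i = fun j => 2^-1 * A * G1 j i.
  by apply/funext => j; rewrite h sG1.
by rewrite ipZl (ip_metric uG1 sG1) -mulrA mulVKr.
Qed.

(** The derivative is expanded over variables, here and in the companions below, so that curvatures,
    Laplacians and gradient norms are atoms for [ring]. *)
Let dexpA i (p k l a b x y : S) : d1 i (p ^+ 2 * (k + l) + p * (a + b) - 2 * (x + y)) =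
  2 * p * d1 i p * (k + l) + p ^+ 2 * (d1 i k + d1 i l) + d1 i p * (a + b)
   + p * (d1 i a + d1 i b) - 2 * (d1 i x + d1 i y).
Proof. by rewrite expr2 !(dvB, dvD, dvM, dv_nat); ring. Qed.

Let dexpB i (p k l a b : S) : d1 i ((k - l) * p + (a - b)) =
  (d1 i k - d1 i l) * p + (k - l) * d1 i p + (d1 i a - d1 i b).
Proof. by rewrite dvD dvM dvB dvB; ring. Qed.

Let dexpC i (p a b : S) : d1 i (p * (a + b)) = d1 i p * (a + b) + p * (d1 i a + d1 i b).
Proof. by rewrite !(dvB, dvD, dvM, dv_nat); ring. Qed.

Let dexpD i (c : nat) (a b : S) : d1 i (c%:R * (a + b)) = c%:R * (d1 i a + d1 i b).
Proof. by rewrite dvM dv_nat mul0r add0r dvD. Qed.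

Let dexpE i (p k l a b : S) : d1 i (p ^+ 2 * (k + l) + 2 * p * (a + b)) =
  2 * p * d1 i p * (k + l) + p ^+ 2 * (d1 i k + d1 i l) + 2 * d1 i p * (a + b)
   + 2 * p * (d1 i a + d1 i b).
Proof. by rewrite expr2 !(dvB, dvD, dvM, dv_nat); ring. Qed.

(** The last hypothesis is psi^2 (S + T) = 0, differentiated along the first factor. Since M = 0,
    the quantities Bq and Q are constant in that direction; umbilicity turns the derivative of A
    into curvature and that of P into A df. *)
Lemma typeA_side : (forall i a, M i a = 0) ->
  (forall i j, 2 * hes d1 G1 psi i j = A * G1 i j) ->
  psi ^+ 2 * (K1 + K2) + psi * (A + Bq) - 2 * (P + Q) = 0 ->
  forall i, (2 * psi * K2 + Bq - A) * f1 i + psi ^+ 2 * d1 i K1 = 0.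
Proof.
move=> M0 um E i; have := congr1 (d1 i) E; rewrite dv0 => <-.
rewrite dexpA side_gau side_gsq side_gsq_other side_lap_other.
have -> : ip G2 (M i) f2 = 0 by rewrite (ip00 G2) // => x y; rewrite M0 mul0r.
rewrite lap_const; last by move=> k; rewrite /f1 -d12 -/(M i k).
rewrite side_umbilic // side_ip_umbilic // -/(f1 i); ring.
Qed.

(** Case T = 0: the two equations are q = 0 and psi^2 T = 0, differentiated along the first factor,
    where M = 0 makes Bq and Q constant. *)
Lemma typeC_side : (forall i a, M i a = 0) ->
  (K1 - K2) * psi + (A - Bq) = 0 -> psi * (A + Bq) = 2 * (P + Q) ->
  forall i, d1 i K1 * psi + (K1 - K2) * f1 i + d1 i A = 0 /\
    f1 i * (A + Bq) + psi * d1 i A = 2 * (2 * ip G1 (hes d1 G1 psi i) f1).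
Proof.
move=> M0 E1 E2 i.
have B0 : d1 i Bq = 0.
  by rewrite side_lap_other lap_const // => k; rewrite /f1 -d12 -/(M i k).
split.
  have := congr1 (d1 i) E1; rewrite dv0 dexpB side_gau B0 -/(f1 i) => <-; ring.
have := congr1 (d1 i) E2; rewrite dexpC (dexpD i 2) side_gsq side_gsq_other B0 -/(f1 i).
have -> : ip G2 (M i) f2 = 0 by rewrite (ip00 G2) // => x y; rewrite M0 mul0r.
by rewrite mulr0 !addr0.
Qed.

(** Case S + 2T = 0: the derivatives of q = 0 and of psi^2 (S + 2T) = 0. Here M need not vanish, so
    the derivative of Bq is solved for in the first equation and substituted into the second. *)
Lemma typeB_side : 
  (forall i j, 2 * hes d1 G1 psi i j = A * G1 i j) ->
  (K1 - K2) * psi + (A - Bq) = 0 ->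
  psi ^+ 2 * (K1 + K2) + 2 * psi * (A + Bq) = 4 * (P + Q) ->
  forall i, d1 i Bq = d1 i K1 * psi - (K1 + K2) * f1 i /\
   3 * psi ^+ 2 * d1 i K1 - 2 * psi * (K1 + K2) * f1 i = 8 * ip G2 (M i) f2.
Proof.
move=> um E1 E2 i.
have Bi : d1 i Bq = d1 i K1 * psi - (K1 + K2) * f1 i.
  have := congr1 (d1 i) E1; rewrite dv0 dexpB side_gau side_umbilic // -/(f1 i) => e.
  by rewrite -[LHS]addr0 -e; ring.
split=> //.
have := congr1 (d1 i) E2; rewrite dexpE (dexpD i 4) side_gau side_umbilic //.
rewrite side_gsq side_gsq_other side_ip_umbilic // Bi -/(f1 i).
move: (ip G2 (M i) f2) (f1 i) (d1 i K1) E1 => W f k E1 e.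
have -> : 8 * W = 4 * (A * f + 2 * W) - 4 * A * f by ring.
rewrite -e.
have -> : A = Bq - (K1 - K2) * psi by rewrite -[LHS]subr0 -E1; ring.
ring.
Qed.

End TypeEquations.

(** * The cases S + T = 0 and T = 0 when psi varies along both factors *)

Section TwoSided.
Context {S : comUnitRingType} (d1 d2 : dfam S 2) (G1 G2 : 'M[S]_2) (psi : S).
Hypothesis d12 : forall i a f, d1 i (d2 a f) = d2 a (d1 i f).
Hypotheses (uG1 : G1 \in unitmx) (sG1 : forall i j, G1 i j = G1 j i).
Hypotheses (uG2 : G2 \in unitmx) (sG2 : forall i j, G2 i j = G2 j i).
Hypotheses (d2G1 : forall a i j, d2 a (G1 i j) = 0) (d1G2 : forall i a b, d1 i (G2 a b) = 0).
Hypothesis u2 : (2 : S) \is a GRing.unit.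
Hypothesis upsi : psi \is a GRing.unit.

Let d21 a i f : d2 a (d1 i f) = d1 i (d2 a f). Proof. by rewrite d12. Qed.

Local Notation K1 := (gau d1 G1).
Local Notation K2 := (gau d2 G2).
Local Notation f1 i := (d1 i psi).
Local Notation f2 a := (d2 a psi).
Local Notation A := (lap d1 G1 psi).
Local Notation B := (lap d2 G2 psi).
Local Notation P := (gsq d1 G1 psi).
Local Notation Q := (gsq d2 G2 psi).
Local Notation M i a := (d1 i (d2 a psi)).

Let um1 := forall i j, 2 * hes d1 G1 psi i j = A * G1 i j.
Let um2 := forall i j, 2 * hes d2 G2 psi i j = B * G2 i j.

Let d2A a : (forall i b, M i b = 0) -> d2 a A = 0.
Proof.
move=> M0; by rewrite (side_lap_other psi d21 uG1 d2G1) lap_const.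
Qed.

(** Differentiating the equation of the first factor along the second gives f2 dK1 + f1 dK2 = 0.
    Multiplying the equations of the two factors by f2 and f1 and adding, only 2 psi S f1 f2
    remains. *)
Lemma typeA_no_mixed : (forall i a, M i a = 0) -> um1 -> um2 ->
  psi ^+ 2 * (K1 + K2) + psi * (A + B) - 2 * (P + Q) = 0 ->
  forall i a, (K1 + K2) * (f1 i * f2 a) = 0.
Proof.
move=> M0 h1 h2 E i a.
have M0' b j : d2 b (d1 j psi) = 0 by rewrite d21.
have E' : psi ^+ 2 * (K2 + K1) + psi * (B + A) - 2 * (Q + P) = 0.
  by rewrite -[RHS]E; ring.
have /= L1 := typeA_side d12 uG1 sG1 uG2 sG2 d1G2 u2 M0 h1 E i.
have /= L2 := typeA_side d21 uG2 sG2 uG1 sG1 d2G1 u2 M0' h2 E' a.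
have dexp (p k b x f h : S) : d2 a ((2 * p * k + b - x) * f + p ^+ 2 * h) =
   (2 * d2 a p * k + 2 * p * d2 a k + d2 a b - d2 a x) * f + (2 * p * k + b - x) * d2 a f
   + 2 * p * d2 a p * h + p ^+ 2 * d2 a h.
  by rewrite expr2 dvD !dvM dvB dvD !dvM dv_nat; ring.
have := congr1 (d2 a) L1; rewrite dv0 dexp (side_umbilic uG2 sG2 u2 h2) d2A // M0'.
rewrite d21 (side_gau d21 uG1 d2G1) dv0 => e.
have e2 : 2 * psi * (d2 a K2 * f1 i + f2 a * d1 i K1) = 0 by rewrite -[RHS]e; ring.
have e3 : d2 a K2 * f1 i + f2 a * d1 i K1 = 0.
  by apply: (mulrI (x := 2 * psi)); rewrite ?mulr0 // unitrM u2.
apply: (mulrI (x := 2 * psi)); first by rewrite unitrM u2.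
rewrite mulr0.
transitivity (((2 * psi * K2 + B - A) * f1 i + psi ^+ 2 * d1 i K1) * f2 a
  + ((2 * psi * K1 + A - B) * f2 a + psi ^+ 2 * d2 a K2) * f1 i
  - psi ^+ 2 * (d2 a K2 * f1 i + f2 a * d1 i K1)); first by ring.
by rewrite L1 L2 e3 !mul0r mulr0 addr0 subr0.
Qed.

(** Where psi varies along the second factor, the traceless Hessian along the first annihilates the
    gradient. The cross derivatives give f2 dK1 = f1 dK2 and f2 dA + f1 dB = 0; with the equations
    of the two factors these force f2 dK1 = 0, and the rest is substitution. *)
Lemma typeC_no_mixed : (forall i a, M i a = 0) ->
  (K1 - K2) * psi + (A - B) = 0 -> psi * (A + B) = 2 * (P + Q) ->
  forall i a, f2 a * (2 * ip G1 (hes d1 G1 psi i) (d1^~ psi) - A * f1 i) = 0.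
Proof.
move=> M0 E1 E2 i a.
have M0' b j : d2 b (d1 j psi) = 0 by rewrite d21.
have E1' : (K2 - K1) * psi + (B - A) = 0 by rewrite -[RHS]oppr0 -E1; ring.
have E2' : psi * (B + A) = 2 * (Q + P) by rewrite addrC E2 addrC.
have /= [X1 X2] := typeC_side d12 uG1 sG1 uG2 sG2 d1G2 u2 M0 E1 E2 i.
have /= [Y1 Y2] := typeC_side d21 uG2 sG2 uG1 sG1 d2G1 u2 M0' E1' E2' a.
have dA : d2 a A = 0 by exact: d2A.
have dK1 : d2 a K1 = 0 by exact: side_gau d21 uG1 d2G1 a.
have dexp1 (k p l x f y : S) : d2 a (k * p + (l - x) * f + y) =
  d2 a k * p + k * d2 a p + (d2 a l - d2 a x) * f + (l - x) * d2 a f + d2 a y.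
  by rewrite dvD dvD !dvM dvB; ring.
have := congr1 (d2 a) X1; rewrite dv0 dexp1 !d21 dK1 dA !dv0 M0 => e1.
have dexp2 (f x y p z : S) : d2 a (f * (x + y) + p * z) =
  d2 a f * (x + y) + f * (d2 a x + d2 a y) + d2 a p * z + p * d2 a z.
  by rewrite dvD !dvM dvD; ring.
have dipH : d2 a (2 * ip G1 (hes d1 G1 psi i) (d1^~ psi)) = 0.
  rewrite -(side_gsq d1 psi uG1 sG1 u2) d21.
  rewrite (side_gsq_other d1 psi uG1 sG1 d2G1) (ip00 G1) ?mulr0 ?dv0 // => x y.
  by rewrite M0' mul0r.
have := congr1 (d2 a) X2; rewrite dexp2 !d21 dA M0 dv0 dvM dv_nat dipH => e2.
have e3 : d1 i K1 * f2 a = 0.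
  apply: (mulrI (x := 2 * psi)); first by rewrite unitrM u2.
  transitivity (psi * (d1 i K1 * f2 a - d2 a K2 * f1 i)
    + (d1 i K1 * psi + (K1 - K2) * f1 i + d1 i A) * f2 a
    + (d2 a K2 * psi + (K2 - K1) * f2 a + d2 a B) * f1 i
    - (f1 i * d2 a B + f2 a * d1 i A)); first by ring.
  rewrite X1 Y1 !mul0r mulr0 !addr0.
  have -> : d1 i K1 * f2 a - d2 a K2 * f1 i = 0 by rewrite -[RHS]e1; ring.
  have -> : f1 i * d2 a B + f2 a * d1 i A = 0 by move: e2; rewrite !mul0r !mulr0 !add0r !addr0.
  by rewrite mulr0 subr0.
apply: (mulrI u2); rewrite mulr0.
transitivity (f2 a * (2 * (2 * ip G1 (hes d1 G1 psi i) (d1^~ psi))) - 2 * A * f1 i * f2 a); first by ring.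
rewrite -X2.
transitivity (psi * (d1 i K1 * psi + (K1 - K2) * f1 i + d1 i A) * f2 a
   - psi ^+ 2 * (d1 i K1 * f2 a) - ((K1 - K2) * psi + (A - B)) * f1 i * f2 a); first by ring.
by rewrite X1 e3 E1; ring.
Qed.

End TwoSided.

(* Case S + 2T = 0: the tensors 2 Hess - Laplacian of both factors vanish and E1, E2 hold. The
   consequences below are algebraic in f1, f2 and the mixed Hessian M, and will exclude the case. *)
Section TypeBSide.
Context {S : comUnitRingType} (d1 d2 : dfam S 2) (G1 G2 : 'M[S]_2) (psi : S).
Hypothesis d12 : forall i a f, d1 i (d2 a f) = d2 a (d1 i f).
Hypotheses (uG1 : G1 \in unitmx) (sG1 : forall i j, G1 i j = G1 j i).
Hypotheses (uG2 : G2 \in unitmx) (sG2 : forall i j, G2 i j = G2 j i).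
Hypotheses (d2G1 : forall a i j, d2 a (G1 i j) = 0) (d1G2 : forall i a b, d1 i (G2 a b) = 0).
Hypothesis u2 : (2 : S) \is a GRing.unit.

Local Notation K1 := (gau d1 G1).
Local Notation K2 := (gau d2 G2).
Local Notation f1 i := (d1 i psi).
Local Notation f2 a := (d2 a psi).
Local Notation A := (lap d1 G1 psi).
Local Notation B := (lap d2 G2 psi).
Local Notation P := (gsq d1 G1 psi).
Local Notation Q := (gsq d2 G2 psi).
Local Notation M i a := (d1 i (d2 a psi)).
Local Notation W i := (ip G2 (fun a => d1 i (d2 a psi)) (d2^~ psi)).

Hypothesis h1 : forall i j, 2 * hes d1 G1 psi i j = A * G1 i j.
Hypothesis h2 : forall i j, 2 * hes d2 G2 psi i j = B * G2 i j.
Hypothesis E1 : (K1 - K2) * psi + (A - B) = 0.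
Hypothesis E2 : psi ^+ 2 * (K1 + K2) + 2 * psi * (A + B) = 4 * (P + Q).

Let d21 a i f : d2 a (d1 i f) = d1 i (d2 a f). Proof. by rewrite d12. Qed.

Lemma typeB_first i : 3 * psi ^+ 2 * d1 i K1 - 2 * psi * (K1 + K2) * f1 i = 8 * W i.
Proof. exact: (typeB_side d12 uG1 sG1 uG2 sG2 d1G2 u2 h1 E1 E2 i).2. Qed.

(** The Leibniz rule for [ip]. The Hessian along the second factor is (B / 2) G2, and the covariant
    derivative of the covector M i is its derivative in the direction i, where G2 is constant. *)
Lemma typeB_dW i b : 2 * d2 b (W i) = d1 i B * f2 b + B * M i b.
Proof.
rewrite (dv_ip d2 uG2 sG2 u2) mulrDr; congr (_ + _).
  have -> : cov d2 G2 (fun a => d1 i (d2 a psi)) b = fun a => 2^-1 * d1 i B * G2 a b.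
    apply/funext => a.
    rewrite -(transverse_cov (dvD d1 i) (dvM d1 i) (d12 i) uG2 (d1G2 i) (dv_half d1 i) (d2^~ psi)).
    have -> : cov d2 G2 (d2^~ psi) b a = hes d2 G2 psi b a by [].
    by rewrite (half_hes u2 h2) !dvM dv_half d1G2 (sG2 b a); ring.
  by rewrite ipZl (ip_metric uG2 sG2) !mulrA mulrV // mul1r.
have -> : cov d2 G2 (d2^~ psi) b = hes d2 G2 psi b by [].
by rewrite (ipC sG2) (side_ip_umbilic uG2 sG2 u2 h2).
Qed.

(** The derivative of [typeB_first] along the second factor, with that of W given by [typeB_dW] and
    that of B by [typeB_side]. *)
Lemma typeB_second i b :
  2 * psi * f2 b * d1 i K1 + 2 * (K1 + K2) * (f1 i * f2 b) - 2 * psi * d2 b K2 * f1 i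
   = (4 * B + 2 * psi * (K1 + K2)) * M i b.
Proof.
have dexp (p k s t f : S) : d2 b (3 * p ^+ 2 * k - 2 * p * (s + t) * f) =
   6 * p * d2 b p * k + 3 * p ^+ 2 * d2 b k - 2 * d2 b p * (s + t) * f
   - 2 * p * (d2 b s + d2 b t) * f - 2 * p * (s + t) * d2 b f.
  by rewrite expr2 dvB !dvM (dvD d2 b s) !dv_nat; ring.
have := congr1 (d2 b) (typeB_first i); rewrite dexp d21 (side_gau d21 uG1 d2G1) dv0 d21.
rewrite dvM dv_nat mul0r add0r.
have -> : 8 * d2 b (W i) = 4 * (2 * d2 b (W i)) by ring.
rewrite typeB_dW (typeB_side d12 uG1 sG1 uG2 sG2 d1G2 u2 h1 E1 E2 i).1 => e.
apply/eqP; rewrite -subr_eq0; apply/eqP.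
move/eqP: e; rewrite -subr_eq0 => /eqP e; rewrite -[RHS]e; ring.
Qed.

(** The differentiated quantity is the obstruction that [typeB_Z] finds: it must vanish wherever psi
    varies along both factors. *)
Lemma typeB_dZ i : d1 i (8 * (Q - P) - 3 * psi ^+ 2 * (K1 - K2)) =
  8 * (2 * W i - A * f1 i) - 6 * psi * f1 i * (K1 - K2) - 3 * psi ^+ 2 * d1 i K1.
Proof.
have dexp (q p f k l : S) : d1 i (8 * (q - p) - 3 * f ^+ 2 * (k - l)) =
  8 * (d1 i q - d1 i p) - 6 * f * d1 i f * (k - l) - 3 * f ^+ 2 * (d1 i k - d1 i l).
  by rewrite expr2 dvB !dvM !dvB !dv_nat; ring.
rewrite dexp (side_gau d12 uG2 d1G2) (side_gsq d1 psi uG1 sG1 u2).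
rewrite (side_gsq_other d2 psi uG2 sG2 d1G2) (side_ip_umbilic uG1 sG1 u2 h1) /=; ring.
Qed.
End TypeBSide.

Section TypeB.
Context {S : comUnitRingType} (d1 d2 : dfam S 2) (G1 G2 : 'M[S]_2) (psi : S).
Hypothesis d12 : forall i a f, d1 i (d2 a f) = d2 a (d1 i f).
Hypotheses (uG1 : G1 \in unitmx) (sG1 : forall i j, G1 i j = G1 j i).
Hypotheses (uG2 : G2 \in unitmx) (sG2 : forall i j, G2 i j = G2 j i).
Hypotheses (d2G1 : forall a i j, d2 a (G1 i j) = 0) (d1G2 : forall i a b, d1 i (G2 a b) = 0).
Hypothesis u2 : (2 : S) \is a GRing.unit.

Local Notation K1 := (gau d1 G1).
Local Notation K2 := (gau d2 G2).
Local Notation f1 i := (d1 i psi).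
Local Notation f2 a := (d2 a psi).
Local Notation A := (lap d1 G1 psi).
Local Notation B := (lap d2 G2 psi).
Local Notation P := (gsq d1 G1 psi).
Local Notation Q := (gsq d2 G2 psi).
Local Notation M i a := (d1 i (d2 a psi)).
Local Notation W i := (ip G2 (fun a => d1 i (d2 a psi)) (d2^~ psi)).
Local Notation W' a := (ip G1 (fun i => d2 a (d1 i psi)) (d1^~ psi)).
Local Notation lam := (A + B + psi * (K1 + K2)).
Local Notation Z := (8 * (Q - P) - 3 * psi ^+ 2 * (K1 - K2)).

Hypothesis h1 : forall i j, 2 * hes d1 G1 psi i j = A * G1 i j.
Hypothesis h2 : forall i j, 2 * hes d2 G2 psi i j = B * G2 i j.
Hypothesis E1 : (K1 - K2) * psi + (A - B) = 0.
Hypothesis E2 : psi ^+ 2 * (K1 + K2) + 2 * psi * (A + B) = 4 * (P + Q).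

Let d21 a i f : d2 a (d1 i f) = d1 i (d2 a f). Proof. by rewrite d12. Qed.
Let E1' : (K2 - K1) * psi + (B - A) = 0. Proof. by rewrite -[RHS]oppr0 -E1; ring. Qed.
Let E2' : psi ^+ 2 * (K2 + K1) + 2 * psi * (B + A) = 4 * (Q + P).
Proof. by rewrite (addrC K2) (addrC B) E2 (addrC P). Qed.

Let u4 : (4 : S) \is a GRing.unit.
Proof. by rewrite (natrM _ 2 2) unitrM u2. Qed.

Let half1 := typeB_second d12 uG1 sG1 uG2 sG2 d2G1 d1G2 u2 h1 h2 E1 E2.
Let half2' := typeB_second d21 uG2 sG2 uG1 sG1 d1G2 d2G1 u2 h2 h1 E1' E2'.

(** Half the information in the two versions of [typeB_second], one for each order of the factors:
    their sum, in which the derivatives of K1 and K2 cancel. *)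
Lemma typeB_hess i b : (K1 + K2) * (f1 i * f2 b) = lam * M i b.
Proof.
have e1 := half1 i b; have e2 := half2' b i; rewrite d21 in e2.
apply: (mulrI u4).
transitivity ((2 * psi * f2 b * d1 i K1 + 2 * (K1 + K2) * (f1 i * f2 b) - 2 * psi * d2 b K2 * f1 i)
  + (2 * psi * f1 i * d2 b K2 + 2 * (K2 + K1) * (f2 b * f1 i) - 2 * psi * d1 i K1 * f2 b)); first by ring.
by rewrite e1 e2; ring.
Qed.

Hypothesis upsi : psi \is a GRing.unit.

(** The other half: the difference of the same two equations, with A - B eliminated by q = 0. *)
Lemma typeB_curl i b : f2 b * d1 i K1 - f1 i * d2 b K2 = (K1 - K2) * M i b.
Proof.
have e1 := half1 i b; have e2 := half2' b i; rewrite d21 in e2.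
apply: (mulrI (x := 4 * psi)); first by rewrite unitrM u4.
transitivity ((2 * psi * f2 b * d1 i K1 + 2 * (K1 + K2) * (f1 i * f2 b) - 2 * psi * d2 b K2 * f1 i)
  - (2 * psi * f1 i * d2 b K2 + 2 * (K2 + K1) * (f2 b * f1 i) - 2 * psi * d1 i K1 * f2 b)); first by ring.
rewrite e1 e2.
transitivity (4 * ((K1 - K2) * psi) * M i b - 4 * ((K1 - K2) * psi + (A - B)) * M i b); last by rewrite E1; ring.
ring.
Qed.

Lemma typeB_W i : lam * W i = (K1 + K2) * f1 i * Q.
Proof.
rewrite /gsq -!ipZl; congr (ip G2 _ _); apply/funext => a.
by rewrite -typeB_hess mulrA.
Qed.

Lemma typeB_W' b : lam * W' b = (K1 + K2) * f2 b * P.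
Proof.
rewrite /gsq -!ipZl; congr (ip G1 _ _); apply/funext => a.
by rewrite d21 -typeB_hess; ring.
Qed.

Lemma typeB_first1 i : 3 * psi ^+ 2 * d1 i K1 - 2 * psi * (K1 + K2) * f1 i = 8 * W i.
Proof. exact: typeB_first. Qed.

Lemma typeB_first2 b : 3 * psi ^+ 2 * d2 b K2 - 2 * psi * (K1 + K2) * f2 b = 8 * W' b.
Proof. by rewrite (addrC K1); apply: typeB_first. Qed.

Lemma typeB_dZ1 i :
  d1 i Z = 8 * (2 * W i - A * f1 i) - 6 * psi * f1 i * (K1 - K2) - 3 * psi ^+ 2 * d1 i K1.
Proof. exact: typeB_dZ. Qed.

Lemma typeB_dZ2 b :
  d2 b Z = 8 * (B * f2 b - 2 * W' b) - 6 * psi * f2 b * (K1 - K2) + 3 * psi ^+ 2 * d2 b K2.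
Proof.
have -> : Z = - (8 * (P - Q) - 3 * psi ^+ 2 * (K2 - K1)) by ring.
rewrite dvN (typeB_dZ d21 uG2 sG2 uG1 sG1 d2G1 u2 h2); ring.
Qed.

Hypothesis uS : K1 + K2 \is a GRing.unit.

(** The expression 8 lam (f2 W - f1 W') is computed in two ways: by contracting [typeB_hess] with
    the differentials, and from the first-order equations by means of [typeB_curl] and [typeB_hess].
    The results differ by S Z f1 f2. *)
Lemma typeB_Z i b : Z * (f1 i * f2 b) = 0.
Proof.
apply: (mulrI uS); rewrite mulr0.
transitivity (3 * psi ^+ 2 * ((K1 - K2) * (lam * M i b - (K1 + K2) * (f1 i * f2 b))
      - lam * ((K1 - K2) * M i b))
  + 8 * (((K1 + K2) * f1 i * Q) * f2 b - ((K1 + K2) * f2 b * P) * f1 i)); first by ring.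
rewrite -typeB_W -typeB_W' -typeB_curl -typeB_hess.
transitivity (lam * (f2 b * (8 * W i) - f1 i * (8 * W' b)) - 3 * psi ^+ 2 * lam * (f2 b * d1 i K1 - f1 i * d2 b K2)); first by ring.
rewrite -typeB_first1 -typeB_first2; ring.
Qed.

End TypeB.

(** * Curvature of a conformally rescaled product of surfaces *)

Section ProductCurvature.
Context {S : comUnitRingType} (d : dfam S (2 + 2)) (G1 G2 : 'M[S]_2) (psi : S).
Hypotheses (uG1 : G1 \in unitmx) (sG1 : forall i j, G1 i j = G1 j i).
Hypotheses (uG2 : G2 \in unitmx) (sG2 : forall i j, G2 i j = G2 j i).
Hypotheses (h1 : forall a i j, d (rshift 2 a) (G1 i j) = 0) (h2 : forall i a b, d (lshift 2 i) (G2 a b) = 0).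
Hypothesis u2 : (2 : S) \is a GRing.unit.
Hypothesis upsi : psi \is a GRing.unit.
Local Notation d1 := (dsub d (@lshift 2 2)).
Local Notation d2 := (dsub d (@rshift 2 2)).
Let L : 'M[S]_(2 + 2) := block_mx G1 0 0 0.
Let H : 'M[S]_(2 + 2) := block_mx 0 0 0 G2.
Let G : 'M[S]_(2 + 2) := block_mx G1 0 0 G2.
Local Notation w := (psi^-1).

Let LE : ((forall i j, L (lshift 2 i) (lshift 2 j) = G1 i j) * (forall i j, L (lshift 2 i) (rshift 2 j) = 0)
  * (forall i j, L (rshift 2 i) (lshift 2 j) = 0) * (forall i j, L (rshift 2 i) (rshift 2 j) = 0))%type.
Proof. by split; [split; [split|]|] => i j; rewrite ?block_mxEul ?block_mxEur ?block_mxEdl ?block_mxEdr ?mxE. Qed.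
Let HE : ((forall i j, H (lshift 2 i) (lshift 2 j) = 0) * (forall i j, H (lshift 2 i) (rshift 2 j) = 0)
  * (forall i j, H (rshift 2 i) (lshift 2 j) = 0) * (forall i j, H (rshift 2 i) (rshift 2 j) = G2 i j))%type.
Proof. by split; [split; [split|]|] => i j; rewrite ?block_mxEul ?block_mxEur ?block_mxEdl ?block_mxEdr ?mxE. Qed.

Lemma rie_product a b c e : rie d G a b c e =
  gau d1 G1 * (L a c * L b e - L a e * L b c) + gau d2 G2 * (H a c * H b e - H a e * H b c).
Proof.
have side_l (i : 'I_2) : (lshift 2 i < 2)%N = true by exact: (ltn_ord i).
have side_r (i : 'I_2) : (rshift 2 i < 2)%N = false by rewrite ltnNge leq_addr.
case: (split_ordP a) => a' ->; case: (split_ordP b) => b' ->;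
  case: (split_ordP c) => c' ->; case: (split_ordP e) => e' ->; rewrite !(LE, HE).
- by rewrite rie_llll // rie_dim2 //; ring.
all: try by rewrite rie_mixed ?/same_side ?(side_l, side_r) //; ring.
by rewrite rie_rrrr // rie_dim2 //; ring.
Qed.

Lemma rie_conformal_product a b c e : rie d (w ^+ 2 *: G) a b c e =
  w ^+ 2 * (gau d1 G1 * (L a c * L b e - L a e * L b c) + gau d2 G2 * (H a c * H b e - H a e * H b c)
   + (G a c * cschouten d G psi b e + G b e * cschouten d G psi a c
     - G a e * cschouten d G psi b c - G b c * cschouten d G psi a e)).
Proof.
rewrite rie_conformal ?rie_product //; first exact: prod_unitmx.
exact: prod_sym.
Qed.

Let N := w ^+ 2 * (gsq d1 G1 psi + gsq d2 G2 psi).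

Lemma cschouten_ll i j : cschouten d G psi (lshift 2 i) (lshift 2 j) =
  w * hes d1 G1 psi i j - 2^-1 * N * G1 i j.
Proof. by rewrite /cschouten hes_ll // gsq_prod // prodEll. Qed.
Lemma cschouten_rr i j : cschouten d G psi (rshift 2 i) (rshift 2 j) =
  w * hes d2 G2 psi i j - 2^-1 * N * G2 i j.
Proof. by rewrite /cschouten hes_rr // gsq_prod // prodErr. Qed.
Lemma cschouten_lr i j : cschouten d G psi (lshift 2 i) (rshift 2 j) =
  w * d (lshift 2 i) (d (rshift 2 j) psi).
Proof. by rewrite /cschouten hes_lr // prodElr mulr0 subr0. Qed.
Lemma cschouten_sym a b : cschouten d G psi a b = cschouten d G psi b a.
Proof.
by rewrite /cschouten (hesC d (prod_sym sG1 sG2)) (prod_sym sG1 sG2 a).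
Qed.

Lemma trace_cschouten1 :
  \sum_i \sum_j invmx G1 i j * cschouten d G psi (lshift 2 j) (lshift 2 i) = w * lap d1 G1 psi - N.
Proof.
have -> : \sum_i \sum_j invmx G1 i j * cschouten d G psi (lshift 2 j) (lshift 2 i) =
  w * lap d1 G1 psi - 2^-1 * N * (\sum_i \sum_j invmx G1 i j * G1 j i).
  rewrite /lap !mulr_sumr -sumrB; apply: eq_bigr => i _; rewrite !mulr_sumr -sumrB; apply: eq_bigr => j _.
  by rewrite cschouten_ll (hesC d1 sG1 psi j); ring.
have -> : \sum_i \sum_j invmx G1 i j * G1 j i = 2.
  transitivity (\tr (invmx G1 *m G1)); last by rewrite mulVmx // mxtrace1.
  by apply: eq_bigr => i _; rewrite mxE.
by congr (_ - _); rewrite mulrAC mulVr // mul1r.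
Qed.

Lemma trace_cschouten2 :
  \sum_i \sum_j invmx G2 i j * cschouten d G psi (rshift 2 j) (rshift 2 i) = w * lap d2 G2 psi - N.
Proof.
have -> : \sum_i \sum_j invmx G2 i j * cschouten d G psi (rshift 2 j) (rshift 2 i) =
  w * lap d2 G2 psi - 2^-1 * N * (\sum_i \sum_j invmx G2 i j * G2 j i).
  rewrite /lap !mulr_sumr -sumrB; apply: eq_bigr => i _; rewrite !mulr_sumr -sumrB; apply: eq_bigr => j _.
  by rewrite cschouten_rr (hesC d2 sG2 psi j); ring.
have -> : \sum_i \sum_j invmx G2 i j * G2 j i = 2.
  transitivity (\tr (invmx G2 *m G2)); last by rewrite mulVmx // mxtrace1.
  by apply: eq_bigr => i _; rewrite mxE.
by congr (_ - _); rewrite mulrAC mulVr // mul1r.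
Qed.

End ProductCurvature.

(** * The local theorem *)

Lemma pderiv_indep (R : realType) n (f : 'rV[R]_n -> R) k z :
  (forall h : R, f (h *: delta_mx 0 k + z) = f z) -> pderiv f k z = 0.
Proof.
move=> fz; have E : (fun h : R => h^-1 *: ((f \o shift z) (h *: (delta_mx 0 k : 'rV[R]_n)) - f z)) =
  (fun h : R => h^-1 *: (((fun=> f z) \o shift z) (h *: delta_mx 0 k) - (fun=> f z) z)).
  by apply/funext => h /=; rewrite fz.
by rewrite /pderiv /derive E; exact: (derive_cst (f z) z).
Qed.

Lemma posdef_unit (R : realType) (G : 'M[R]_2) : (forall i j, G i j = G j i) ->
  (forall v : 'rV[R]_2, v != 0 -> 0 < (v *m G *m v^T) 0 0) -> G \in unitmx.
Proof.
move=> sG pG; have [P e] := frame_exists sG pG.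
have [uP iG] := invmx_frame e.
have uPT : P^T \in unitmx by rewrite unitmx_tr.
by move: (unitmx1 R 2); rewrite -e !unitmx_mul uP uPT andbT.
Qed.

Lemma lsub_lshift (R : realType) (z : 'rV[R]_(2 + 2)) k (h : R) :
  lsubmx (h *: delta_mx 0 (lshift 2 k) + z) = h *: delta_mx 0 k + lsubmx z :> 'rV[R]_2.
Proof. by apply/rowP => j; rewrite !mxE !eqxx (inj_eq (@lshift_inj _ _)). Qed.

Lemma rsub_lshift (R : realType) (z : 'rV[R]_(2 + 2)) k (h : R) :
  rsubmx (h *: delta_mx 0 (lshift 2 k) + z) = rsubmx z :> 'rV[R]_2.
Proof. by apply/rowP => j; rewrite !mxE eq_rlshift andbF mulr0n mulr0 add0r. Qed.

Lemma lsub_rshift (R : realType) (z : 'rV[R]_(2 + 2)) k (h : R) :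
  lsubmx (h *: delta_mx 0 (rshift 2 k) + z) = lsubmx z :> 'rV[R]_2.
Proof. by apply/rowP => j; rewrite !mxE eq_lrshift andbF mulr0n mulr0 add0r. Qed.

Lemma rsub_rshift (R : realType) (z : 'rV[R]_(2 + 2)) k (h : R) :
  rsubmx (h *: delta_mx 0 (rshift 2 k) + z) = h *: delta_mx 0 k + rsubmx z :> 'rV[R]_2.
Proof. by apply/rowP => j; rewrite !mxE !eqxx (inj_eq (@rshift_inj _ _)). Qed.

Lemma trace_sum (S : comUnitRingType) (w a b n : S) : w * a - n + (w * b - n) = w * (a + b) - 2 * n.
Proof. by ring. Qed.

Lemma trace_diff (S : comUnitRingType) (w p k a b n : S) : w * p = 1 ->
  k + (w * a - n - (w * b - n)) = w * (k * p + (a - b)).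
Proof. by move=> e; transitivity (k * (w * p) + w * (a - b)); [rewrite e; ring|ring]. Qed.

Lemma half_trace (S : comUnitRingType) (w h n g a : S) : (2 : S) \is a GRing.unit ->
  2 * (w * h - 2^-1 * n * g) - (w * a - n) * g = w * (2 * h - a * g).
Proof.
move=> u2; rewrite mulrBr -[2^-1 * n * g]mulrA mulVKr //; ring.
Qed.

(** * The weak Einstein condition on a coordinate domain *)

Section Local.
Context {R : realType} (D : odom R (2 + 2)).
Variables (gh gt : 'rV[R]_2 -> 'M[R]_2) (psi : 'rV[R]_(2 + 2) -> R).
Hypothesis smooth_gh : forall i j, smooth_on (dom D) (fun z => gh (lsubmx z) i j).
Hypothesis smooth_gt : forall i j, smooth_on (dom D) (fun z => gt (rsubmx z) i j).
Hypothesis smooth_psi : smooth_on (dom D) psi.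
Hypothesis psi0 : forall z, dom D z -> psi z != 0.
Hypothesis sym_gh : forall z, dom D z -> forall i j, gh (lsubmx z) i j = gh (lsubmx z) j i.
Hypothesis sym_gt : forall z, dom D z -> forall i j, gt (rsubmx z) i j = gt (rsubmx z) j i.
Hypothesis pos_gh : forall z, dom D z -> forall v : 'rV[R]_2, v != 0 -> 0 < (v *m gh (lsubmx z) *m v^T) 0 0.
Hypothesis pos_gt : forall z, dom D z -> forall v : 'rV[R]_2, v != 0 -> 0 < (v *m gt (rsubmx z) *m v^T) 0 0.

(** In a chart, [conformal_prod] is convertible to this, with psi composed with the inverse
    chart. *)
Definition conf_metric (z : 'rV[R]_(2 + 2)) : 'M[R]_(2 + 2) :=
  psi z ^- 2 *: block_mx (gh (lsubmx z)) 0 0 (gt (rsubmx z)).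

Definition lG1 : 'M[sfun D]_2 := \matrix_(i, j) mksf (smooth_gh i j).
Definition lG2 : 'M[sfun D]_2 := \matrix_(i, j) mksf (smooth_gt i j).
Definition lpsi : sfun D := mksf smooth_psi.
Definition ldd : dfam (sfun D) (2 + 2) := pdfam D id.
Local Notation d1 := (dsub ldd (@lshift 2 2)).
Local Notation d2 := (dsub ldd (@rshift 2 2)).
Local Notation G1 := lG1.
Local Notation G2 := lG2.
Local Notation Psi := lpsi.

Lemma rep_lG1 i j : rep lsubmx (fun x => gh x i j) (G1 i j).
Proof. by move=> z Dz; rewrite mxE /ev mksfE. Qed.
Lemma rep_lG2 i j : rep rsubmx (fun x => gt x i j) (G2 i j).
Proof. by move=> z Dz; rewrite mxE /ev mksfE. Qed.
Lemma rep_lpsi : rep id psi Psi.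
Proof. by move=> z Dz; rewrite /ev mksfE. Qed.

Lemma ev_lG1 z (Dz : dom D z) : map_mx (ev Dz) G1 = gh (lsubmx z).
Proof. exact: ev_metric rep_lG1 z Dz. Qed.
Lemma ev_lG2 z (Dz : dom D z) : map_mx (ev Dz) G2 = gt (rsubmx z).
Proof. exact: ev_metric rep_lG2 z Dz. Qed.

Lemma unit_lG1 : G1 \in unitmx.
Proof.
apply/sf_unitP => z Dz; rewrite -[_ z]/(ev Dz (\det G1)) -det_map_mx ev_lG1 -unitfE.
by apply: posdef_unit; [exact: sym_gh|exact: pos_gh].
Qed.
Lemma unit_lG2 : G2 \in unitmx.
Proof.
apply/sf_unitP => z Dz; rewrite -[_ z]/(ev Dz (\det G2)) -det_map_mx ev_lG2 -unitfE.
by apply: posdef_unit; [exact: sym_gt|exact: pos_gt].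
Qed.
Lemma unit_lpsi : Psi \is a GRing.unit.
Proof. by apply/sf_unitP => z Dz; rewrite mksfE //; exact: psi0. Qed.

Lemma sym_lG1 i j : G1 i j = G1 j i.
Proof.
by apply: sfun_evP => z Dz; rewrite -!(rep_lG1 _ _ Dz) sym_gh.
Qed.
Lemma sym_lG2 i j : G2 i j = G2 j i.
Proof.
by apply: sfun_evP => z Dz; rewrite -!(rep_lG2 _ _ Dz) sym_gt.
Qed.

Lemma transverse_lG1 a i j : ldd (rshift 2 a) (G1 i j) = 0.
Proof.
apply: sfun_evP => z Dz; rewrite rmorph0.
have -> : ev Dz (ldd (rshift 2 a) (G1 i j)) = pderiv (G1 i j) (rshift 2 a) z by exact: mksfE.
rewrite (@pderiv_eq_on _ _ _ (@dom_open _ _ D) _ _ (fun z => gh (lsubmx z) i j)) //.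
  by apply: pderiv_indep => h; rewrite lsub_rshift.
by move=> y Dy; rewrite mxE mksfE.
Qed.
Lemma transverse_lG2 i a b : ldd (lshift 2 i) (G2 a b) = 0.
Proof.
apply: sfun_evP => z Dz; rewrite rmorph0.
have -> : ev Dz (ldd (lshift 2 i) (G2 a b)) = pderiv (G2 a b) (lshift 2 i) z by exact: mksfE.
rewrite (@pderiv_eq_on _ _ _ (@dom_open _ _ D) _ _ (fun z => gt (rsubmx z) a b)) //.
  by apply: pderiv_indep => h; rewrite rsub_lshift.
by move=> y Dy; rewrite mxE mksfE.
Qed.

Let Gp : 'M[sfun D]_(2 + 2) := block_mx G1 0 0 G2.
Let Gb : 'M[sfun D]_(2 + 2) := Psi^-1 ^+ 2 *: Gp.

Lemma rep_conf_metric i j : rep id (fun z => conf_metric z i j) (Gb i j).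
Proof.
move=> z Dz; rewrite /Gb [in RHS]mxE rmorphM rmorphXn /= rmorphV; last exact: unit_lpsi.
rewrite /= -(rep_lpsi Dz) exprVn /conf_metric [in LHS]mxE; congr (_ * _).
have -> : ev Dz (Gp i j) = map_mx (ev Dz) Gp i j by rewrite [RHS]mxE.
by rewrite /Gp map_block_mx !map_mx0 ev_lG1 ev_lG2.
Qed.

Lemma unit_conf_metric : Gb \in unitmx.
Proof. by apply: conformal_unitmx unit_lpsi; exact: prod_unitmx unit_lG1 unit_lG2. Qed.

Definition lB z (Dz : dom D z) : 'M[R]_(2 + 2) :=
  \matrix_(i, j) ev Dz (cschouten ldd Gp Psi i j).

(** Read through the ring, the curvature in coordinates is the algebraic tensor to which the
    pointwise lemmas apply. *)
Lemma riemann_conf_metric z (Dz : dom D z) :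
  (fun a b c e => riemann conf_metric a b c e z) =
  curv_form (gh (lsubmx z)) (gt (rsubmx z)) (lB Dz) (gauss gh (lsubmx z)) (gauss gt (rsubmx z)) (psi z ^- 2).
Proof.
apply/funext => a; apply/funext => b; apply/funext => c; apply/funext => e.
have projE (y : 'rV[R]_(2 + 2)) k (h : R) : id (h *: delta_mx 0 (id k) + y) = h *: delta_mx 0 k + id y by [].
rewrite -[z in LHS]/(id z) (rep_riemann projE unit_conf_metric rep_conf_metric a b c e Dz).
rewrite (rie_conformal_product unit_lG1 sym_lG1 unit_lG2 sym_lG2 transverse_lG1 transverse_lG2 (unit2 D) unit_lpsi).
rewrite (rep_gauss (@lsub_lshift R) unit_lG1 rep_lG1 Dz) (rep_gauss (@rsub_rshift R) unit_lG2 rep_lG2 Dz).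
rewrite /curv_form -(ev_lG1 Dz) -(ev_lG2 Dz).
have evF (w k1 k2 l1 l2 l3 l4 m1 m2 m3 m4 g1 g2 g3 g4 c1 c2 c3 c4 : sfun D) :
   ev Dz (w * (k1 * (l1 * l2 - l3 * l4) + k2 * (m1 * m2 - m3 * m4)
      + (g1 * c1 + g2 * c2 - g3 * c3 - g4 * c4))) =
   ev Dz w * (ev Dz k1 * (ev Dz l1 * ev Dz l2 - ev Dz l3 * ev Dz l4)
     + ev Dz k2 * (ev Dz m1 * ev Dz m2 - ev Dz m3 * ev Dz m4)
     + (ev Dz g1 * ev Dz c1 + ev Dz g2 * ev Dz c2 - ev Dz g3 * ev Dz c3 - ev Dz g4 * ev Dz c4)).
  by rewrite !(rmorphM, rmorphB, rmorphD).
rewrite evF.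
have evb (X Y : 'M[sfun D]_2) x y : block_mx (map_mx (ev Dz) X) 0 0 (map_mx (ev Dz) Y) x y =
    ev Dz (block_mx X 0 0 Y x y).
  have -> : block_mx (map_mx (ev Dz) X) 0 0 (map_mx (ev Dz) Y) = map_mx (ev Dz) (block_mx X 0 0 Y).
    by rewrite map_block_mx !map_mx0.
  by rewrite [LHS]mxE.
have evL (x y : 'I_(2 + 2)) : block_mx (map_mx (ev Dz) G1) 0 0 (0 : 'M[R]_2) x y = ev Dz (block_mx G1 0 0 (0 : 'M[sfun D]_2) x y).
  by rewrite -evb map_mx0.
have evH (x y : 'I_(2 + 2)) : block_mx (0 : 'M[R]_2) 0 0 (map_mx (ev Dz) G2) x y = ev Dz (block_mx (0 : 'M[sfun D]_2) 0 0 G2 x y).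
  by rewrite -evb map_mx0.
have evB x y : lB Dz x y = ev Dz (cschouten ldd Gp Psi x y) by rewrite mxE.
have -> : ev Dz (Psi^-1 ^+ 2) = psi z ^- 2.
  rewrite rmorphXn /= rmorphV; last exact: unit_lpsi.
  by rewrite /= -(rep_lpsi Dz) exprVn.
by rewrite !evb !evL !evH !evB.
Qed.

Local Notation K1 := (gau d1 G1).
Local Notation K2 := (gau d2 G2).
Local Notation A := (lap d1 G1 Psi).
Local Notation B := (lap d2 G2 Psi).
Local Notation P := (gsq d1 G1 Psi).
Local Notation Q := (gsq d2 G2 Psi).
Local Notation w := (Psi^-1).
(** The trace T of the tensor B with respect to the product metric. *)
Definition ltrace : sfun D := w * (A + B) - 2 * (w ^+ 2 * (P + Q)).

Let ev_inv1 z (Dz : dom D z) i j : invmx (gh (lsubmx z)) i j = ev Dz (invmx G1 i j).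
Proof. exact: (rep_ginv unit_lG1 rep_lG1 i j Dz). Qed.
Let ev_inv2 z (Dz : dom D z) i j : invmx (gt (rsubmx z)) i j = ev Dz (invmx G2 i j).
Proof. exact: (rep_ginv unit_lG2 rep_lG2 i j Dz). Qed.

Lemma ev_trace1 z (Dz : dom D z) : \tr (invmx (gh (lsubmx z)) *m ulsubmx (lB Dz)) =
  ev Dz (w * A - w ^+ 2 * (P + Q)).
Proof.
rewrite -(trace_cschouten1 Psi unit_lG1 sym_lG1 unit_lG2 transverse_lG1 (unit2 D)).
rewrite rmorph_sum /mxtrace; apply: eq_bigr => i _; rewrite mxE rmorph_sum; apply: eq_bigr => j _.
by rewrite ev_inv1 !mxE rmorphM.
Qed.
Lemma ev_trace2 z (Dz : dom D z) : \tr (invmx (gt (rsubmx z)) *m drsubmx (lB Dz)) =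
  ev Dz (w * B - w ^+ 2 * (P + Q)).
Proof.
rewrite -(trace_cschouten2 Psi unit_lG1 unit_lG2 sym_lG2 transverse_lG2 (unit2 D)).
rewrite rmorph_sum /mxtrace; apply: eq_bigr => i _; rewrite mxE rmorph_sum; apply: eq_bigr => j _.
by rewrite ev_inv2 !mxE rmorphM.
Qed.

Let evwn z (Dz : dom D z) : ev Dz w != 0.
Proof.
apply/eqP => e; have := congr1 (ev Dz) (mulrV unit_lpsi).
by rewrite rmorphM rmorph1 /= e mulr0 => /esym/eqP; rewrite oner_eq0.
Qed.

Let ev_gau1 z (Dz : dom D z) : gauss gh (lsubmx z) = ev Dz K1.
Proof.
exact: (rep_gauss (@lsub_lshift R) unit_lG1 rep_lG1 Dz).
Qed.
Let ev_gau2 z (Dz : dom D z) : gauss gt (rsubmx z) = ev Dz K2.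
Proof.
exact: (rep_gauss (@rsub_rshift R) unit_lG2 rep_lG2 Dz).
Qed.

Let lB_ll z (Dz : dom D z) i j : 2 * ulsubmx (lB Dz) i j -
    ev Dz (w * A - w ^+ 2 * (P + Q)) * gh (lsubmx z) i j =
  ev Dz w * ev Dz (2 * hes d1 G1 Psi i j - A * G1 i j).
Proof.
have -> : ulsubmx (lB Dz) i j = ev Dz (w * hes d1 G1 Psi i j - 2^-1 * (w ^+ 2 * (P + Q)) * G1 i j).
  by rewrite -(cschouten_ll Psi unit_lG1 unit_lG2 transverse_lG1) !mxE.
rewrite (rep_lG1 i j Dz) -(rmorph_nat (ev Dz) 2) -!(rmorphM (ev Dz)) -(rmorphB (ev Dz)) /=; congr (ev Dz _).
exact: half_trace (unit2 D).
Qed.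
Let lB_rr z (Dz : dom D z) i j : 2 * drsubmx (lB Dz) i j -
    ev Dz (w * B - w ^+ 2 * (P + Q)) * gt (rsubmx z) i j =
  ev Dz w * ev Dz (2 * hes d2 G2 Psi i j - B * G2 i j).
Proof.
have -> : drsubmx (lB Dz) i j = ev Dz (w * hes d2 G2 Psi i j - 2^-1 * (w ^+ 2 * (P + Q)) * G2 i j).
  by rewrite -(cschouten_rr Psi unit_lG1 unit_lG2 transverse_lG2) !mxE.
rewrite (rep_lG2 i j Dz) -(rmorph_nat (ev Dz) 2) -!(rmorphM (ev Dz)) -(rmorphB (ev Dz)) /=; congr (ev Dz _).
exact: half_trace (unit2 D).
Qed.
Let lB_lr z (Dz : dom D z) i j : ursubmx (lB Dz) i j = ev Dz w * ev Dz (d1 i (d2 j Psi)).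
Proof.
by rewrite !mxE (cschouten_lr Psi unit_lG1 unit_lG2 transverse_lG1 transverse_lG2) rmorphM.
Qed.
Let lB_sym z (Dz : dom D z) i j : lB Dz i j = lB Dz j i.
Proof. by rewrite !mxE (cschouten_sym ldd Psi sym_lG1 sym_lG2). Qed.

Let lB_tr z (Dz : dom D z) : ev Dz (w * A - w ^+ 2 * (P + Q)) + ev Dz (w * B - w ^+ 2 * (P + Q)) = ev Dz ltrace.
Proof.
apply: etrans (esym (rmorphD (ev Dz) _ _)) _.
exact: (congr1 (ev Dz) (trace_sum w A B (w ^+ 2 * (P + Q)))).
Qed.
Let lB_dtr z (Dz : dom D z) : ev Dz K1 - ev Dz K2 +
   (ev Dz (w * A - w ^+ 2 * (P + Q)) - ev Dz (w * B - w ^+ 2 * (P + Q))) =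
   ev Dz w * ev Dz ((K1 - K2) * Psi + (A - B)).
Proof.
have e : w * Psi = 1 by rewrite mulVr // unit_lpsi.
have evs (k1 k2 x y : sfun D) : ev Dz (k1 - k2 + (x - y)) = ev Dz k1 - ev Dz k2 + (ev Dz x - ev Dz y).
  by rewrite rmorphD !rmorphB.
apply: etrans (esym (evs _ _ _ _)) _.
exact: etrans (congr1 (ev Dz) (@trace_diff _ w Psi (K1 - K2) A B (w ^+ 2 * (P + Q)) e)) (rmorphM (ev Dz) _ _).
Qed.

(** At each point this is [weak_trichotomy], after division by the value of 1/psi. Equality of all
    values is equality in the ring, where the identities can be differentiated. *)
Lemma weak_identities (f : 'rV[R]_(2 + 2) -> R) :
  (forall z, dom D z -> forall a b, riemann_square conf_metric a b z = f z * conf_metric z a b) ->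
  [/\ forall i a, (K1 + K2 + 2 * ltrace) * d1 i (d2 a Psi) = 0,
      forall i j, ltrace * (2 * hes d1 G1 Psi i j - A * G1 i j) = 0,
      forall i j, ltrace * (2 * hes d2 G2 Psi i j - B * G2 i j) = 0 &
      (K1 + K2 + ltrace) * ((K1 - K2) * Psi + (A - B)) = 0].
Proof.
move=> hw.
have key z (Dz : dom D z) : [/\ forall i a, ev Dz ((K1 + K2 + 2 * ltrace) * d1 i (d2 a Psi)) = 0,
      forall i j, ev Dz (ltrace * (2 * hes d1 G1 Psi i j - A * G1 i j)) = 0,
      forall i j, ev Dz (ltrace * (2 * hes d2 G2 Psi i j - B * G2 i j)) = 0 &
      ev Dz ((K1 + K2 + ltrace) * ((K1 - K2) * Psi + (A - B))) = 0].
  have s0 : psi z ^- 2 != 0 by rewrite invr_neq0 // expf_neq0 // psi0.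
  have wk a b : rsqT (psi z ^- 2 *: block_mx (gh (lsubmx z)) 0 0 (gt (rsubmx z)))
     (curv_form (gh (lsubmx z)) (gt (rsubmx z)) (lB Dz) (gauss gh (lsubmx z)) (gauss gt (rsubmx z)) (psi z ^- 2)) a b
     = f z * (psi z ^- 2 *: block_mx (gh (lsubmx z)) 0 0 (gt (rsubmx z))) a b.
    by rewrite -riemann_conf_metric; exact: hw.
  have [] := weak_trichotomy (sym_gh Dz) (sym_gt Dz) (pos_gh Dz) (pos_gt Dz) (lB_sym Dz) s0 wk.
  rewrite (ev_trace1 Dz) (ev_trace2 Dz) (ev_gau1 Dz) (ev_gau2 Dz) lB_tr lB_dtr => /matrixP t1 /matrixP t2 /matrixP t3 t4.
  have entE (U g : 'M[R]_2) (c : R) i j : (2 *: U - c *: g) i j = 2 * U i j - c * g i j by rewrite !mxE.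
  have can x : ev Dz w * x = 0 -> x = 0.
    by move/eqP; rewrite mulf_eq0 (negPf (evwn Dz)) => /eqP.
  split.
  - move=> i a; apply: can; rewrite (rmorphM (ev Dz)) /= mulrCA -lB_lr.
    have := t1 i a; rewrite [LHS]mxE [RHS]mxE => t.
    have -> : ev Dz (K1 + K2 + 2 * ltrace) = ev Dz K1 + ev Dz K2 + 2 * ev Dz ltrace.
      by rewrite rmorphD rmorphD (rmorphM (ev Dz) 2) rmorph_nat.
    exact: t.
  - move=> i j; apply: can; rewrite (rmorphM (ev Dz)) /= mulrCA -lB_ll.
    by have := t2 i j; rewrite [LHS]mxE [RHS]mxE entE.
  - move=> i j; apply: can; rewrite (rmorphM (ev Dz)) /= mulrCA -lB_rr.
    by have := t3 i j; rewrite [LHS]mxE [RHS]mxE entE.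
  - apply: can; rewrite (rmorphM (ev Dz)) /= mulrCA.
    have -> : ev Dz (K1 + K2 + ltrace) = ev Dz K1 + ev Dz K2 + ev Dz ltrace by rewrite rmorphD rmorphD.
    exact: t4.
split.
- by move=> i a; apply: sfun_evP => z Dz; rewrite rmorph0; have [+ _ _ _] := key z Dz; apply.
- by move=> i j; apply: sfun_evP => z Dz; rewrite rmorph0; have [_ + _ _] := key z Dz; apply.
- by move=> i j; apply: sfun_evP => z Dz; rewrite rmorph0; have [_ _ + _] := key z Dz; apply.
- by apply: sfun_evP => z Dz; rewrite rmorph0; have [_ _ _ +] := key z Dz; apply.
Qed.

Lemma einstein_nondegenerate z (Dz : dom D z) a b : einstein conf_metric a b z != 0 ->
  ~ [/\ forall i a, ev Dz (d1 i (d2 a Psi)) = 0,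
      forall i j, ev Dz (2 * hes d1 G1 Psi i j - A * G1 i j) = 0,
      forall i j, ev Dz (2 * hes d2 G2 Psi i j - B * G2 i j) = 0 &
      ev Dz ((K1 - K2) * Psi + (A - B)) = 0].
Proof.
move=> /eqP e0 [z1 z2 z3 z4]; apply: e0.
have s0 : psi z ^- 2 != 0 by rewrite invr_neq0 // expf_neq0 // psi0.
have -> : einstein conf_metric a b z =
  einT (conf_metric z) (fun a b c e => riemann conf_metric a b c e z) a b by [].
rewrite (riemann_conf_metric Dz).
apply: einstein_curv_form0 => //.
- exact: sym_gh.
- exact: sym_gt.
- by apply: posdef_unit; [exact: sym_gh|exact: pos_gh].
- by apply: posdef_unit; [exact: sym_gt|exact: pos_gt].
- by apply/matrixP => i j; rewrite lB_lr z1 mulr0 mxE.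
- rewrite (ev_trace1 Dz); apply/matrixP => i j; apply/eqP; rewrite -subr_eq0.
  by rewrite mxE [in X in _ - X]mxE lB_ll z2 mulr0.
- rewrite (ev_trace2 Dz); apply/matrixP => i j; apply/eqP; rewrite -subr_eq0.
  by rewrite mxE [in X in _ - X]mxE lB_rr z3 mulr0.
- by rewrite (ev_trace1 Dz) (ev_trace2 Dz) (ev_gau1 Dz) (ev_gau2 Dz) lB_dtr z4 mulr0.
Qed.

Lemma weyl_nondegenerate z (Dz : dom D z) a b c e : weyl conf_metric a b c e z != 0 ->
  gauss gh (lsubmx z) + gauss gt (rsubmx z) != 0.
Proof.
apply: contraNneq => k0.
have s0 : psi z ^- 2 != 0 by rewrite invr_neq0 // expf_neq0 // psi0.
have -> : weyl conf_metric a b c e z =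
  weyT (conf_metric z) (fun a b c e => riemann conf_metric a b c e z) a b c e by [].
rewrite (riemann_conf_metric Dz) weyl_curv_form0 //.
- exact: sym_gh.
- exact: sym_gt.
- by apply: posdef_unit; [exact: sym_gh|exact: pos_gh].
- by apply: posdef_unit; [exact: sym_gt|exact: pos_gt].
Qed.

End Local.

(** The square of a symmetric traceless 2 x 2 matrix is a^2 + b^2 times the identity, so a nonzero
    kernel vector forces a = b = 0. *)
Lemma symmetric_traceless_kernel (R : realType) (a b b' c x y : R) : a + c = 0 -> b = b' ->
  a * x + b * y = 0 -> b' * x + c * y = 0 -> x != 0 \/ y != 0 -> a = 0 /\ b = 0.
Proof.
move=> ac <- e1 e2 xy; have cE : c = - a by lra.
have hx : (a ^+ 2 + b ^+ 2) * x = 0.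
  transitivity (a * (a * x + b * y) + b * (b * x + c * y)); first by rewrite cE; ring.
  by rewrite e1 e2; ring.
have hy : (a ^+ 2 + b ^+ 2) * y = 0.
  transitivity (b * (a * x + b * y) - a * (b * x + c * y)); first by rewrite cE; ring.
  by rewrite e1 e2; ring.
have : a ^+ 2 + b ^+ 2 = 0.
  by case: xy => n0; apply: (mulIf n0); rewrite mul0r.
move=> /eqP; rewrite paddr_eq0 ?sqr_ge0 // !sqrf_eq0 => /andP[/eqP -> /eqP ->].
by [].
Qed.

(** * Consequences of positive definiteness *)

Section PointwiseFacts.
Context {R : realType}.
Variable G : 'M[R]_2.
Hypothesis sG : forall i j, G i j = G j i.
Hypothesis pG : forall v : 'rV[R]_2, v != 0 -> 0 < (v *m G *m v^T) 0 0.

Lemma ip_frame (P : 'M[R]_2) X Y : P *m G *m P^T = 1%:M ->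
  ip G X Y = \sum_m (\sum_k P m k * X k) * (\sum_k P m k * Y k).
Proof.
move=> e; have [uP iG] := invmx_frame e; rewrite -contract_frame /ip iG.
by apply: eq_bigr => i _; apply: eq_bigr => j _; rewrite mulrA.
Qed.

Lemma frame_vec0 (P : 'M[R]_2) (v : 'I_2 -> R) : P \in unitmx ->
  (forall m, \sum_k P m k * v k = 0) -> forall k, v k = 0.
Proof.
move=> uP h k; have e : P *m (\col_j v j) = 0.
  by apply/matrixP => i j; rewrite !mxE -[RHS](h i); apply: eq_bigr => l _; rewrite mxE.
have /matrixP/(_ k 0) : \col_j v j = 0 :> 'cV[R]_2 by rewrite -(mulKmx uP (\col_j v j)) e mulmx0.
by rewrite !mxE.
Qed.

Lemma ip_posdef (v : 'I_2 -> R) : ip G v v <= 0 -> forall k, v k = 0.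
Proof.
have [P e] := frame_exists sG pG; have [uP _] := invmx_frame e.
rewrite (ip_frame _ _ e) big_ord2 => h; apply: (frame_vec0 uP) => m.
have h0 := sqr_ge0 (\sum_k P 0 k * v k); have h1 := sqr_ge0 (\sum_k P 1 k * v k).
rewrite !expr2 in h0 h1.
by case: (ord2P m) => ->; apply/eqP; rewrite -sqrf_eq0 expr2; apply/eqP; lra.
Qed.

Lemma ip_ge0 (v : 'I_2 -> R) : 0 <= ip G v v.
Proof.
have [P e] := frame_exists sG pG.
by rewrite (ip_frame _ _ e) big_ord2 addr_ge0 // -expr2 sqr_ge0.
Qed.

(** In an orthonormal frame the trace becomes the sum of the diagonal entries, and
    [symmetric_traceless_kernel] applies to the components of T and v. *)
Lemma traceless_kernel (T : 'I_2 -> 'I_2 -> R) (v : 'I_2 -> R) j :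
  (forall i k, T i k = T k i) -> \sum_i \sum_k invmx G i k * T i k = 0 ->
  (forall i, ip G (T i) v = 0) -> v j != 0 -> forall i k, T i k = 0.
Proof.
move=> sT trT kerT vj.
have [P e] := frame_exists sG pG; have [uP iG] := invmx_frame e.
pose U (m n : 'I_2) := \sum_k P m k * \sum_l P n l * T k l.
pose u (m : 'I_2) := \sum_k P m k * v k.
have trU : U 0 0 + U 1 1 = 0.
  rewrite -(big_ord2 (fun m => U m m)) -[RHS]trT /U; under [RHS]eq_bigr do under eq_bigr do rewrite iG mxE mulr_suml.
  under [RHS]eq_bigr do rewrite exchange_big; rewrite [RHS]exchange_big; apply: eq_bigr => m _ /=.
  apply: eq_bigr => k _; rewrite mulr_sumr; apply: eq_bigr => l _; rewrite mxE; ring.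
have sU : U 0 1 = U 1 0.
  rewrite /U; under eq_bigr do rewrite mulr_sumr; rewrite exchange_big; apply: eq_bigr => k _ /=.
  by rewrite mulr_sumr; apply: eq_bigr => l _; rewrite sT; ring.
have kU m : U m 0 * u 0 + U m 1 * u 1 = 0.
  rewrite -(big_ord2 (fun n => U m n * u n)).
  transitivity (\sum_k P m k * ip G (T k) v); last by rewrite big1 // => k _; rewrite kerT mulr0.
  under [RHS]eq_bigr do rewrite (ip_frame _ _ e) mulr_sumr.
  rewrite exchange_big; apply: eq_bigr => n _ /=; rewrite /U mulr_suml; apply: eq_bigr => k _.
  by rewrite mulrA.
have un0 : u 0 != 0 \/ u 1 != 0.
  have [u0|] := eqVneq (u 0) 0; last by left.
  have [u1|] := eqVneq (u 1) 0; last by right.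
  move: vj; rewrite (frame_vec0 uP (v := v)) ?eqxx // => m.
  by case: (ord2P m) => ->.
have U0 : U 0 0 = 0 /\ U 0 1 = 0.
  have k0 := kU 0; have k1 := kU 1; move: trU sU k0 k1 un0.
  move: (U 0 0) (U 0 1) (U 1 0) (U 1 1) (u 0) (u 1) => a b b' c x y; exact: symmetric_traceless_kernel.
have {}U0 m n : U m n = 0.
  have [h0 h1] := U0; have h2 : U 1 1 = 0 by rewrite -trU h0 add0r.
  by case: (ord2P m) => ->; case: (ord2P n) => ->; rewrite // -sU.
move=> i k; have hk n : \sum_l P n l * T i l = 0.
  by apply: (frame_vec0 uP (v := fun i => \sum_l P n l * T i l)) => m; exact: U0.
exact: (frame_vec0 uP hk).
Qed.
End PointwiseFacts.

Lemma rmorph_invmx (S R : comUnitRingType) (phi : {rmorphism S -> R}) n (G : 'M[S]_n) :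
  G \in unitmx -> invmx (map_mx phi G) = map_mx phi (invmx G).
Proof.
move=> uG; have uG' : map_mx phi G \in unitmx by rewrite unitmxE det_map_mx rmorph_unit.
by rewrite -[LHS](mulmx1) -(map_mx1 phi) -(mulmxV uG) map_mxM mulmxA mulVmx // mul1mx.
Qed.

Lemma rmorph_ip (S R : comUnitRingType) (phi : {rmorphism S -> R}) n (G : 'M[S]_n) X Y :
  G \in unitmx -> phi (ip G X Y) = ip (map_mx phi G) (phi \o X) (phi \o Y).
Proof.
move=> uG; rewrite /ip rmorph_invmx // rmorph_sum; apply: eq_bigr => m _.
by rewrite rmorph_sum; apply: eq_bigr => l _; rewrite !rmorphM mxE.
Qed.

(** The letters are the values at one point of the quantities of the case S + 2T = 0, with D for K1
    - K2 and l for lam. Since f and g are nonzero they can be cancelled, and what remains is a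
    perfect square. *)
Lemma typeB_pointwise (R : realFieldType) (p S D l A B P Q f g M W W' k1 k2 : R) :
  l = A + B + p * S -> S * (f * g) = l * M -> l * W = S * f * Q -> l * W' = S * g * P ->
  3 * p ^+ 2 * k1 - 2 * p * S * f = 8 * W -> 3 * p ^+ 2 * k2 - 2 * p * S * g = 8 * W' ->
  p ^+ 2 * S + 2 * p * (A + B) = 4 * (P + Q) ->
  8 * (2 * W - A * f) - 6 * p * f * D - 3 * p ^+ 2 * k1 = 0 ->
  8 * (B * g - 2 * W') - 6 * p * g * D + 3 * p ^+ 2 * k2 = 0 ->
  S != 0 -> f != 0 -> g != 0 -> P + Q = 0.
Proof.
move=> lE hM hW hW' h1 h2 hPQ z1 z2 S0 f0 g0.
have l0 : l != 0.
  by apply/eqP => l0; move: hM; rewrite l0 mul0r => /eqP; rewrite !mulf_eq0 (negPf S0) (negPf f0) (negPf g0).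
(* [al] and [be] are the two vanishing derivatives of Z, multiplied by l and divided by f and g. *)
have al : 8 * S * Q - 8 * A * l - 6 * p * D * l - 2 * p * S * l = 0.
  apply: (mulIf f0); rewrite mul0r -[RHS](mulr0 l) -[in RHS]z1.
  transitivity (8 * (S * f * Q) - 8 * A * f * l - 6 * p * f * D * l - 2 * p * S * f * l); first by ring.
  rewrite -hW; transitivity (l * (8 * (2 * W - A * f) - 6 * p * f * D - (8 * W + 2 * p * S * f))); first by ring.
  by rewrite -h1; ring.
have be : 8 * B * l - 8 * S * P - 6 * p * D * l + 2 * p * S * l = 0.
  apply: (mulIf g0); rewrite mul0r -[RHS](mulr0 l) -[in RHS]z2.
  transitivity (8 * B * g * l - 8 * (S * g * P) - 6 * p * g * D * l + 2 * p * S * g * l); first by ring.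
  rewrite -hW'; transitivity (l * (8 * (B * g - 2 * W') - 6 * p * g * D + (8 * W' + 2 * p * S * g))); first by ring.
  by rewrite -h2; ring.
have AB : A + B = l - p * S by rewrite lE addrK.
(* Subtracting [be] from [al] eliminates D; the relation for P + Q turns the outcome into -2 (2 l -
   p S)^2 = 0. *)
have sq : (2 * l - p * S) ^+ 2 = 0.
  have e1 : 8 * S * (P + Q) - 8 * (A + B) * l - 4 * p * S * l = 0.
    by rewrite -[RHS](subrr 0) -{1}al -be; ring.
  have e2 : 2 * S * (4 * (P + Q)) - 8 * l ^+ 2 + 4 * p * S * l = 0.
    by rewrite -[RHS]e1 AB; ring.
  move: e2; rewrite -hPQ AB => e2; apply/eqP; rewrite -(mulrI_eq0 _ (mulfI (_ : -2 != 0 :> R))) ?oppr_eq0 ?pnatr_eq0 //.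
  by apply/eqP; rewrite -[RHS]e2; ring.
have {}sq : 2 * l = p * S by apply/eqP; rewrite -subr_eq0 -sqrf_eq0 sq.
have : 4 * (P + Q) = 0.
  rewrite -hPQ AB; transitivity (p * (2 * l) - p ^+ 2 * S); first by ring.
  by rewrite sq; ring.
by move=> /eqP; rewrite mulf_eq0 pnatr_eq0 => /eqP.
Qed.

(** Most relations hold in the ring, whereas the derivatives of Z are known to vanish only at the
    point of evaluation. *)
Lemma typeB_morphism (R : realFieldType) (S : comUnitRingType) (phi : {rmorphism S -> R})
    (p s D l A B P Q f g M W W' k1 k2 : S) :
  l = A + B + p * s -> s * (f * g) = l * M -> l * W = s * f * Q -> l * W' = s * g * P ->
  3 * p ^+ 2 * k1 - 2 * p * s * f = 8 * W -> 3 * p ^+ 2 * k2 - 2 * p * s * g = 8 * W' ->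
  p ^+ 2 * s + 2 * p * (A + B) = 4 * (P + Q) ->
  phi (8 * (2 * W - A * f) - 6 * p * f * D - 3 * p ^+ 2 * k1) = 0 ->
  phi (8 * (B * g - 2 * W') - 6 * p * g * D + 3 * p ^+ 2 * k2) = 0 ->
  phi s != 0 -> phi f != 0 -> phi g != 0 -> phi P + phi Q = 0.
Proof.
move=> /(congr1 phi) e1 /(congr1 phi) e2 /(congr1 phi) e3 /(congr1 phi) e4 /(congr1 phi) e5.
move=> /(congr1 phi) e6 /(congr1 phi) e7 z1 z2 s0 f0 g0.
apply: (@typeB_pointwise _ (phi p) (phi s) (phi D) (phi l) (phi A) (phi B) (phi P) (phi Q) (phi f) (phi g)
   (phi M) (phi W) (phi W') (phi k1) (phi k2)) => //.
- by move: e1; rewrite !(rmorphM, rmorph_nat, rmorphXn, rmorphB, rmorphD).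
- by move: e2; rewrite !(rmorphM, rmorph_nat, rmorphXn, rmorphB, rmorphD).
- by move: e3; rewrite !(rmorphM, rmorph_nat, rmorphXn, rmorphB, rmorphD).
- by move: e4; rewrite !(rmorphM, rmorph_nat, rmorphXn, rmorphB, rmorphD).
- by move: e5; rewrite !(rmorphM, rmorph_nat, rmorphXn, rmorphB, rmorphD).
- by move: e6; rewrite !(rmorphM, rmorph_nat, rmorphXn, rmorphB, rmorphD).
- by move: e7; rewrite !(rmorphM, rmorph_nat, rmorphXn, rmorphB, rmorphD).
- by move: z1; rewrite !(rmorphM, rmorph_nat, rmorphXn, rmorphB, rmorphD).
- by move: z2; rewrite !(rmorphM, rmorph_nat, rmorphXn, rmorphB, rmorphD).
Qed.

Lemma lap_inv (S : comUnitRingType) n (d : dfam S n) (G : 'M[S]_n) (f : S) : f \is a GRing.unit ->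
  lap d G f^-1 = 2 * (f^-1 ^+ 3 * gsq d G f) - f^-1 ^+ 2 * lap d G f.
Proof.
move=> uf; have dw k : d k f^-1 = - (f^-1 ^+ 2 * d k f) by rewrite dvV // expr2.
have hw i j : hes d G f^-1 i j = 2 * (f^-1 ^+ 3 * (d i f * d j f)) - f^-1 ^+ 2 * hes d G f i j.
  rewrite /hes dw dvN dvM expr2 dvM dw mulrBr [X in _ - X = _](_ : _ = - (f^-1 ^+ 2 * \sum_k chr d G k i j * d k f)).
    by move: (\sum_k _) (f^-1) (d i (d j f)) => u v t; ring.
  rewrite mulr_sumr -sumrN; apply: eq_bigr => k _; rewrite dw.
  by move: (chr _ _ _ _ _) (f^-1) (d k f) => u v t; ring.
rewrite /lap /gsq /ip !mulr_sumr -sumrB; apply: eq_bigr => i _.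
rewrite !mulr_sumr -sumrB; apply: eq_bigr => j _; rewrite hw.
by move: (hes _ _ _ _ _) (invmx _ _ _) (f^-1) (d i f) (d j f) => u v t y z; ring.
Qed.

Lemma trace_metric (S : comUnitRingType) (G : 'M[S]_2) : G \in unitmx ->
  (forall i j, G i j = G j i) -> \sum_i \sum_j invmx G i j * G i j = 2.
Proof.
move=> uG sG; have e i : \sum_j invmx G i j * G i j = 1.
  have := congr1 (fun N : 'M[S]_2 => N i i) (mulVmx uG); rewrite !mxE eqxx => e.
  by rewrite -[RHS]e; apply: eq_bigr => j _; rewrite sG.
by rewrite (eq_bigr (fun=> 1)) // sumr_const card_ord.
Qed.

Lemma trace_umbilicity (S : comUnitRingType) (G : 'M[S]_2) (H : 'I_2 -> 'I_2 -> S) a :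
  \sum_k \sum_l invmx G k l * (2 * H k l - a * G k l) =
  2 * (\sum_k \sum_l invmx G k l * H k l) - a * (\sum_k \sum_l invmx G k l * G k l).
Proof.
rewrite !mulr_sumr -sumrB; apply: eq_bigr => k _; rewrite !mulr_sumr -sumrB.
by apply: eq_bigr => l _; ring.
Qed.

Lemma ip_umbilicity (S : comUnitRingType) (G : 'M[S]_2) (H X : 'I_2 -> S) a k :
  G \in unitmx -> (forall i j, G i j = G j i) ->
  ip G (fun l => 2 * H l - a * G k l) X = 2 * ip G H X - a * X k.
Proof.
move=> uG sG; rewrite -(ip_metric uG sG k X) /ip !mulr_sumr -sumrB; apply: eq_bigr => i _.
by rewrite !mulr_sumr -sumrB; apply: eq_bigr => l _; rewrite (sG k); ring.
Qed.

(** * The case of vanishing mixed Hessian *)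

Section OneSide.
Context {R : realType} {S : comUnitRingType} {d1 d2 : dfam S 2} {G1 G2 : 'M[S]_2} {psi : S}.
Hypothesis d12 : forall i a f, d1 i (d2 a f) = d2 a (d1 i f).
Hypotheses (uG1 : G1 \in unitmx) (sG1 : forall i j, G1 i j = G1 j i).
Hypotheses (uG2 : G2 \in unitmx) (sG2 : forall i j, G2 i j = G2 j i).
Hypotheses (d2G1 : forall a i j, d2 a (G1 i j) = 0) (d1G2 : forall i a b, d1 i (G2 a b) = 0).
Hypothesis u2 : (2 : S) \is a GRing.unit.
Hypothesis upsi : psi \is a GRing.unit.

Local Notation K1 := (gau d1 G1).
Local Notation K2 := (gau d2 G2).
Local Notation A := (lap d1 G1 psi).
Local Notation B := (lap d2 G2 psi).
Local Notation P := (gsq d1 G1 psi).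
Local Notation Q := (gsq d2 G2 psi).
Local Notation T1 i j := (2 * hes d1 G1 psi i j - A * G1 i j).

Hypothesis M0 : forall i a, d1 i (d2 a psi) = 0.

(** By [typeC_no_mixed] the traceless Hessian annihilates the gradient, which is nonzero at the
    point; [traceless_kernel] concludes. *)
Lemma typeC_traceless (phi : {rmorphism S -> R}) i a :
  (forall v : 'rV[R]_2, v != 0 -> 0 < (v *m map_mx phi G1 *m v^T) 0 0) ->
  (K1 - K2) * psi + (A - B) = 0 -> psi * (A + B) = 2 * (P + Q) ->
  phi (d1 i psi) != 0 -> phi (d2 a psi) != 0 -> forall k l, phi (T1 k l) = 0.
Proof.
move=> pos q0 E f0 g0.
have sG k l : map_mx phi G1 k l = map_mx phi G1 l k by rewrite !mxE sG1.
apply: (@traceless_kernel _ _ sG pos (fun k l => phi (T1 k l)) (phi \o (d1^~ psi)) i) => //.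
- by move=> k l; rewrite (hesC d1 sG1) sG1.
- have tr : \sum_k \sum_l invmx G1 k l * T1 k l = 0.
    by rewrite trace_umbilicity trace_metric // mulrC subrr.
  rewrite -[RHS](rmorph0 phi) -tr rmorph_sum; apply: eq_bigr => k _; rewrite rmorph_sum.
  by apply: eq_bigr => l _; rewrite rmorphM rmorph_invmx // mxE.
move=> k; rewrite -(rmorph_ip phi (fun l => T1 k l)) //.
have -> : ip G1 (fun l => T1 k l) (d1^~ psi) = 2 * ip G1 (hes d1 G1 psi k) (d1^~ psi) - A * d1 k psi.
  exact: ip_umbilicity.
have := congr1 phi (typeC_no_mixed d12 uG1 sG1 uG2 sG2 d2G1 d1G2 u2 upsi M0 q0 E k a).
by rewrite rmorphM rmorph0 => /eqP; rewrite mulf_eq0 (negPf g0) => /eqP.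
Qed.

(* The disjunction is (i) or (ii) for psi, with first factor Sigma and second factor Pi. *)
Definition side_conclusion := (forall a, d2 a K2 = 0) /\
  ((lap d1 G1 psi^-1 = 0 /\ 2 * P = (K2 - K1) * psi ^+ 2) \/
   ((forall i j, 2 * hes d1 G1 psi i j = A * G1 i j) /\
    (K1 + K2) * psi ^+ 2 + psi * A = 2 * P)).

(** With psi constant along the second factor, [typeA_side] for that factor reduces to psi^2 dK2 =
    0, and the equation itself becomes that of (ii). *)
Lemma side_typeA : (forall a, d2 a psi = 0) ->
  (forall i j, 2 * hes d1 G1 psi i j = A * G1 i j) ->
  (forall i j, 2 * hes d2 G2 psi i j = B * G2 i j) ->
  psi ^+ 2 * (K1 + K2) + psi * (A + B) - 2 * (P + Q) = 0 -> side_conclusion.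
Proof.
move=> f2 z1 z2 E; have d21 a i f : d2 a (d1 i f) = d1 i (d2 a f) by rewrite d12.
have M0' a i : d2 a (d1 i psi) = 0 by rewrite d21.
have Q0 : Q = 0 by rewrite /gsq /ip big1 // => m _; rewrite big1 // => l _; rewrite !f2 !mulr0.
have B0 : B = 0 by apply: lap_const.
split; last first.
  right; split => //; move: E; rewrite Q0 B0 !addr0 => /eqP; rewrite subr_eq0 => /eqP <-.
  by rewrite mulrC.
move=> a.
have E' : psi ^+ 2 * (K2 + K1) + psi * (B + A) - 2 * (Q + P) = 0.
  by rewrite [K2 + _]addrC [B + _]addrC [Q + _]addrC.
have := typeA_side d21 uG2 sG2 uG1 sG1 d2G1 u2 M0' z2 E' a; rewrite f2 mulr0 add0r => h.
by apply: (mulrI (unitrX 2 upsi)); rewrite mulr0.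
Qed.

(** With psi constant along the second factor, q = 0 gives psi dK2 = 0. The equation psi A = 2 P
    says that 1/psi is harmonic and, combined with q = 0, becomes the second equation of (i). *)
Lemma side_typeC : (forall a, d2 a psi = 0) ->
  (K1 - K2) * psi + (A - B) = 0 -> psi * (A + B) = 2 * (P + Q) -> side_conclusion.
Proof.
move=> f2 q0 E; have d21 a i f : d2 a (d1 i f) = d1 i (d2 a f) by rewrite d12.
have M0' a i : d2 a (d1 i psi) = 0 by rewrite d21.
have Q0 : Q = 0 by rewrite /gsq /ip big1 // => m _; rewrite big1 // => l _; rewrite !f2 !mulr0.
have B0 : B = 0 by apply: lap_const.
have E' : psi * (B + A) = 2 * (Q + P) by rewrite [B + _]addrC [Q + _]addrC.
have q0' : (K2 - K1) * psi + (B - A) = 0.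
  by rewrite -[RHS]oppr0 -q0; move: K1 K2 A B psi => *; ring.
split => [a|].
  have [h _] := typeC_side d21 uG2 sG2 uG1 sG1 d2G1 u2 M0' q0' E' a.
  move: h; rewrite f2 mulr0 addr0 B0 dv0 addr0 => h.
  by apply: (mulIr upsi); rewrite mul0r.
move: E q0; rewrite Q0 B0 !addr0 subr0 => E q0; left; split.
  rewrite lap_inv // mulrCA -E.
  transitivity (psi^-1 ^+ 2 * A * (psi^-1 * psi - 1)); first by move: A (psi^-1) => u v; ring.
  by rewrite mulVr // subrr mulr0.
rewrite -E; apply/eqP; rewrite -subr_eq0; apply/eqP.
rewrite -[RHS](mulr0 psi) -q0; move: K1 K2 A => u v t; ring.
Qed.
End OneSide.
Arguments side_conclusion {S} d1 d2 G1 G2 psi.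

(** * The classification, with points given by evaluation morphisms *)

Section AbstractLocal.
Context {R : realType} {S : comUnitRingType} (d1 d2 : dfam S 2) (G1 G2 : 'M[S]_2) (psi : S).
Hypothesis d12 : forall i a f, d1 i (d2 a f) = d2 a (d1 i f).
Hypotheses (uG1 : G1 \in unitmx) (sG1 : forall i j, G1 i j = G1 j i).
Hypotheses (uG2 : G2 \in unitmx) (sG2 : forall i j, G2 i j = G2 j i).
Hypotheses (d2G1 : forall a i j, d2 a (G1 i j) = 0) (d1G2 : forall i a b, d1 i (G2 a b) = 0).
Hypothesis u2 : (2 : S) \is a GRing.unit.
Hypothesis upsi : psi \is a GRing.unit.
Context {X : Type} (x0 : X) (phi : X -> {rmorphism S -> R}) (mix : X -> X -> X).
Hypothesis sep : forall f g, (forall x, phi x f = phi x g) -> f = g.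
Hypothesis conn : forall f, (forall i, d1 i f = 0) -> (forall a, d2 a f = 0) ->
  forall x y, phi x f = phi y f.
Hypothesis mix1 : forall f, (forall a, d2 a f = 0) -> forall x y, phi (mix x y) f = phi x f.
Hypothesis mix2 : forall f, (forall i, d1 i f = 0) -> forall x y, phi (mix x y) f = phi y f.
Hypothesis pos1 : forall x (v : 'rV[R]_2), v != 0 -> 0 < (v *m map_mx (phi x) G1 *m v^T) 0 0.
Hypothesis pos2 : forall x (v : 'rV[R]_2), v != 0 -> 0 < (v *m map_mx (phi x) G2 *m v^T) 0 0.

Local Notation K1 := (gau d1 G1).
Local Notation K2 := (gau d2 G2).
Local Notation A := (lap d1 G1 psi).
Local Notation B := (lap d2 G2 psi).
Local Notation P := (gsq d1 G1 psi).
Local Notation Q := (gsq d2 G2 psi).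
Local Notation w := (psi^-1).
Local Notation T := (w * (A + B) - 2 * (w ^+ 2 * (P + Q))).
Local Notation M i a := (d1 i (d2 a psi)).
Local Notation T1 i j := (2 * hes d1 G1 psi i j - A * G1 i j).
Local Notation T2 i j := (2 * hes d2 G2 psi i j - B * G2 i j).
Local Notation q := ((K1 - K2) * psi + (A - B)).

Hypothesis uS : K1 + K2 \is a GRing.unit.
Hypothesis w1 : forall i a, (K1 + K2 + 2 * T) * M i a = 0.
Hypothesis w2 : forall i j, T * T1 i j = 0.
Hypothesis w3 : forall i j, T * T2 i j = 0.
Hypothesis w4 : (K1 + K2 + T) * q = 0.
Hypothesis nondeg : forall x, ~ [/\ forall i a, phi x (M i a) = 0, forall i j, phi x (T1 i j) = 0,
   forall i j, phi x (T2 i j) = 0 & phi x q = 0].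

Let S0 x : phi x (K1 + K2) != 0.
Proof. by rewrite -unitfE rmorph_unit. Qed.

Let psi0 x : phi x psi != 0.
Proof. by rewrite -unitfE rmorph_unit. Qed.

Let sym1 x i j : map_mx (phi x) G1 i j = map_mx (phi x) G1 j i.
Proof. by rewrite !mxE sG1. Qed.

Let sym2 x i j : map_mx (phi x) G2 i j = map_mx (phi x) G2 j i.
Proof. by rewrite !mxE sG2. Qed.

Let gsq_ge01 x : 0 <= phi x P.
Proof. by rewrite rmorph_ip //; apply: ip_ge0 (pos1 x) _. Qed.

Let gsq_ge02 x : 0 <= phi x Q.
Proof. by rewrite rmorph_ip //; apply: ip_ge0 (pos2 x) _. Qed.

(* tau = t / U is a root of (1 + tau)(1 + 2 tau) tau, whose roots are simple, so d tau = 0. *)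
Lemma constant_ratio (U t : S) : U \is a GRing.unit ->
  (forall x, (phi x U + phi x t) * ((phi x U + 2 * phi x t) * phi x t) = 0) ->
  [\/ U + t = 0, U + 2 * t = 0 | t = 0].
Proof.
move=> uU pt; have U0 x : phi x U != 0 by rewrite -unitfE rmorph_unit.
have [tau tE] : exists tau, t = tau * U by exists (t / U); rewrite divrK.
have cub x : (1 + phi x tau) * ((1 + 2 * phi x tau) * phi x tau) = 0.
  have := pt x; rewrite tE rmorphM => h.
  apply: (mulIf (x := phi x U ^+ 3)); first by rewrite expf_neq0.
  by rewrite mul0r -[RHS]h; ring.
have cubS : (1 + tau) * ((1 + 2 * tau) * tau) = 0.
  apply: sep => x; rewrite rmorph0 -[RHS](cub x) rmorphM rmorphD rmorph1.
  by rewrite (rmorphM _ (1 + 2 * tau)) (rmorphD _ 1) rmorph1 (rmorphM _ 2) rmorph_nat.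
have dtau (d : S -> S) : (forall f g, d (f + g) = d f + d g) ->
    (forall f g, d (f * g) = d f * g + f * d g) -> d 1 = 0 -> d 0 = 0 -> d tau = 0.
  move=> dD dM d1' d0; have e : (6 * tau ^+ 2 + 6 * tau + 1) * d tau = 0.
    by have := congr1 d cubS; rewrite !(dM, dD) d1' d0 => e; rewrite -[RHS]e; ring.
  apply: sep => x; rewrite rmorph0; have := congr1 (phi x) e.
  have -> : phi x ((6 * tau ^+ 2 + 6 * tau + 1) * d tau) =
    (6 * phi x tau ^+ 2 + 6 * phi x tau + 1) * phi x (d tau).
    rewrite (rmorphM _ (_ + 1)) (rmorphD _ _ 1) rmorph1 (rmorphD _ (6 * tau ^+ 2)).
    by rewrite (rmorphM _ 6) (rmorphM _ 6) rmorphXn rmorph_nat.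
  rewrite rmorph0 => /eqP.
  rewrite mulf_eq0 => /orP[/eqP h|/eqP //].
  have := cub x; move: (phi x tau) h => y h c.
  suff : (1 : R) == 0 by rewrite oner_eq0.
  (* At the roots -1, -1/2 and 0 the derivative 6 y^2 + 6 y + 1 takes the values 1, -1/2 and 1,
     whence the multipliers 1, -2 and 1 below. *)
  have h3 (z : R) : 1 = z * (6 * y ^+ 2 + 6 * y + 1) -> (1 : R) == 0.
    by move=> e'; rewrite [X in X == _]e' h mulr0.
  move/eqP: c; rewrite !mulf_eq0 => /or3P[] /eqP c.
  - apply: (h3 1); have -> : y = -1 by lra.
    by ring.
  - apply: (h3 (-2)); have -> : y = - 2^-1 by lra.
    by field.
  - by apply: (h3 1); rewrite c; ring.
have cst x : phi x tau = phi x0 tau.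
  by apply: conn => k; apply: dtau; rewrite ?dv1 ?dv0 //; [exact: dvD|exact: dvM|exact: dvD|exact: dvM].
have := cub x0 => /eqP; rewrite !mulf_eq0 => /or3P[] /eqP c.
- apply: Or31; rewrite tE; apply: sep => x; rewrite rmorphD rmorphM rmorph0 cst.
  by move/eqP: c; rewrite addrC addr_eq0 => /eqP ->; rewrite mulN1r addrN.
- apply: Or32; rewrite tE; apply: sep => x; rewrite rmorphD (rmorphM _ 2) rmorphM rmorph_nat rmorph0 cst.
  move/eqP: c; rewrite addrC addr_eq0 => /eqP c; rewrite mulrA c.
  by rewrite mulN1r addrN.
- by apply: Or33; rewrite tE; apply: sep => x; rewrite rmorphM rmorph0 cst c mul0r.
Qed.

(** If none of the three factors vanished at a point, all four tensors would vanish there, against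
    [nondeg]. *)
Lemma three_types : [\/ K1 + K2 + T = 0, K1 + K2 + 2 * T = 0 | T = 0].
Proof.
apply: constant_ratio => // x.
move: w1 w2 w3 w4; move: (K1 + K2) T => U t v1 v2 v3 v4.
apply/eqP; rewrite !mulf_eq0; apply/negPn/negP; rewrite !negb_or => /and3P[n1 n2 n3].
apply: (nondeg (x := x)); split.
- by move=> i a; have := congr1 (phi x) (v1 i a); rewrite rmorphM (rmorphD _ U) (rmorphM _ 2) rmorph_nat rmorph0 => /eqP; rewrite mulf_eq0 (negPf n2) => /eqP.
- by move=> i j; have := congr1 (phi x) (v2 i j); rewrite rmorphM rmorph0 => /eqP; rewrite mulf_eq0 (negPf n3) => /eqP.
- by move=> i j; have := congr1 (phi x) (v3 i j); rewrite rmorphM rmorph0 => /eqP; rewrite mulf_eq0 (negPf n3) => /eqP.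
- by have := congr1 (phi x) v4; rewrite rmorphM rmorphD rmorph0 => /eqP; rewrite mulf_eq0 (negPf n1) => /eqP.
Qed.

Let clear2 (t : S) : T = t -> psi * (A + B) = 2 * (P + Q) + psi ^+ 2 * t.
Proof.
move=> <-; have e : psi * w = 1 by rewrite mulrV.
transitivity (2 * (1 - (psi * w) ^+ 2) * (P + Q) + psi * (psi * w) * (A + B)).
  by rewrite e expr1n subrr mulr0 mul0r add0r mulr1.
ring.
Qed.

(* Where both differentials of psi are nonzero, 8(Q - P) = 3 psi^2 (K1 - K2); differentiating this
   gives P + Q = 0. Hence the differentials never are both nonzero, which makes M vanish. *)
Lemma typeB_impossible : K1 + K2 + 2 * T = 0 -> False.
Proof.
move=> tB.
have uT : T \is a GRing.unit.
  have e : K1 + K2 = - 2 * T by rewrite -[RHS]add0r -tB; ring.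
  by have := uS; rewrite e unitrM => /andP[].
have z2 i j : 2 * hes d1 G1 psi i j = A * G1 i j.
  by apply/eqP; rewrite -subr_eq0; apply/eqP/(mulrI uT); rewrite mulr0 w2.
have z3 i j : 2 * hes d2 G2 psi i j = B * G2 i j.
  by apply/eqP; rewrite -subr_eq0; apply/eqP/(mulrI uT); rewrite mulr0 w3.
have z4 : q = 0.
  apply/(mulrI uT); rewrite mulr0 -oppr0 -[in RHS]w4.
  transitivity (- ((K1 + K2 + T) * q) + (K1 + K2 + 2 * T) * q); last by rewrite tB mul0r addr0.
  by move: (K1 + K2) T q => a b c; ring.
have E2 : psi ^+ 2 * (K1 + K2) + 2 * psi * (A + B) = 4 * (P + Q).
  have := clear2 erefl; move: tB; move: (K1 + K2) T => k t; move: (A + B) (P + Q) => a p tB e.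
  transitivity (psi ^+ 2 * (k + 2 * t) - psi ^+ 2 * (2 * t) + 2 * (psi * a)); first by ring.
  by rewrite tB e; ring.
have Z := typeB_Z d12 uG1 sG1 uG2 sG2 d2G1 d1G2 u2 z2 z3 z4 E2 upsi uS.
have ff x i b : phi x (d1 i psi) * phi x (d2 b psi) = 0.
  apply/eqP/negPn/negP; rewrite mulf_eq0 negb_or => /andP[f0 g0].
  have hM := typeB_hess d12 uG1 sG1 uG2 sG2 d2G1 d1G2 u2 z2 z3 z4 E2 i b.
  have hW := typeB_W d12 uG1 sG1 uG2 sG2 d2G1 d1G2 u2 z2 z3 z4 E2 i.
  have hW' := typeB_W' d12 uG1 sG1 uG2 sG2 d2G1 d1G2 u2 z2 z3 z4 E2 b.
  have h1 := typeB_first1 d12 uG1 sG1 uG2 sG2 d1G2 u2 z2 z4 E2 i.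
  have h2 := typeB_first2 d12 uG1 sG1 uG2 sG2 d2G1 u2 z3 z4 E2 b.
  (* Where n is nonzero, z n = 0 makes z vanish, and by the Leibniz rule its derivative as well. *)
  have dZ0 (d : S -> S) (z n : S) : (forall u v, d (u * v) = d u * v + u * d v) -> d 0 = 0 ->
      z * n = 0 -> phi x n != 0 -> phi x (d z) = 0.
    move=> dM d0 zn n0; have zx : phi x z = 0.
      by have := congr1 (phi x) zn; rewrite rmorphM rmorph0 => /eqP; rewrite mulf_eq0 (negPf n0) orbF => /eqP.
    have := congr1 (phi x \o d) zn; rewrite /= dM d0 rmorphD (rmorphM _ (d z)) (rmorphM _ z) zx mul0r addr0 rmorph0.
    by move/eqP; rewrite mulf_eq0 (negPf n0) orbF => /eqP.
  have n0 : phi x (d1 i psi * d2 b psi) != 0 by rewrite rmorphM mulf_neq0.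
  have := dZ0 (d1 i) _ _ (dvM d1 i) (dv0 d1 i) (Z i b) n0.
  rewrite (typeB_dZ1 d12 uG1 sG1 uG2 sG2 d1G2 u2 z2) => y1.
  have := dZ0 (d2 b) _ _ (dvM d2 b) (dv0 d2 b) (Z i b) n0.
  rewrite (typeB_dZ2 d12 uG1 sG1 uG2 sG2 d2G1 u2 z3) => y2.
  have PQ := typeB_morphism erefl hM hW hW' h1 h2 E2 y1 y2 (S0 x) f0 g0.
  have P0 := gsq_ge01 x; have Q0 := gsq_ge02 x.
  have e : ip (map_mx (phi x) G1) (phi x \o (d1^~ psi)) (phi x \o (d1^~ psi)) <= 0.
    by rewrite -rmorph_ip // -[leLHS]/(phi x P); lra.
  by have := ip_posdef (sym1 x) (pos1 x) e i; move/eqP: f0.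
have ffS i b : d1 i psi * d2 b psi = 0 by apply: sep => x; rewrite rmorphM ff rmorph0.
apply: (nondeg (x := x0)); split; last 3 first.
- by move=> i j; rewrite z2 subrr rmorph0.
- by move=> i j; rewrite z3 subrr rmorph0.
- by rewrite z4 rmorph0.
move=> i b; apply/eqP/negPn/negP => M0.
(* If M i b is nonzero at x0, differentiating f1 f2 = 0 there shows that both differentials vanish,
   so P = Q = 0. Then [typeB_hess] gives lam = 0, and [E2] leaves psi^2 S = 0, a contradiction. *)
have f10 j : phi x0 (d1 j psi) = 0.
  apply/eqP/negPn/negP => n0; have := congr1 (phi x0 \o d1 i) (ffS j b).
  have g0 : phi x0 (d2 b psi) = 0.
    by apply/eqP; have /eqP := ff x0 j b; rewrite mulf_eq0 (negPf n0).
  rewrite /= dvM dv0 rmorphD (rmorphM _ (d1 i _)) (rmorphM _ (d1 j _)) g0 mulr0 add0r rmorph0.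
  by move/eqP; rewrite mulf_eq0 (negPf n0) (negPf M0).
have f20 a : phi x0 (d2 a psi) = 0.
  apply/eqP/negPn/negP => n0; have := congr1 (phi x0 \o d2 b) (ffS i a).
  rewrite /= dvM dv0 rmorphD (rmorphM _ (d2 b _)) (rmorphM _ (d1 i _)) f10 mul0r addr0 rmorph0 -d12.
  by move/eqP; rewrite mulf_eq0 (negPf n0) (negPf M0).
have hM := typeB_hess d12 uG1 sG1 uG2 sG2 d2G1 d1G2 u2 z2 z3 z4 E2 i b.
have P0 : phi x0 P = 0.
  by rewrite rmorph_ip // /ip big1 // => m _; rewrite big1 // => l _; rewrite /= !f10 !mulr0.
have Q0 : phi x0 Q = 0.
  by rewrite rmorph_ip // /ip big1 // => m _; rewrite big1 // => l _; rewrite /= !f20 !mulr0.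
move: hM E2 P0 Q0 (S0 x0) (psi0 x0) M0; rewrite ffS mulr0.
move: (K1 + K2) (A + B) P Q (M i b) => s l p r m hm E P0 Q0 s0 p0 m0.
have := congr1 (phi x0) hm; rewrite rmorph0 rmorphM => /esym /eqP; rewrite mulf_eq0 (negPf m0) orbF.
rewrite rmorphD rmorphM => /eqP h1.
have := congr1 (phi x0) E; rewrite (rmorphM _ 4) (rmorphD _ p) P0 Q0 addr0 mulr0 (rmorphD _ (psi ^+ 2 * s)).
rewrite (rmorphM _ (psi ^+ 2)) rmorphXn (rmorphM _ (2 * psi)) (rmorphM _ 2) rmorph_nat => h2.
have : phi x0 psi ^+ 2 * phi x0 s = 0.
  rewrite -[RHS]oppr0 -[in RHS]h2; apply/eqP; rewrite -subr_eq0; apply/eqP.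
  transitivity (2 * phi x0 psi * (phi x0 l + phi x0 psi * phi x0 s)); first by ring.
  by rewrite h1 mulr0.
by move/eqP; rewrite mulf_eq0 expf_eq0 (negPf p0) (negPf s0).
Qed.

(** [mix x y] has the first coordinates of x and the second ones of y. When M = 0, the derivatives
    of psi along each factor depend on that factor alone, so their products vanish even when taken
    at two unrelated points. *)
Lemma psi_one_sided : (forall i a, M i a = 0) ->
  (forall x i a, phi x (d1 i psi) * phi x (d2 a psi) = 0) ->
  (forall a, d2 a psi = 0) \/ (forall i, d1 i psi = 0).
Proof.
move=> M0 ff; have gg x y i a : phi x (d1 i psi) * phi y (d2 a psi) = 0.
  rewrite -(mix1 (f := d1 i psi) _ x y) -?(mix2 (f := d2 a psi) _ x y) //.
  by move=> b; rewrite -d12.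
case: (pselect (forall i, d1 i psi = 0)) => [|h]; [by right|left => a].
apply: sep => y; rewrite rmorph0; apply/eqP/negPn/negP => g0; apply: h => i.
apply: sep => x; rewrite rmorph0; apply/eqP.
by have /eqP := gg x y i a; rewrite mulf_eq0 (negPf g0) orbF.
Qed.

Lemma local_structure :
  ((forall a, d2 a psi = 0) /\ side_conclusion d1 d2 G1 G2 psi) \/
  ((forall i, d1 i psi = 0) /\ side_conclusion d2 d1 G2 G1 psi).
Proof.
have d21 a i f : d2 a (d1 i f) = d1 i (d2 a f) by rewrite d12.
case: three_types => [tA|/typeB_impossible //|tC].
- have TE : T = - (K1 + K2) by apply/eqP; rewrite -addr_eq0 addrC tA.
  have M0 i a : M i a = 0.
    have := w1 i a; rewrite TE => h; apply: (mulrI uS); rewrite mulr0 -oppr0 -[in RHS]h.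
    by move: (K1 + K2) (M i a) => u v; ring.
  have z2 i j : 2 * hes d1 G1 psi i j = A * G1 i j.
    apply/eqP; rewrite -subr_eq0; apply/eqP/(mulrI uS); rewrite mulr0 -oppr0 -(w2 i j) TE.
    by rewrite mulNr opprK.
  have z3 i j : 2 * hes d2 G2 psi i j = B * G2 i j.
    apply/eqP; rewrite -subr_eq0; apply/eqP/(mulrI uS); rewrite mulr0 -oppr0 -(w3 i j) TE.
    by rewrite mulNr opprK.
  have E : psi ^+ 2 * (K1 + K2) + psi * (A + B) - 2 * (P + Q) = 0.
    by rewrite (clear2 TE); move: (K1 + K2) (P + Q) => u v; ring.
  have ff x i a : phi x (d1 i psi) * phi x (d2 a psi) = 0.
    rewrite -rmorphM -[RHS](rmorph0 (phi x)); congr (phi x _); apply: (mulrI uS).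
    by rewrite mulr0; apply: typeA_no_mixed E i a.
  have [f2|f1] := psi_one_sided M0 ff; [left|right]; split => //.
    exact: side_typeA E.
  apply: side_typeA => //; first by move=> a i; rewrite d21.
  by rewrite [K2 + _]addrC [B + _]addrC [Q + _]addrC.
- have M0 i a : M i a = 0.
    by apply: (mulrI uS); rewrite mulr0 -[RHS](w1 i a) tC mulr0 addr0.
  have q0 : q = 0 by apply: (mulrI uS); rewrite mulr0 -[RHS]w4 tC addr0.
  have E : psi * (A + B) = 2 * (P + Q) by rewrite (clear2 tC) mulr0 addr0.
  have E' : psi * (B + A) = 2 * (Q + P) by rewrite [B + _]addrC [Q + _]addrC.
  have q0' : (K2 - K1) * psi + (B - A) = 0.
    by rewrite -[RHS]oppr0 -q0; move: K1 K2 A B => *; ring.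
  have M0' a i : d2 a (d1 i psi) = 0 by rewrite d21.
  (* If both differentials were nonzero at x, [typeC_traceless] on either side would make the
     traceless Hessians vanish there along with M and q, against [nondeg]. *)
  have ff x i a : phi x (d1 i psi) * phi x (d2 a psi) = 0.
    apply/eqP/negPn/negP; rewrite mulf_eq0 negb_or => /andP[f0 g0].
    apply: (nondeg (x := x)); split.
    - by move=> ? ?; rewrite M0 rmorph0.
    - exact: (typeC_traceless d12 uG1 sG1 uG2 sG2 d2G1 d1G2 u2 upsi M0 (pos1 x) q0 E f0 g0).
    - exact: (typeC_traceless d21 uG2 sG2 uG1 sG1 d1G2 d2G1 u2 upsi M0' (pos2 x) q0' E' g0 f0).
    - by rewrite q0 rmorph0.
  have [f2|f1] := psi_one_sided M0 ff; [left|right]; split => //.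
    exact: side_typeC.
  exact: side_typeC.
Qed.
End AbstractLocal.

(** * Convex domains and the equations in coordinates *)

Lemma segment_const (R : realType) (V : normedModType R) (f : V -> R) (z u : V) :
  (forall t : R, 0 <= t <= 1 -> differentiable f (t *: u + z)) ->
  (forall t : R, 0 <= t <= 1 -> 'D_u f (t *: u + z) = 0) -> f (u + z) = f z.
Proof.
move=> df D0; have dphi (t : R) : 0 <= t <= 1 ->
    is_derive t (1 : R) (fun t : R => f (t *: u + z)) 0.
  move=> t01; apply: is_derive_line; split; last exact: D0.
  exact/diff_derivable/df.
have [| |xi _] := @MVT _ (fun t : R => f (t *: u + z)) (fun=> 0) 0 1 ltr01.
- by move=> t; rewrite in_itv /= => /andP[t0 t1]; apply: dphi; rewrite !ltW.
- apply: continuous_in_subspaceT => t; rewrite inE /= in_itv /= => t01.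
  apply: differentiable_continuous; apply/derivable1_diffP.
  by have [] := dphi _ t01.
by rewrite mul0r scale1r scale0r add0r => /eqP; rewrite subr_eq0 => /eqP.
Qed.

Lemma derive_row (R : realType) n (f : 'rV[R]_n -> R) x u : differentiable f x ->
  'D_u f x = \sum_k u 0 k * pderiv f k x.
Proof.
move=> df; rewrite deriveE // {1}(row_sum_delta u) linear_sum; apply: eq_bigr => k _.
by rewrite linearZ /= /pderiv deriveE.
Qed.

(** The alternative (i) or (ii) in coordinates; the same one of the two holds on the whole of B. *)
Definition pde (R : realType) (g : 'rV[R]_2 -> 'M[R]_2) (h : 'rV[R]_2 -> R) (c : R) (B : set 'rV[R]_2) :=
  (forall x, B x -> laplacian g (fun y => (h y)^-1) x = 0 /\
      2 * grad_sqr g h x = (c - gauss g x) * h x ^+ 2) \/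
  (forall x, B x -> 2 *: hessian g h x = laplacian g h x *: g x /\
      (gauss g x + c) * h x ^+ 2 + h x * laplacian g h x = 2 * grad_sqr g h x).
Section OnDomain.
Context {R : realType} (D : odom R (2 + 2)).
Variables (gh gt : 'rV[R]_2 -> 'M[R]_2) (psi : 'rV[R]_(2 + 2) -> R).
Hypothesis smooth_gh : forall i j, smooth_on (dom D) (fun z => gh (lsubmx z) i j).
Hypothesis smooth_gt : forall i j, smooth_on (dom D) (fun z => gt (rsubmx z) i j).
Hypothesis smooth_psi : smooth_on (dom D) psi.
Hypothesis psi0 : forall z, dom D z -> psi z != 0.
Hypothesis sym_gh : forall z, dom D z -> forall i j, gh (lsubmx z) i j = gh (lsubmx z) j i.
Hypothesis sym_gt : forall z, dom D z -> forall i j, gt (rsubmx z) i j = gt (rsubmx z) j i.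
Hypothesis pos_gh : forall z, dom D z -> forall v : 'rV[R]_2, v != 0 -> 0 < (v *m gh (lsubmx z) *m v^T) 0 0.
Hypothesis pos_gt : forall z, dom D z -> forall v : 'rV[R]_2, v != 0 -> 0 < (v *m gt (rsubmx z) *m v^T) 0 0.
Hypothesis convex : forall z u, dom D z -> dom D (u + z) ->
  forall t : R, 0 <= t <= 1 -> dom D (t *: u + z).
Hypothesis box : forall z z', dom D z -> dom D z' -> dom D (row_mx (lsubmx z) (rsubmx z')).

Local Notation ldd := (ldd D).
Local Notation d1 := (dsub ldd (@lshift 2 2)).
Local Notation d2 := (dsub ldd (@rshift 2 2)).
Local Notation G1 := (lG1 smooth_gh).
Local Notation G2 := (lG2 smooth_gt).
Local Notation Psi := (lpsi smooth_psi).

(** Serves for arbitrary displacements and for those along a single factor: in each direction either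
    the displacement or the derivative is zero. *)
Let convex_const (F : sfun D) z u : dom D z -> dom D (u + z) ->
  (forall k, u 0 k = 0 \/ ldd k F = 0) -> F (u + z) = F z.
Proof.
move=> Dz Duz h; apply: segment_const => t t01.
  by apply: (sfval_smooth F 0).1; exact: convex.
have Dt := convex Dz Duz t01.
rewrite derive_row; last exact: (sfval_smooth F 0).1.
apply: big1 => k _; have [->|kF] := h k; first by rewrite mul0r.
have <- : ev Dt (ldd k F) = pderiv F k (t *: u + z) by exact: mksfE.
by rewrite kF rmorph0 mulr0.
Qed.

Lemma flat_const (F : sfun D) : (forall i, d1 i F = 0) -> (forall a, d2 a F = 0) ->
  forall z z', dom D z -> dom D z' -> F z = F z'.
Proof.
move=> F1 F2 z z' Dz Dz'; rewrite -{1}(subrK z' z); apply: convex_const; rewrite ?subrK //.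
by move=> k; right; have [i ->|a ->] := split_ordP k; [exact: F1|exact: F2].
Qed.

Lemma flat_const2 (F : sfun D) : (forall a, d2 a F = 0) ->
  forall z z', dom D z -> dom D z' -> F (row_mx (lsubmx z) (rsubmx z')) = F z.
Proof.
move=> F2 z z' Dz Dz'; set y := row_mx _ _; have Dy : dom D y := box Dz Dz'.
rewrite -{1}(subrK z y); apply: convex_const; rewrite ?subrK //.
move=> k; have [i ->|a ->] := split_ordP k; [left|right; exact: F2].
have := row_mxKl (lsubmx z) (rsubmx z'); rewrite -/y; clearbody y => /rowP/(_ i).
by rewrite !mxE => ->; rewrite subrr.
Qed.

Lemma flat_const1 (F : sfun D) : (forall i, d1 i F = 0) ->
  forall z z', dom D z -> dom D z' -> F (row_mx (lsubmx z) (rsubmx z')) = F z'.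
Proof.
move=> F1 z z' Dz Dz'; set y := row_mx _ _; have Dy : dom D y := box Dz Dz'.
rewrite -{1}(subrK z' y); apply: convex_const; rewrite ?subrK //.
move=> k; have [i ->|a ->] := split_ordP k; [right; exact: F1|left].
have := row_mxKr (lsubmx z) (rsubmx z'); rewrite -/y; clearbody y => /rowP/(_ a).
by rewrite !mxE => ->; rewrite subrr.
Qed.

Variable f : 'rV[R]_(2 + 2) -> R.
Hypothesis weak : forall z, dom D z -> forall a b,
  riemann_square (conf_metric gh gt psi) a b z = f z * conf_metric gh gt psi z a b.
Hypothesis einstein0 : exists a b, forall z, dom D z -> einstein (conf_metric gh gt psi) a b z != 0.
Hypothesis gauss0 : forall z, dom D z -> gauss gh (lsubmx z) + gauss gt (rsubmx z) != 0.

Let pt := {z | dom D z}.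
Let phi (x : pt) : {rmorphism sfun D -> R} := ev (proj2_sig x).
Let mix (x y : pt) : pt := exist _ _ (box (proj2_sig x) (proj2_sig y)).

Lemma rep_gauss1 : rep lsubmx (gauss gh) (gau d1 G1).
Proof.
exact: (rep_gauss (@lsub_lshift R) (unit_lG1 smooth_gh sym_gh pos_gh) (rep_lG1 smooth_gh)).
Qed.

Lemma rep_gauss2 : rep rsubmx (gauss gt) (gau d2 G2).
Proof.
exact: (rep_gauss (@rsub_rshift R) (unit_lG2 smooth_gt sym_gt pos_gt) (rep_lG2 smooth_gt)).
Qed.

Lemma rep_gauss_sum : rep id (fun z => gauss gh (lsubmx z) + gauss gt (rsubmx z)) (gau d1 G1 + gau d2 G2).
Proof.
move=> z Dz; apply: etrans (congr2 +%R (rep_gauss1 Dz) (rep_gauss2 Dz)) (esym (rmorphD (ev Dz) _ _)).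
Qed.

(** [local_structure] with the points of D and evaluation at them. Convexity provides the constancy
    of flat functions, [box] the recombination of points. *)
Lemma domain_structure :
  ((forall a, d2 a Psi = 0) /\ side_conclusion d1 d2 G1 G2 Psi) \/
  ((forall i, d1 i Psi = 0) /\ side_conclusion d2 d1 G2 G1 Psi).
Proof.
have [x0 Dx0] := @dom_neq0 _ _ D.
have uG1 := unit_lG1 smooth_gh sym_gh pos_gh.
have uG2 := unit_lG2 smooth_gt sym_gt pos_gt.
have [w1 w2 w3 w4] := weak_identities smooth_gh smooth_gt smooth_psi psi0 sym_gh sym_gt pos_gh pos_gt weak.
have H := @local_structure R (sfun D) d1 d2 G1 G2 Psi.
have d12 i a F : d1 i (d2 a F) = d2 a (d1 i F) by exact: pdC.
have {}H := H d12 uG1 (sym_lG1 smooth_gh sym_gh) uG2 (sym_lG2 smooth_gt sym_gt).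
have {}H := H (transverse_lG1 smooth_gh) (transverse_lG2 smooth_gt) (unit2 D) (unit_lpsi smooth_psi psi0).
have {}H := H pt (exist _ x0 Dx0) phi mix.
have sep F G : (forall x, phi x F = phi x G) -> F = G.
  by move=> FG; apply: sfun_evP => z Dz; exact: (FG (exist _ z Dz)).
have conn F : (forall i, d1 i F = 0) -> (forall a, d2 a F = 0) -> forall x y, phi x F = phi y F.
  by move=> F1 F2 [x Dx] [y Dy]; exact: flat_const.
have mix1 F : (forall a, d2 a F = 0) -> forall x y, phi (mix x y) F = phi x F.
  by move=> F2 [x Dx] [y Dy]; exact: flat_const2.
have mix2 F : (forall i, d1 i F = 0) -> forall x y, phi (mix x y) F = phi y F.
  by move=> F1 [x Dx] [y Dy]; exact: flat_const1.
have {}H := H sep conn mix1 mix2.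
have pos1 x (v : 'rV[R]_2) : v != 0 -> 0 < (v *m map_mx (phi x) G1 *m v^T) 0 0.
  by move=> v0; rewrite (ev_lG1 smooth_gh (proj2_sig x)); exact: pos_gh (proj2_sig x) _ v0.
have pos2 x (v : 'rV[R]_2) : v != 0 -> 0 < (v *m map_mx (phi x) G2 *m v^T) 0 0.
  by move=> v0; rewrite (ev_lG2 smooth_gt (proj2_sig x)); exact: pos_gt (proj2_sig x) _ v0.
have {}H := H pos1 pos2.
have uS : gau d1 G1 + gau d2 G2 \is a GRing.unit.
  by apply/sf_unitP => z Dz; have := gauss0 Dz; have := rep_gauss_sum Dz; rewrite /id => ->.
have {}H := H uS.
have {}H := H w1 w2 w3 w4.
apply: H => -[z Dz]; have [a [b e0]] := einstein0.
exact: (einstein_nondegenerate psi0 sym_gh sym_gt pos_gh pos_gt (e0 z Dz)).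
Qed.

Lemma ev_pdeA z (Dz : dom D z) (p k1 k2 g : sfun D) : 2 * g = (k2 - k1) * p ^+ 2 ->
  2 * ev Dz g = (ev Dz k2 - ev Dz k1) * ev Dz p ^+ 2.
Proof.
move=> /(congr1 (ev Dz)); rewrite (rmorphM _ 2) rmorph_nat => ->.
by rewrite (rmorphM _ (_ - _)) rmorphB rmorphXn.
Qed.

Lemma ev_pdeB z (Dz : dom D z) (p k1 k2 g l : sfun D) : (k1 + k2) * p ^+ 2 + p * l = 2 * g ->
  (ev Dz k1 + ev Dz k2) * ev Dz p ^+ 2 + ev Dz p * ev Dz l = 2 * ev Dz g.
Proof.
move=> /(congr1 (ev Dz)); rewrite (rmorphM _ 2) rmorph_nat => <-.
by rewrite rmorphD (rmorphM _ (_ + _)) rmorphD rmorphXn (rmorphM _ p).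
Qed.

Lemma rep_inv (proj : 'rV[R]_(2 + 2) -> 'rV[R]_2) (h : 'rV[R]_2 -> R) (F : sfun D) :
  F \is a GRing.unit -> rep proj h F -> rep proj (fun y => (h y)^-1) F^-1.
Proof. by move=> uF hF z Dz; rewrite rmorphV //= (hF z Dz). Qed.

Lemma pde_of_side1 (h : 'rV[R]_2 -> R) (c : R) : rep lsubmx h Psi ->
  (forall z, dom D z -> gauss gt (rsubmx z) = c) ->
  side_conclusion d1 d2 G1 G2 Psi -> pde gh h c (lsubmx @` dom D).
Proof.
move=> hP gc; have uG1 := unit_lG1 smooth_gh sym_gh pos_gh; have rG := rep_lG1 smooth_gh.
case=> _ [[L E]|[H E]]; [left|right] => x [z Dz <-].
- have rl := rep_laplacian (@lsub_lshift R) uG1 rG (rep_inv (unit_lpsi smooth_psi psi0) hP) Dz.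
  rewrite rl L rmorph0; split => //.
  rewrite (rep_grad_sqr (@lsub_lshift R) uG1 rG hP Dz) (hP z Dz) -(gc z Dz) (rep_gauss1 Dz) (rep_gauss2 Dz).
  exact: ev_pdeA.
- rewrite (rep_laplacian (@lsub_lshift R) uG1 rG hP Dz); split; last first.
    rewrite (rep_grad_sqr (@lsub_lshift R) uG1 rG hP Dz) (hP z Dz) -(gc z Dz) (rep_gauss1 Dz) (rep_gauss2 Dz).
    exact: ev_pdeB.
  apply/matrixP => i j; rewrite [LHS]mxE [RHS]mxE (rep_hessian (@lsub_lshift R) uG1 rG i j hP Dz) (rG i j z Dz).
  have := congr1 (ev Dz) (H i j).
  by rewrite (rmorphM _ 2) rmorph_nat (rmorphM _ (lap _ _ _)).
Qed.

Lemma pde_of_side2 (h : 'rV[R]_2 -> R) (c : R) : rep rsubmx h Psi ->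
  (forall z, dom D z -> gauss gh (lsubmx z) = c) ->
  side_conclusion d2 d1 G2 G1 Psi -> pde gt h c (rsubmx @` dom D).
Proof.
move=> hP gc; have uG2 := unit_lG2 smooth_gt sym_gt pos_gt; have rG := rep_lG2 smooth_gt.
case=> _ [[L E]|[H E]]; [left|right] => x [z Dz <-].
- have rl := rep_laplacian (@rsub_rshift R) uG2 rG (rep_inv (unit_lpsi smooth_psi psi0) hP) Dz.
  rewrite rl L rmorph0; split => //.
  rewrite (rep_grad_sqr (@rsub_rshift R) uG2 rG hP Dz) (hP z Dz) -(gc z Dz) (rep_gauss1 Dz) (rep_gauss2 Dz).
  exact: ev_pdeA.
- rewrite (rep_laplacian (@rsub_rshift R) uG2 rG hP Dz); split; last first.
    rewrite (rep_grad_sqr (@rsub_rshift R) uG2 rG hP Dz) (hP z Dz) -(gc z Dz) (rep_gauss1 Dz) (rep_gauss2 Dz).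
    exact: ev_pdeB.
  apply/matrixP => i j; rewrite [LHS]mxE [RHS]mxE (rep_hessian (@rsub_rshift R) uG2 rG i j hP Dz) (rG i j z Dz).
  have := congr1 (ev Dz) (H i j).
  by rewrite (rmorphM _ 2) rmorph_nat (rmorphM _ (lap _ _ _)).
Qed.

(** The point z0 fixes the slice on which psi is read as a function on one factor. The curvature of
    the other factor is constant: along its own factor by [side_conclusion], along the first one by
    the product structure. *)
Lemma local_theorem z0 : dom D z0 ->
  [\/ [/\ forall z, dom D z -> psi z = psi (row_mx (lsubmx z) (rsubmx z0)),
         forall z, dom D z -> gauss gt (rsubmx z) = gauss gt (rsubmx z0) &
         pde gh (fun x => psi (row_mx x (rsubmx z0))) (gauss gt (rsubmx z0)) (lsubmx @` dom D)] |
      [/\ forall z, dom D z -> psi z = psi (row_mx (lsubmx z0) (rsubmx z)),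
         forall z, dom D z -> gauss gh (lsubmx z) = gauss gh (lsubmx z0) &
         pde gt (fun y => psi (row_mx (lsubmx z0) y)) (gauss gh (lsubmx z0)) (rsubmx @` dom D)]].
Proof.
move=> Dz0; have d12 i a F : d1 i (d2 a F) = d2 a (d1 i F) by exact: pdC.
have psiE z (Dz : dom D z) : Psi z = psi z by rewrite mksfE.
have [[P2 sc]|[P1 sc]] := domain_structure; [left|right].
- have psi1 z : dom D z -> psi z = psi (row_mx (lsubmx z) (rsubmx z0)).
    by move=> Dz; rewrite -!psiE //; [rewrite flat_const2|exact: box].
  have gc z : dom D z -> gauss gt (rsubmx z) = gauss gt (rsubmx z0).
    move=> Dz; rewrite (rep_gauss2 Dz) (rep_gauss2 Dz0); apply: flat_const => //; last exact: sc.1.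
    exact: (side_gau d12 (unit_lG2 smooth_gt sym_gt pos_gt) (transverse_lG2 smooth_gt)).
  split => //; apply: pde_of_side1 => // z Dz.
  by rewrite -psi1 // -psiE.
- have psi2 z : dom D z -> psi z = psi (row_mx (lsubmx z0) (rsubmx z)).
    by move=> Dz; rewrite -!psiE //; [rewrite flat_const1|exact: box].
  have gc z : dom D z -> gauss gh (lsubmx z) = gauss gh (lsubmx z0).
    move=> Dz; rewrite (rep_gauss1 Dz) (rep_gauss1 Dz0); apply: flat_const => //; first exact: sc.1.
    have d21 a i F : d2 a (d1 i F) = d1 i (d2 a F) by rewrite d12.
    exact: (side_gau d21 (unit_lG1 smooth_gh sym_gh pos_gh) (transverse_lG1 smooth_gh)).
  split => //; apply: pde_of_side2 => // z Dz.
  by rewrite -psi2 // -psiE.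
Qed.
End OnDomain.

(** * Coordinate projections and balls of the sup norm *)

Lemma smooth_coord (R : realType) n (D : set 'rV[R]_n) k : smooth_on D (fun y : 'rV[R]_n => y 0 k).
Proof.
case=> [|r]; first by split=> // x _; exact: differentiable_coord.
split=> [x _|l]; first exact: differentiable_coord.
have -> : pderiv (fun y : 'rV[R]_n => y 0 k) l = fun=> (delta_mx 0 l : 'rV[R]_n) 0 k.
  apply/funext => x; rewrite -(@pderiv_entry _ _ _ _ (fun y : 'rV[R]_n => y)) //.
  by rewrite /pderiv derive_id.
exact: smooth_upto_cst.
Qed.

(** Covers the identity, the two projections of a product and permutations of the coordinates. *)
Lemma smooth_rows (R : realType) m n (D : set 'rV[R]_m) (e : 'I_n -> 'I_m) :
  smooth_on D (fun y : 'rV[R]_m => \row_j y 0 (e j)).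
Proof.
move=> r; apply: (@smooth_upto_subset _ _ setT) => //; apply/(smooth_upto_mx (@openT _)) => i j.
have -> : (fun y : 'rV[R]_m => (\row_j0 y 0 (e j0)) i j) = (fun y => y 0 (e j)).
  by apply/funext => y; rewrite mxE.
exact: smooth_coord.
Qed.

Lemma smooth_lsub (R : realType) m n (D : set 'rV[R]_(m + n)) :
  smooth_on D (@lsubmx R 1 m n).
Proof.
have -> : @lsubmx R 1 m n = fun y => \row_j y 0 (lshift n j); last exact: smooth_rows.
by apply/funext => y; apply/rowP => j; rewrite !mxE.
Qed.

Lemma smooth_rsub (R : realType) m n (D : set 'rV[R]_(m + n)) :
  smooth_on D (@rsubmx R 1 m n).
Proof.
have -> : @rsubmx R 1 m n = fun y => \row_j y 0 (rshift m j); last exact: smooth_rows.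
by apply/funext => y; apply/rowP => j; rewrite !mxE.
Qed.

Lemma smooth_continuous (R : realType) n (W : normedModType R) (D : set 'rV[R]_n) (f : 'rV[R]_n -> W) x :
  smooth_on D f -> D x -> {for x, continuous f}.
Proof. by move=> sf Dx; apply: differentiable_continuous; exact: (sf 0).1. Qed.

Lemma open_preim_box (R : realType) m n (U : set 'rV[R]_m) (V : set 'rV[R]_n) : open U -> open V ->
  open [set z : 'rV[R]_(m + n) | U (lsubmx z) /\ V (rsubmx z)].
Proof.
move=> oU oV; apply: openI.
  apply: (@open_comp _ _ (@lsubmx R 1 m n)) => // z _.
  exact: (smooth_continuous (smooth_lsub setT)).
apply: (@open_comp _ _ (@rsubmx R 1 m n)) => // z _.
exact: (smooth_continuous (smooth_rsub setT)).
Qed.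

Lemma ball_rowP (R : realType) n (z y : 'rV[R]_n) r :
  ball z r y <-> 0 < r /\ forall k, `|z 0 k - y 0 k| < r.
Proof.
split=> [[r0 h]|[r0 h]]; split=> //; first by move=> k; exact: (h 0 k).
by move=> i k; rewrite (ord1 i); exact: (h k).
Qed.

(** The reason for working on balls: for the sup norm a ball is the product of its two
    projections. *)
Lemma ball_box (R : realType) m n (z0 z : 'rV[R]_(m + n)) r :
  ball z0 r z <-> ball (lsubmx z0) r (lsubmx z) /\ ball (rsubmx z0) r (rsubmx z).
Proof.
split=> [/ball_rowP[r0 h]|[/ball_rowP[r0 h1] /ball_rowP[_ h2]]].
  by split; apply/ball_rowP; split => // k; rewrite !mxE.
apply/ball_rowP; split=> // k; have [i ->|i ->] := split_ordP k.
  by have := h1 i; rewrite !mxE.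
by have := h2 i; rewrite !mxE.
Qed.

Lemma ball_convex (R : realType) n (x z u : 'rV[R]_n) r : ball x r z -> ball x r (u + z) ->
  forall t : R, 0 <= t <= 1 -> ball x r (t *: u + z).
Proof.
move=> /ball_rowP[r0 h1] /ball_rowP[_ h2] t /andP[t0 t1]; apply/ball_rowP; split=> // k.
have := h1 k; have := h2 k; rewrite !mxE.
set a := x 0 k - z 0 k; set b := _ - (u 0 k + _) => br ar.
have -> : x 0 k - (t * u 0 k + z 0 k) = (1 - t) * a + t * b by rewrite /a /b; ring.
apply: le_lt_trans (ler_normD _ _) _; rewrite !normrM (ger0_norm t0) (@ger0_norm _ (1 - t)) ?subr_ge0 //.
set m := Num.max `|a| `|b|; have mr : m < r by rewrite gt_max ar.
apply: le_lt_trans mr; have ma : `|a| <= m by rewrite le_max lexx.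
have mb : `|b| <= m by rewrite le_max lexx orbT.
have -> : m = (1 - t) * m + t * m by ring.
by rewrite lerD // ler_wpM2l // subr_ge0.
Qed.

Section Repable.
Context {R : realType} {n : nat} (D : odom R n) (g : 'rV[R]_n -> 'M[R]_n) (G : 'M[sfun D]_n).
Hypothesis uG : G \in unitmx.
Hypothesis gG : forall i j, rep id (fun y => g y i j) (G i j).

Let projE (y : 'rV[R]_n) k (h : R) : id (h *: delta_mx 0 (id k) + y) = h *: delta_mx 0 k + y.
Proof. by []. Qed.

(** Membership in the ring gives continuity of the component, which therefore stays nonzero near the
    given point. *)
Lemma rep_einstein a b : exists F : sfun D, rep id (einstein g a b) F.
Proof.
have rr c e : rep id (ricci g c e) (\sum_i \sum_j invmx G i j * rie (pdfam D id) G i c j e).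
  exact: (rep_sum2M (rep_ginv uG gG) (fun i j => rep_riemann projE uG gG i c j e)).
have rs := rep_sum2M (rep_ginv uG gG) rr.
have rc : rep id (fun=> n%:R^-1 : R) (sf_cst (n%:R^-1) : sfun D) by move=> z Dz; rewrite /ev mksfE.
eexists; exact: (rep_sub (rr a b) (rep_mul (rep_mul rs rc) (gG a b))).
Qed.
End Repable.

Lemma rep_neq0_near (R : realType) n (D : odom R n) (f : 'rV[R]_n -> R) (F : sfun D) z :
  rep id f F -> dom D z -> f z != 0 -> \forall y \near z, f y != 0.
Proof.
move=> fF Dz fz; have cF : {for z, continuous F} by exact: smooth_continuous (sfval_smooth F) Dz.
have Fz : F z != 0 by rewrite -[F z]/(ev Dz F) -(fF z Dz).
have nF := cvgr_neq0 _ cF Fz; have nD : \forall y \near z, dom D y by apply: open_nbhs_nbhs; split=> //; exact: dom_open.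
near=> y; have Dy : dom D y by near: y.
have -> : f y = F y by exact: (fF y Dy).
by near: y; exact: nF.
Unshelve. all: by end_near. Qed.

(** * A ball around the given point in one chart *)

Section Chart.
Context {R : realType} (Uh Ut : set 'rV[R]_2) (gh gt : 'rV[R]_2 -> 'M[R]_2) (psi : 'rV[R]_(2 + 2) -> R).
Hypotheses (oUh : open Uh) (oUt : open Ut).
Let U := [set z : 'rV[R]_(2 + 2) | Uh (lsubmx z) /\ Ut (rsubmx z)].
Hypotheses (smooth_gh : smooth_on Uh gh) (smooth_gt : smooth_on Ut gt) (smooth_psi : smooth_on U psi).
Hypothesis psi0 : forall z, U z -> psi z != 0.
Hypothesis sym_gh : forall x, Uh x -> forall i j, gh x i j = gh x j i.
Hypothesis sym_gt : forall x, Ut x -> forall i j, gt x i j = gt x j i.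
Hypothesis pos_gh : forall x, Uh x -> forall v : 'rV[R]_2, v != 0 -> 0 < (v *m gh x *m v^T) 0 0.
Hypothesis pos_gt : forall x, Ut x -> forall v : 'rV[R]_2, v != 0 -> 0 < (v *m gt x *m v^T) 0 0.
Variable z0 : 'rV[R]_(2 + 2).
Hypothesis Uz0 : U z0.

Let oU : open U. Proof. exact: open_preim_box. Qed.

Let smooth_gh' (D : odom R (2 + 2)) : dom D `<=` U -> forall i j, smooth_on (dom D) (fun z => gh (lsubmx z) i j).
Proof.
move=> DU i j r; apply: (@smooth_upto_comp _ _ _ _ Uh (fun x => gh x i j) (@lsubmx R 1 2 2)) (smooth_lsub _ r) => //.
- exact: dom_open.
- by move=> z /DU[].
- exact: ((smooth_upto_mx oUh r gh).2 (smooth_gh r) i j).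
Qed.

Let smooth_gt' (D : odom R (2 + 2)) : dom D `<=` U -> forall i j, smooth_on (dom D) (fun z => gt (rsubmx z) i j).
Proof.
move=> DU i j r; apply: (@smooth_upto_comp _ _ _ _ Ut (fun x => gt x i j) (@rsubmx R 1 2 2)) (smooth_rsub _ r) => //.
- exact: dom_open.
- by move=> z /DU[].
- exact: ((smooth_upto_mx oUt r gt).2 (smooth_gt r) i j).
Qed.

Let D0 : odom R (2 + 2) := Odom oU (ex_intro _ z0 Uz0).

(** Kept apart from what follows because it is applied in the chart where the Weyl tensor is known
    to be nonzero, possibly another than the one used for the Einstein tensor. *)
Lemma chart_weyl a b c e : weyl (conf_metric gh gt psi) a b c e z0 != 0 ->
  gauss gh (lsubmx z0) + gauss gt (rsubmx z0) != 0.
Proof.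
apply: (@weyl_nondegenerate _ D0 gh gt psi (@smooth_gh' D0 (fun z h => h)) (@smooth_gt' D0 (fun z h => h)) smooth_psi).
- exact: psi0.
- by move=> z [+ _]; exact: sym_gh.
- by move=> z [_ +]; exact: sym_gt.
- by move=> z [+ _]; exact: pos_gh.
- by move=> z [_ +]; exact: pos_gt.
- exact: Uz0.
Qed.

Variable f : 'rV[R]_(2 + 2) -> R.
Hypothesis weak : forall z, U z -> forall a b,
  riemann_square (conf_metric gh gt psi) a b z = f z * conf_metric gh gt psi z a b.
Variables (a0 b0 : 'I_(2 + 2)).
Hypothesis einstein0 : einstein (conf_metric gh gt psi) a0 b0 z0 != 0.
Hypothesis gauss0 : gauss gh (lsubmx z0) + gauss gt (rsubmx z0) != 0.

(** All three conditions are open: [U] is an open set, and the other two say that a function in the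
    ring is nonzero. *)
Lemma nondegenerate_ball : exists2 r : R, 0 < r & forall z, ball z0 r z ->
  [/\ U z, einstein (conf_metric gh gt psi) a0 b0 z != 0 & gauss gh (lsubmx z) + gauss gt (rsubmx z) != 0].
Proof.
have sgh := @smooth_gh' D0 (fun z h => h); have sgt := @smooth_gt' D0 (fun z h => h).
have syh z : dom D0 z -> forall i j, gh (lsubmx z) i j = gh (lsubmx z) j i by case=> + _; exact: sym_gh.
have syt z : dom D0 z -> forall i j, gt (rsubmx z) i j = gt (rsubmx z) j i by case=> _ +; exact: sym_gt.
have ph z : dom D0 z -> forall v : 'rV[R]_2, v != 0 -> 0 < (v *m gh (lsubmx z) *m v^T) 0 0 by case=> + _; exact: pos_gh.
have pt z : dom D0 z -> forall v : 'rV[R]_2, v != 0 -> 0 < (v *m gt (rsubmx z) *m v^T) 0 0 by case=> _ +; exact: pos_gt.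
have [F hF] := rep_einstein (unit_conf_metric sgh sgt smooth_psi psi0 syh syt ph pt) 
  (rep_conf_metric sgh sgt smooth_psi psi0) a0 b0.
have nE := rep_neq0_near hF Uz0 einstein0.
have hG := rep_gauss_sum sgh sgt syh syt ph pt.
have nG := rep_neq0_near hG Uz0 gauss0.
have nU : \forall z \near z0, U z by apply: open_nbhs_nbhs.
have : \forall z \near z0, [/\ U z, einstein (conf_metric gh gt psi) a0 b0 z != 0
   & gauss gh (lsubmx z) + gauss gt (rsubmx z) != 0].
  by near=> z; split; near: z.
by move=> /nbhs_ballP[r r0 h]; exists r.
Unshelve. all: by end_near. Qed.

Lemma chart_theorem : exists r : R, [/\ 0 < r, ball (lsubmx z0) r `<=` Uh, ball (rsubmx z0) r `<=` Ut &
  [\/ [/\ forall z, ball z0 r z -> psi z = psi (row_mx (lsubmx z) (rsubmx z0)),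
         forall y, ball (rsubmx z0) r y -> gauss gt y = gauss gt (rsubmx z0) &
         pde gh (fun x => psi (row_mx x (rsubmx z0))) (gauss gt (rsubmx z0)) (ball (lsubmx z0) r)] |
      [/\ forall z, ball z0 r z -> psi z = psi (row_mx (lsubmx z0) (rsubmx z)),
         forall x, ball (lsubmx z0) r x -> gauss gh x = gauss gh (lsubmx z0) &
         pde gt (fun y => psi (row_mx (lsubmx z0) y)) (gauss gh (lsubmx z0)) (ball (rsubmx z0) r)]]].
Proof.
have [r r0 hr] := nondegenerate_ball; exists r.
have bc := ballxx z0 r0.
have oB : open (ball z0 r) by exact: ball_open.
pose D : odom R (2 + 2) := Odom oB (ex_intro _ z0 bc).
have DU : dom D `<=` U by move=> z /hr[].
have bl x : ball (lsubmx z0) r x -> ball z0 r (row_mx x (rsubmx z0)).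
  by move=> h; apply/ball_box; rewrite row_mxKl row_mxKr; split => //; exact: ballxx.
have br y : ball (rsubmx z0) r y -> ball z0 r (row_mx (lsubmx z0) y).
  by move=> h; apply/ball_box; rewrite row_mxKl row_mxKr; split => //; exact: ballxx.
have lD : lsubmx @` dom D = ball (lsubmx z0) r.
  apply/seteqP; split => [_ [z /ball_box[h _] <-] //|x /bl h].
  by exists (row_mx x (rsubmx z0)) => //; rewrite row_mxKl.
have rD : rsubmx @` dom D = ball (rsubmx z0) r.
  apply/seteqP; split => [_ [z /ball_box[_ h] <-] //|x /br h].
  by exists (row_mx (lsubmx z0) x) => //; rewrite row_mxKr.
split => //.
- by move=> x /bl/hr[[+ _] _ _]; rewrite row_mxKl.
- by move=> x /br/hr[[_ +] _ _]; rewrite row_mxKr.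
have := @local_theorem R D gh gt psi (smooth_gh' DU) (smooth_gt' DU).
have sp : smooth_on (dom D) psi by move=> k; apply: smooth_upto_subset (smooth_psi k).
move=> /(_ sp); have h1 z : dom D z -> psi z != 0 by move=> /DU; exact: psi0.
move=> /(_ h1).
have syh z : dom D z -> forall i j, gh (lsubmx z) i j = gh (lsubmx z) j i by move=> /DU[+ _]; exact: sym_gh.
have syt z : dom D z -> forall i j, gt (rsubmx z) i j = gt (rsubmx z) j i by move=> /DU[_ +]; exact: sym_gt.
have ph z : dom D z -> forall v : 'rV[R]_2, v != 0 -> 0 < (v *m gh (lsubmx z) *m v^T) 0 0 by move=> /DU[+ _]; exact: pos_gh.
have pt z : dom D z -> forall v : 'rV[R]_2, v != 0 -> 0 < (v *m gt (rsubmx z) *m v^T) 0 0 by move=> /DU[_ +]; exact: pos_gt.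
move=> /(_ syh syt ph pt).
have cv z u : dom D z -> dom D (u + z) -> forall t : R, 0 <= t <= 1 -> dom D (t *: u + z) by exact: ball_convex.
have bx z z' : dom D z -> dom D z' -> dom D (row_mx (lsubmx z) (rsubmx z')).
  by move=> /ball_box[? _] /ball_box[_ ?]; apply/ball_box; rewrite row_mxKl row_mxKr.
move=> /(_ cv bx f).
have wk z : dom D z -> forall a b,
  riemann_square (conf_metric gh gt psi) a b z = f z * conf_metric gh gt psi z a b.
  by move=> /DU; exact: weak.
have ei : exists a b, forall z, dom D z -> einstein (conf_metric gh gt psi) a b z != 0.
  by exists a0, b0 => z /hr[].
have ga z : dom D z -> gauss gh (lsubmx z) + gauss gt (rsubmx z) != 0 by move=> /hr[].
move=> /(_ wk ei ga z0 bc); rewrite lD rD => -[[h2 h3 h4]|[h2 h3 h4]]; [left|right]; split => //.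
  by move=> y /br/h3; rewrite row_mxKr.
by move=> y /bl/h3; rewrite row_mxKl.
Qed.
End Chart.

(** * Invariance of the Gaussian curvature *)

(* The indices i, j, l of the Christoffel symbol give the Jacobian rows u, v, w, with derivatives X;
   h, D and q are the other metric, its derivatives and its Christoffel symbols. *)
Lemma frame_christoffel (S : comNzRingType) (D000 D001 D011 D100 D101 D111 Xuv0 Xuv1 Xuw0 Xuw1 Xvw0 Xvw1 h00 h01 h11 q000 q001 q011 q100 q101 q111 u0 u1 v0 v1 w0 w1 : S) :
  2 * (h00 * q000 + h01 * q100) = D000 + D000 - D000 ->
  2 * (h00 * q001 + h01 * q101) = D001 + D100 - D001 ->
  2 * (h00 * q011 + h01 * q111) = D101 + D101 - D011 ->
  2 * (h01 * q000 + h11 * q100) = D001 + D001 - D100 ->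
  2 * (h01 * q001 + h11 * q101) = D011 + D101 - D101 ->
  2 * (h01 * q011 + h11 * q111) = D111 + D111 - D111 ->
  2 * (w0 * h00 * (Xuv0 + u0 * v0 * q000 + u0 * v1 * q001 + u1 * v0 * q001 + u1 * v1 * q011) + w0 *
    h01 * (Xuv1 + u0 * v0 * q100 + u0 * v1 * q101 + u1 * v0 * q101 + u1 * v1 * q111) + w1 * h01 *
    (Xuv0 + u0 * v0 * q000 + u0 * v1 * q001 + u1 * v0 * q001 + u1 * v1 * q011) + w1 * h11 * (Xuv1 +
    u0 * v0 * q100 + u0 * v1 * q101 + u1 * v0 * q101 + u1 * v1 * q111)) =
  ((Xuv0 * h00 * w0 + v0 * h00 * Xuw0 + v0 * w0 * (u0 * D000 + u1 * D100)) + (Xuv0 * h01 * w1 + v0 *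
    h01 * Xuw1 + v0 * w1 * (u0 * D001 + u1 * D101)) + (Xuv1 * h01 * w0 + v1 * h01 * Xuw0 + v1 * w0 *
    (u0 * D001 + u1 * D101)) + (Xuv1 * h11 * w1 + v1 * h11 * Xuw1 + v1 * w1 * (u0 * D011 + u1 *
    D111))) + ((Xuv0 * h00 * w0 + u0 * h00 * Xvw0 + u0 * w0 * (v0 * D000 + v1 * D100)) + (Xuv0 * h01
    * w1 + u0 * h01 * Xvw1 + u0 * w1 * (v0 * D001 + v1 * D101)) + (Xuv1 * h01 * w0 + u1 * h01 * Xvw0
    + u1 * w0 * (v0 * D001 + v1 * D101)) + (Xuv1 * h11 * w1 + u1 * h11 * Xvw1 + u1 * w1 * (v0 * D011
    + v1 * D111))) - ((Xuw0 * h00 * v0 + u0 * h00 * Xvw0 + u0 * v0 * (w0 * D000 + w1 * D100)) +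
    (Xuw0 * h01 * v1 + u0 * h01 * Xvw1 + u0 * v1 * (w0 * D001 + w1 * D101)) + (Xuw1 * h01 * v0 + u1
    * h01 * Xvw0 + u1 * v0 * (w0 * D001 + w1 * D101)) + (Xuw1 * h11 * v1 + u1 * h11 * Xvw1 + u1 * v1
    * (w0 * D011 + w1 * D111))).
Proof.
move=> e000 e001 e011 e100 e101 e111; apply/eqP; rewrite -subr_eq0; apply/eqP.
(* The difference of the two sides as a combination of the hypotheses, with products of Jacobian
   entries as coefficients. *)
transitivity (w0 * u0 * v0 * (2 * (h00 * q000 + h01 * q100) - (D000 + D000 - D000)) + w0 * u0 * v1 *
    (2 * (h00 * q001 + h01 * q101) - (D001 + D100 - D001)) + w0 * u1 * v0 * (2 * (h00 * q001 + h01 *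
    q101) - (D001 + D100 - D001)) + w0 * u1 * v1 * (2 * (h00 * q011 + h01 * q111) - (D101 + D101 -
    D011)) + w1 * u0 * v0 * (2 * (h01 * q000 + h11 * q100) - (D001 + D001 - D100)) + w1 * u0 * v1 *
    (2 * (h01 * q001 + h11 * q101) - (D011 + D101 - D101)) + w1 * u1 * v0 * (2 * (h01 * q001 + h11 *
    q101) - (D011 + D101 - D101)) + w1 * u1 * v1 * (2 * (h01 * q011 + h11 * q111) - (D111 + D111 -
    D111))); first by ring.
by rewrite e000 e001 e011 e100 e101 e111; ring.
Qed.

(* Here g and q, r are the Christoffel symbols in the two charts, j and x entries of the Jacobian,
   X and Y their derivatives. The hypotheses are the transformation law of the Christoffel symbols
   and two of its derivatives; the conclusion is that of the curvature. *)
Lemma frame_curvature (S : comNzRingType) (D0g011 D0g111 D1g001 D1g101 X00 X01 X11 Y001 Y011 Y101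
    Y111 Z d0q00 d0q01 d0q11 d1q00 d1q01 d1q11 g000 g001 g011 g100 g101 g111 j00 j01 j10 j11 q00 q01
    q11 r000 r001 r011 r100 r101 r111 x0 x1 : S) :
  (g000 * x0 + g100 * x1) = (X00 + j00 * j00 * q00 + j00 * j01 * q01 + j01 * j00 * q01 + j01 * j01 * q11) ->
  (g001 * x0 + g101 * x1) = (X01 + j00 * j10 * q00 + j00 * j11 * q01 + j01 * j10 * q01 + j01 * j11 * q11) ->
  (g011 * x0 + g111 * x1) = (X11 + j10 * j10 * q00 + j10 * j11 * q01 + j11 * j10 * q01 + j11 * j11 * q11) ->
  (g001 * j00 + g101 * j10) = (Y001 + j00 * j10 * r000 + j00 * j11 * r001 + j01 * j10 * r001 + j01 * j11 * r011) ->
  (g011 * j00 + g111 * j10) = (Y011 + j10 * j10 * r000 + j10 * j11 * r001 + j11 * j10 * r001 + j11 * j11 * r011) ->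
  (g001 * j01 + g101 * j11) = (Y101 + j00 * j10 * r100 + j00 * j11 * r101 + j01 * j10 * r101 + j01 * j11 * r111) ->
  (g011 * j01 + g111 * j11) = (Y111 + j10 * j10 * r100 + j10 * j11 * r101 + j11 * j10 * r101 + j11 * j11 * r111) ->
  ((D0g011 * x0 + g011 * X00) + (D0g111 * x1 + g111 * X01)) = (Z + (Y001 * j10 * q00 + j10 * Y001 *
    q00 + j10 * j10 * (j00 * d0q00 + j01 * d1q00)) + (Y001 * j11 * q01 + j10 * Y101 * q01 + j10 *
    j11 * (j00 * d0q01 + j01 * d1q01)) + (Y101 * j10 * q01 + j11 * Y001 * q01 + j11 * j10 * (j00 *
    d0q01 + j01 * d1q01)) + (Y101 * j11 * q11 + j11 * Y101 * q11 + j11 * j11 * (j00 * d0q11 + j01 *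
    d1q11))) ->
  ((D1g001 * x0 + g001 * X01) + (D1g101 * x1 + g101 * X11)) = (Z + (Y001 * j10 * q00 + j00 * Y011 *
    q00 + j00 * j10 * (j10 * d0q00 + j11 * d1q00)) + (Y001 * j11 * q01 + j00 * Y111 * q01 + j00 *
    j11 * (j10 * d0q01 + j11 * d1q01)) + (Y101 * j10 * q01 + j01 * Y011 * q01 + j01 * j10 * (j10 *
    d0q01 + j11 * d1q01)) + (Y101 * j11 * q11 + j01 * Y111 * q11 + j01 * j11 * (j10 * d0q11 + j11 *
    d1q11))) ->
  ((D0g011 - D1g001 + ((g000 * g011 - g001 * g001) + (g001 * g111 - g011 * g101))) * x0 + (D0g111 -
    D1g101 + ((g100 * g011 - g101 * g001) + (g101 * g111 - g111 * g101))) * x1) = (j00 * j11 - j01 *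
    j10) * (j10 * (d0q01 - d1q00 + ((q00 * r001 - q01 * r000) + (q01 * r101 - q11 * r100))) + j11 *
    (d0q11 - d1q01 + ((q00 * r011 - q01 * r001) + (q01 * r111 - q11 * r101)))).
Proof.
move=> a00 a01 a11 b001 b011 b101 b111 d011 d101; apply/eqP; rewrite -subr_eq0; apply/eqP.
(* Again a combination of the hypotheses: the two differentiated laws enter with coefficients 1 and
   -1, the law itself multiplied by Christoffel symbols of either chart, in the second case also by
   Jacobian entries. *)
transitivity ((((D0g011 * x0 + g011 * X00) + (D0g111 * x1 + g111 * X01)) - (Z + (Y001 * j10 * q00 +
    j10 * Y001 * q00 + j10 * j10 * (j00 * d0q00 + j01 * d1q00)) + (Y001 * j11 * q01 + j10 * Y101 *
    q01 + j10 * j11 * (j00 * d0q01 + j01 * d1q01)) + (Y101 * j10 * q01 + j11 * Y001 * q01 + j11 *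
    j10 * (j00 * d0q01 + j01 * d1q01)) + (Y101 * j11 * q11 + j11 * Y101 * q11 + j11 * j11 * (j00 *
    d0q11 + j01 * d1q11)))) - (((D1g001 * x0 + g001 * X01) + (D1g101 * x1 + g101 * X11)) - (Z +
    (Y001 * j10 * q00 + j00 * Y011 * q00 + j00 * j10 * (j10 * d0q00 + j11 * d1q00)) + (Y001 * j11 *
    q01 + j00 * Y111 * q01 + j00 * j11 * (j10 * d0q01 + j11 * d1q01)) + (Y101 * j10 * q01 + j01 *
    Y011 * q01 + j01 * j10 * (j10 * d0q01 + j11 * d1q01)) + (Y101 * j11 * q11 + j01 * Y111 * q11 +
    j01 * j11 * (j10 * d0q11 + j11 * d1q11)))) + ((g000 * x0 + g100 * x1) - (X00 + j00 * j00 * q00 +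
    j00 * j01 * q01 + j01 * j00 * q01 + j01 * j01 * q11)) * g011 - ((g001 * x0 + g101 * x1) - (X01 +
    j10 * j00 * q00 + j10 * j01 * q01 + j11 * j00 * q01 + j11 * j01 * q11)) * g001 + ((g001 * x0 +
    g101 * x1) - (X01 + j00 * j10 * q00 + j00 * j11 * q01 + j01 * j10 * q01 + j01 * j11 * q11)) *
    g111 - ((g011 * x0 + g111 * x1) - (X11 + j10 * j10 * q00 + j10 * j11 * q01 + j11 * j10 * q01 +
    j11 * j11 * q11)) * g101 + j00 * q00 * ((g011 * j00 + g111 * j10) - (Y011 + j10 * j10 * r000 +
    j10 * j11 * r001 + j11 * j10 * r001 + j11 * j11 * r011)) - j10 * q00 * ((g001 * j00 + g101 *
    j10) - (Y001 + j00 * j10 * r000 + j00 * j11 * r001 + j01 * j10 * r001 + j01 * j11 * r011)) + j00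
    * q01 * ((g011 * j01 + g111 * j11) - (Y111 + j10 * j10 * r100 + j10 * j11 * r101 + j11 * j10 *
    r101 + j11 * j11 * r111)) - j10 * q01 * ((g001 * j01 + g101 * j11) - (Y101 + j00 * j10 * r100 +
    j00 * j11 * r101 + j01 * j10 * r101 + j01 * j11 * r111)) + j01 * q01 * ((g011 * j00 + g111 *
    j10) - (Y011 + j10 * j10 * r000 + j10 * j11 * r001 + j11 * j10 * r001 + j11 * j11 * r011)) - j11
    * q01 * ((g001 * j00 + g101 * j10) - (Y001 + j00 * j10 * r000 + j00 * j11 * r001 + j01 * j10 *
    r001 + j01 * j11 * r011)) + j01 * q11 * ((g011 * j01 + g111 * j11) - (Y111 + j10 * j10 * r100 +
    j10 * j11 * r101 + j11 * j10 * r101 + j11 * j11 * r111)) - j11 * q11 * ((g001 * j01 + g101 *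
    j11) - (Y101 + j00 * j10 * r100 + j00 * j11 * r101 + j01 * j10 * r101 + j01 * j11 * r111)));
    first by ring.
by rewrite a00 a01 a11 b001 b011 b101 b111 d011 d101; ring.
Qed.

Section ChangeOfCoordinates.
Context {S S' : comUnitRingType} (d : dfam S 2) (d' : dfam S' 2) (kappa : {rmorphism S' -> S}).
Variables (J : 'M[S]_2) (G : 'M[S]_2) (H : 'M[S']_2).
Hypothesis d_kappa : forall k f, d k (kappa f) = J k 0 * kappa (d' 0 f) + J k 1 * kappa (d' 1 f).
Hypothesis dJ : forall i k a, d i (J k a) = d k (J i a).
Hypotheses (uJ : J \in unitmx) (uG : G \in unitmx) (uH : H \in unitmx).
Hypothesis sH : forall a b, H a b = H b a.
Hypothesis u2 : (2 : S') \is a GRing.unit.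
Hypothesis GE : forall i j, G i j =
  J i 0 * kappa (H 0 0) * J j 0 + J i 0 * kappa (H 0 1) * J j 1
  + (J i 1 * kappa (H 0 1) * J j 0 + J i 1 * kappa (H 1 1) * J j 1).

Local Notation h a b := (kappa (H a b)).
Local Notation q a c e := (kappa (chr d' H a c e)).
Local Notation L i j a := (d i (J j a) + J i 0 * J j 0 * q a 0 0 + J i 0 * J j 1 * q a 0 1
  + J i 1 * J j 0 * q a 0 1 + J i 1 * J j 1 * q a 1 1).

Let u2S : (2 : S) \is a GRing.unit.
Proof. by rewrite -(rmorph_nat kappa 2) rmorph_unit. Qed.

Let chl2 a c e : 2 * (h a 0 * q 0 c e + h a 1 * q 1 c e) =
  kappa (d' c (H e a)) + kappa (d' e (H c a)) - kappa (d' a (H c e)).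
Proof.
have := congr1 kappa (chlE d' uH sH a c e); rewrite big_ord2 rmorphD (rmorphM _ (H a 0)) (rmorphM _ (H a 1)).
move=> <-; rewrite -(rmorph_nat kappa 2) -rmorphM /chl mulVKr //.
by rewrite rmorphB rmorphD.
Qed.

Let dGE i j l : d i (G j l) =
  d i (J j 0) * h 0 0 * J l 0 + J j 0 * h 0 0 * d i (J l 0)
    + J j 0 * J l 0 * (J i 0 * kappa (d' 0 (H 0 0)) + J i 1 * kappa (d' 1 (H 0 0)))
  + (d i (J j 0) * h 0 1 * J l 1 + J j 0 * h 0 1 * d i (J l 1)
    + J j 0 * J l 1 * (J i 0 * kappa (d' 0 (H 0 1)) + J i 1 * kappa (d' 1 (H 0 1))))
  + (d i (J j 1) * h 0 1 * J l 0 + J j 1 * h 0 1 * d i (J l 0)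
    + J j 1 * J l 0 * (J i 0 * kappa (d' 0 (H 0 1)) + J i 1 * kappa (d' 1 (H 0 1))))
  + (d i (J j 1) * h 1 1 * J l 1 + J j 1 * h 1 1 * d i (J l 1)
    + J j 1 * J l 1 * (J i 0 * kappa (d' 0 (H 1 1)) + J i 1 * kappa (d' 1 (H 1 1)))).
Proof.
have dp x y z : d i (x * y * z) = d i x * y * z + x * y * d i z + x * z * d i y.
  by rewrite (dvM d i (x * y)) (dvM d i x y); ring.
by rewrite GE (dvD d i (_ + _)) !(dvD d i (_ * _ * _)) !dp !d_kappa; ring.
Qed.

(** The transformation law of the Christoffel symbols. Here [kappa] is composition with the
    coordinate change, J is its Jacobian, [d_kappa] the chain rule and [dJ] the symmetry of its
    second derivatives. *)
Lemma chr_change i j a : chr d G 0 i j * J 0 a + chr d G 1 i j * J 1 a = L i j a.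
Proof.
(* X is the right-hand side contracted with the inverse Jacobian; it remains to see that X, lowered
   by G, is given by the derivatives of G as the Christoffel symbols are. *)
set E := invmx J; pose X k := L i j 0 * E 0 k + L i j 1 * E 1 k.
have XJ b : X 0 * J 0 b + X 1 * J 1 b = L i j b.
  have e c : E c 0 * J 0 b + E c 1 * J 1 b = (c == b)%:R.
    by have := congr1 (fun N : 'M[S]_2 => N c b) (mulVmx uJ); rewrite !mxE big_ord2.
  rewrite /X; transitivity (L i j 0 * (E 0 0 * J 0 b + E 0 1 * J 1 b) + L i j 1 * (E 1 0 * J 0 b + E 1 1 * J 1 b)).
    by move: (L i j 0) (L i j 1) => x y; ring.
  by rewrite !e; have [->|->] := ord2P b; rewrite mulr1 mulr0 ?addr0 ?add0r.
suff chrX k : chr d G k i j = X k by rewrite !chrX XJ.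
rewrite chrE -(invmx_solve uG X k); apply: eq_bigr => l _; congr (_ * _).
rewrite big_ord2 /chl.
apply: (mulrI u2S); rewrite mulVKr //.
have -> : G l 0 * X 0 + G l 1 * X 1 =
    J l 0 * h 0 0 * L i j 0 + J l 0 * h 0 1 * L i j 1 + J l 1 * h 0 1 * L i j 0 + J l 1 * h 1 1 * L i j 1.
  rewrite -(XJ 0) -(XJ 1) !GE; clearbody X.
  by move: (J l 0) (J l 1) (J 0 0) (J 0 1) (J 1 0) (J 1 1) (X 0) (X 1) (h 0 0) (h 0 1) (h 1 1) => *; ring.
have := chl2 0 0 0; have := chl2 0 0 1; have := chl2 0 1 1.
have := chl2 1 0 0; have := chl2 1 0 1; have := chl2 1 1 1.
rewrite !dGE (sH 1 0) (dJ j i 0) (dJ j i 1) (dJ l i 0) (dJ l i 1) (dJ l j 0) (dJ l j 1) => e111 e101 e100 e011 e001 e000.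
have := frame_christoffel (d i (J j 0)) (d i (J j 1)) (d i (J l 0)) (d i (J l 1)) (d j (J l 0)) (d j (J l 1))
  (J i 0) (J i 1) (J j 0) (J j 1) (J l 0) (J l 1) e000 e001 e011 e100 e101 e111.
by move=> e; rewrite -e; congr (_ * _); ring.
Qed.

Let sG i j : G i j = G j i.
Proof. by rewrite !GE; ring. Qed.

(** Two derivatives of [chr_change] are subtracted; the third derivatives of the coordinate change,
    [d 0 (d 1 (J 1 a))] in both, cancel. *)
Lemma rup_change a : rup d G 0 1 0 1 * J 0 a + rup d G 1 1 0 1 * J 1 a =
  (J 0 0 * J 1 1 - J 0 1 * J 1 0) *
  (J 1 0 * kappa (rup d' H a 0 0 1) + J 1 1 * kappa (rup d' H a 1 0 1)).
Proof.
have dp k x y z : d k (x * y * z) = d k x * y * z + x * d k y * z + x * y * d k z.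
  by rewrite (dvM d k (x * y)) (dvM d k x y); ring.
have ds k x y z t u : d k (x + y + z + t + u) = d k x + d k y + d k z + d k t + d k u.
  by rewrite !dvD.
have dc k i j : d k (chr d G 0 i j) * J 0 a + chr d G 0 i j * d k (J 0 a)
   + (d k (chr d G 1 i j) * J 1 a + chr d G 1 i j * d k (J 1 a)) =
   d k (d i (J j a))
   + (d k (J i 0) * J j 0 * q a 0 0 + J i 0 * d k (J j 0) * q a 0 0
      + J i 0 * J j 0 * (J k 0 * kappa (d' 0 (chr d' H a 0 0)) + J k 1 * kappa (d' 1 (chr d' H a 0 0))))
   + (d k (J i 0) * J j 1 * q a 0 1 + J i 0 * d k (J j 1) * q a 0 1
      + J i 0 * J j 1 * (J k 0 * kappa (d' 0 (chr d' H a 0 1)) + J k 1 * kappa (d' 1 (chr d' H a 0 1))))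
   + (d k (J i 1) * J j 0 * q a 0 1 + J i 1 * d k (J j 0) * q a 0 1
      + J i 1 * J j 0 * (J k 0 * kappa (d' 0 (chr d' H a 0 1)) + J k 1 * kappa (d' 1 (chr d' H a 0 1))))
   + (d k (J i 1) * J j 1 * q a 1 1 + J i 1 * d k (J j 1) * q a 1 1
      + J i 1 * J j 1 * (J k 0 * kappa (d' 0 (chr d' H a 1 1)) + J k 1 * kappa (d' 1 (chr d' H a 1 1)))).
  have := congr1 (d k) (chr_change i j a).
  by rewrite (dvD d k (chr d G 0 i j * _)) (dvM d k (chr d G 0 i j)) (dvM d k (chr d G 1 i j)) ds !dp !d_kappa.
have d011 := dc 0 1 1; have d101 := dc 1 0 1.
move: d101; rewrite (dJ 1 0) (dJ 1 0 0) (dJ 1 0 1) (dvC d 1 0) => d101.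
have rupE m : rup d G m 1 0 1 = d 0 (chr d G m 1 1) - d 1 (chr d G m 0 1)
   + (chr d G m 0 0 * chr d G 0 1 1 - chr d G m 0 1 * chr d G 0 0 1
     + (chr d G m 0 1 * chr d G 1 1 1 - chr d G m 1 1 * chr d G 1 0 1)).
  by rewrite /rup big_ord2 (chrC d sG m 1 0).
have krup b : kappa (rup d' H a b 0 1) = kappa (d' 0 (chr d' H a 1 b)) - kappa (d' 1 (chr d' H a 0 b))
   + (q a 0 0 * q 0 1 b - q a 0 1 * q 0 0 b + (q a 0 1 * q 1 1 b - q a 1 1 * q 1 0 b)).
  rewrite /rup big_ord2 (chrC d' sH a 1 0) !rmorphD !rmorphN.
  by rewrite (rmorphM _ (chr d' H a 0 0)) !(rmorphM _ (chr d' H a 0 1)) (rmorphM _ (chr d' H a 1 1)).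
rewrite !rupE !krup (chrC d' sH a 1 0) !(chrC d' sH _ 1 0).
by apply: (@frame_curvature S (d 0 (chr d G 0 1 1)) (d 0 (chr d G 1 1 1)) (d 1 (chr d G 0 0 1)) (d 1
    (chr d G 1 0 1)) (d 0 (J 0 a)) (d 0 (J 1 a)) (d 1 (J 1 a)) (d 0 (J 1 0)) (d 1 (J 1 0)) (d 0 (J 1
    1)) (d 1 (J 1 1)) (d 0 (d 1 (J 1 a))) (kappa (d' 0 (chr d' H a 0 0))) (kappa (d' 0 (chr d' H a 0
    1))) (kappa (d' 0 (chr d' H a 1 1))) (kappa (d' 1 (chr d' H a 0 0))) (kappa (d' 1 (chr d' H a 0
    1))) (kappa (d' 1 (chr d' H a 1 1))) (chr d G 0 0 0) (chr d G 0 0 1) (chr d G 0 1 1) (chr d G 1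
    0 0) (chr d G 1 0 1) (chr d G 1 1 1) (J 0 0) (J 0 1) (J 1 0) (J 1 1) (q a 0 0) (q a 0 1) (q a 1
    1) (q 0 0 0) (q 0 0 1) (q 0 1 1) (q 1 0 0) (q 1 0 1) (q 1 1 1) (J 0 a) (J 1 a)
  (chr_change 0 0 a) (chr_change 0 1 a) (chr_change 1 1 a)
  (chr_change 0 1 0) (chr_change 1 1 0) (chr_change 0 1 1) (chr_change 1 1 1)); exact: d011 || exact: d101.
Qed.

Let detE : \det G = \det J ^+ 2 * kappa (\det H).
Proof. by rewrite !det2 !GE rmorphB !rmorphM /= (sH 1 0); ring. Qed.

Let rieE2 : rie d G 0 1 0 1 = \det J ^+ 2 * kappa (rie d' H 0 1 0 1).
Proof.
have r0 b : rie d' H b b 0 1 = 0 by apply: (eqN0 u2); exact: rie_antisym.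
have kr b c : h b 0 * kappa (rup d' H 0 c 0 1) + h b 1 * kappa (rup d' H 1 c 0 1) = kappa (rie d' H b c 0 1).
  by rewrite /rie big_ord2 (rmorphD _ (H b 0 * _)) (rmorphM _ (H b 0)) (rmorphM _ (H b 1)).
have k00 := kr 0 0; have k01 := kr 0 1; have k10 := kr 1 0; have k11 := kr 1 1.
rewrite r0 rmorph0 in k00; rewrite r0 rmorph0 (sH 1 0) in k11.
rewrite (rie_antisym d' uH sH u2 1 0) rmorphN (sH 1 0) in k10.
have N0 := rup_change 0; have N1 := rup_change 1.
rewrite det2 /rie big_ord2 -/(rie d' H 0 1 0 1) !GE.
move: N0 N1 k00 k01 k10 k11.
move: (J 0 0) (J 0 1) (J 1 0) (J 1 1) (h 0 0) (h 0 1) (h 1 1) (kappa (rie d' H 0 1 0 1)).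
move: (rup d G 0 1 0 1) (rup d G 1 1 0 1) (kappa (rup d' H 0 0 0 1)) (kappa (rup d' H 0 1 0 1))
  (kappa (rup d' H 1 0 0 1)) (kappa (rup d' H 1 1 0 1)).
move=> p0 p1 r00 r01 r10 r11 a b c e x y z t N0 N1 k00 k01 k10 k11.
transitivity ((a * x + b * y) * (p0 * a + p1 * c) + (a * y + b * z) * (p0 * b + p1 * e)); first by ring.
rewrite N0 N1; transitivity ((a * e - b * c) *
   (a * (c * (x * r00 + y * r10) + e * (x * r01 + y * r11))
    + b * (c * (y * r00 + z * r10) + e * (y * r01 + z * r11)))); first by ring.
by rewrite k00 k01 k10 k11; ring.
Qed.

(** Both R_0101 and det G acquire the factor (det J)^2. *)
Lemma gau_change : gau d G = kappa (gau d' H).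
Proof.
have uDJ : \det J ^+ 2 \is a GRing.unit by rewrite unitrX.
have ukH : kappa (\det H) \is a GRing.unit by rewrite rmorph_unit.
rewrite /gau rieE2 detE rmorphM rmorphV // invrM // [_^-1 * _]mulrC mulrACA divrr // mul1r.
by [].
Qed.

End ChangeOfCoordinates.

(** * Charts and Jacobians *)

Section Charts.
Context {R : realType} {n : nat} {M : charted R n}.
Implicit Types i j : chart_index M.

Lemma chart_im_inv i x : is_chart i -> chart_im i x ->
  chart_dom i (chart_inv i x) /\ chart_map i (chart_inv i x) = x.
Proof. by case=> _ _ inv _ _ [p dp <-]; rewrite inv. Qed.

Lemma chart_inv_continuous i x : is_chart i -> chart_im i x -> {for x, continuous (chart_inv i)}.
Proof.
by case=> _ oi _ _; rewrite continuous_open_subspace // => c ix; apply: c; rewrite inE.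
Qed.

Lemma chart_map_continuous i p : is_chart i -> chart_dom i p -> {for p, continuous (chart_map i)}.
Proof.
by case=> od _ _ + _; rewrite continuous_open_subspace // => c ip; apply: c; rewrite inE.
Qed.

Lemma chart_image_open i (O : set M) : is_chart i -> open O ->
  open (chart_map i @` (chart_dom i `&` O)).
Proof.
move=> ci oO; rewrite openE => _ [p [ip Op] <-].
have [od oi inv _ _] := ci; have ix : chart_im i (chart_map i p) by exists p.
have c := chart_inv_continuous ci ix.
have nO : \forall y \near chart_map i p, O (chart_inv i y).
  by apply: c; rewrite inv //; apply: open_nbhs_nbhs.
have ni : \forall y \near chart_map i p, chart_im i y by apply: open_nbhs_nbhs.
near=> y; have iy : chart_im i y by near: y.
have [dy ey] := chart_im_inv ci iy.
by exists (chart_inv i y) => //; split => //; near: y.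
Unshelve. all: by end_near. Qed.
End Charts.

Lemma jacobian_entry (R : realType) m n (f : 'rV[R]_m -> 'rV[R]_n) x k a : differentiable f x ->
  jacobian f x k a = pderiv (fun y => f y 0 a) k x.
Proof.
by move=> df; rewrite /jacobian /lin1_mx mxE -pderiv_entry // /pderiv deriveE.
Qed.

Lemma sandwich2 (S : comNzRingType) (J K : 'M[S]_2) i j : K 1 0 = K 0 1 ->
  (J *m K *m J^T) i j = J i 0 * K 0 0 * J j 0 + J i 0 * K 0 1 * J j 1
    + (J i 1 * K 0 1 * J j 0 + J i 1 * K 1 1 * J j 1).
Proof. by move=> e; rewrite mxE big_ord2 !mxE !big_ord2 e; ring. Qed.

(** * Gaussian curvature under pullback *)

Section Pullback.
Context {R : realType} (D D' : odom R 2) (tau : 'rV[R]_2 -> 'rV[R]_2).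
Hypothesis tau_smooth : smooth_on (dom D) tau.
Hypothesis tauD : forall x, dom D x -> dom D' (tau x).

Fact comp_subproof (F : sfun D') : smooth_on (dom D) (F \o tau).
Proof.
move=> r; apply: (smooth_upto_comp (@dom_open _ _ D) (@dom_open _ _ D') tauD) (tau_smooth r).
exact: sfval_smooth.
Qed.
Definition sf_comp (F : sfun D') : sfun D := mksf (comp_subproof F).

Fact sf_comp_zmod : zmod_morphism sf_comp.
Proof.
move=> F G; apply: sfun_evP => x Dx; rewrite rmorphB /=.
rewrite /ev !mksfE //=; exact: (rmorphB (ev (tauD Dx)) F G).
Qed.
Fact sf_comp_monoid : monoid_morphism sf_comp.
Proof.
split=> [|F G]; apply: sfun_evP => x Dx.
  by rewrite rmorph1 /ev mksfE //=; exact: (rmorph1 (ev (tauD Dx))).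
by rewrite rmorphM /= /ev !mksfE //=; exact: (rmorphM (ev (tauD Dx)) F G).
Qed.
HB.instance Definition _ := GRing.isZmodMorphism.Build _ _ sf_comp sf_comp_zmod.
HB.instance Definition _ := GRing.isMonoidMorphism.Build _ _ sf_comp sf_comp_monoid.

Let tau_entry a r : smooth_upto r (dom D) (fun y => tau y 0 a).
Proof. exact: ((smooth_upto_mx (@dom_open _ _ D) r tau).2 (tau_smooth r) 0 a). Qed.

Variables (g g' : 'rV[R]_2 -> 'M[R]_2).
Hypotheses (smooth_g : smooth_on (dom D) g) (smooth_g' : smooth_on (dom D') g').
Hypothesis sym_g' : forall x, dom D' x -> forall i j, g' x i j = g' x j i.
Hypothesis sym_g : forall x, dom D x -> forall i j, g x i j = g x j i.
Hypothesis pos_g' : forall x, dom D' x -> forall v : 'rV[R]_2, v != 0 -> 0 < (v *m g' x *m v^T) 0 0.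
Hypothesis pos_g : forall x, dom D x -> forall v : 'rV[R]_2, v != 0 -> 0 < (v *m g x *m v^T) 0 0.
Hypothesis pull : forall x, dom D x -> g x = jacobian tau x *m g' (tau x) *m (jacobian tau x)^T.

(** [gau_change], with composition with [tau] as the ring morphism between the functions on the two
    domains. *)
Lemma gauss_pullback x : dom D x -> gauss g x = gauss g' (tau x).
Proof.
move=> Dx.
have sg i j : smooth_on (dom D) (fun y => g y i j).
  by move=> r; exact: ((smooth_upto_mx (@dom_open _ _ D) r g).2 (smooth_g r) i j).
have sg' i j : smooth_on (dom D') (fun y => g' y i j).
  by move=> r; exact: ((smooth_upto_mx (@dom_open _ _ D') r g').2 (smooth_g' r) i j).
have sJ k a : smooth_on (dom D) (pderiv (fun y => tau y 0 a) k).
  by move=> r; exact: (tau_entry a r.+1).2.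
pose G : 'M[sfun D]_2 := \matrix_(i, j) mksf (sg i j).
pose H : 'M[sfun D']_2 := \matrix_(i, j) mksf (sg' i j).
pose J : 'M[sfun D]_2 := \matrix_(k, a) mksf (sJ k a).
have rG i j : rep id (fun x => g x i j) (G i j) by move=> z Dz; rewrite mxE /ev mksfE.
have rH i j : rep id (fun x => g' x i j) (H i j) by move=> z Dz; rewrite mxE /ev mksfE.
have uG : G \in unitmx.
  apply/sf_unitP => z Dz; rewrite -[_ z]/(ev Dz (\det G)) -det_map_mx (ev_metric rG) -unitfE.
  by apply: posdef_unit; [exact: sym_g|exact: pos_g].
have uH : H \in unitmx.
  apply/sf_unitP => z Dz; rewrite -[_ z]/(ev Dz (\det H)) -det_map_mx (ev_metric rH) -unitfE.
  by apply: posdef_unit; [exact: sym_g'|exact: pos_g'].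
have sH a b : H a b = H b a by apply: sfun_evP => z Dz; rewrite -!(rH _ _ _ Dz) sym_g'.
have evJ z (Dz : dom D z) k a : ev Dz (J k a) = jacobian tau z k a.
  by rewrite mxE /ev mksfE // jacobian_entry //; exact: (tau_smooth 0).1.
have ev_comp z (Dz : dom D z) F : ev Dz (sf_comp F) = ev (tauD Dz) F by rewrite /ev mksfE.
have GE i j : G i j =
    J i 0 * sf_comp (H 0 0) * J j 0 + J i 0 * sf_comp (H 0 1) * J j 1
    + (J i 1 * sf_comp (H 0 1) * J j 0 + J i 1 * sf_comp (H 1 1) * J j 1).
  apply: sfun_evP => z Dz.
  have evF (a b c e h00 h01 h11 : sfun D) : ev Dz (a * h00 * c + a * h01 * e + (b * h01 * c + b * h11 * e)) =
      ev Dz a * ev Dz h00 * ev Dz c + ev Dz a * ev Dz h01 * ev Dz e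
      + (ev Dz b * ev Dz h01 * ev Dz c + ev Dz b * ev Dz h11 * ev Dz e).
    by rewrite !(rmorphD, rmorphM).
  rewrite evF !evJ !ev_comp -(rG i j z Dz) -!(rH _ _ _ (tauD Dz)).
  by rewrite (pull Dz) sandwich2 // sym_g' //; exact: tauD.
(* Invertibility of the Jacobian is read off from G = J H J^T, where G is invertible. *)
have uJ : J \in unitmx.
  have : G = J *m map_mx sf_comp H *m J^T.
    have mE a b : map_mx sf_comp H a b = sf_comp (H a b) by rewrite [LHS]mxE.
    by apply/matrixP => i j; rewrite sandwich2 !mE ?(sH 1 0) // GE.
  by move=> e; have := eq_ind _ (fun N => N \in unitmx) uG _ e; rewrite !unitmx_mul => /andP[/andP[]].
have dJ i k a : pdfam D id i (J k a) = pdfam D id k (J i a).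
  have Jd l b : J l b = pd l (mksf (fun r => tau_entry b r)).
    apply: sfun_evP => z Dz; rewrite mxE /ev !mksfE //.
    by apply: (pderiv_eq_on (@dom_open _ _ D)) Dz => y Dy; rewrite mksfE.
  by rewrite !Jd; exact: pdC.
have dk k F : pdfam D id k (sf_comp F) =
    J k 0 * sf_comp (pdfam D' id 0 F) + J k 1 * sf_comp (pdfam D' id 1 F).
  apply: sfun_evP => z Dz.
  have evF (a b c e : sfun D) : ev Dz (a * b + c * e) = ev Dz a * ev Dz b + ev Dz c * ev Dz e.
    by rewrite rmorphD !rmorphM.
  rewrite evF !evJ (ev_comp z Dz (pdfam D' id 0 F)) (ev_comp z Dz (pdfam D' id 1 F)).
  have -> : ev Dz (pdfam D id k (sf_comp F)) = pderiv (sf_comp F) k z by exact: mksfE.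
  rewrite (@pderiv_eq_on _ _ _ (@dom_open _ _ D) _ _ (F \o tau)) //; last by move=> y Dy; exact: mksfE.
  rewrite pderiv_comp; [|exact: (tau_smooth 0).1|exact: (sfval_smooth F 0).1 (tauD Dz)].
  have dt : differentiable tau z by exact: (tau_smooth 0).1.
  rewrite big_ord2 !jacobian_entry //.
  have -> : ev (tauD Dz) (pdfam D' id 0 F) = pderiv F 0 (tau z) by apply: mksfE; exact: tauD.
  have -> : ev (tauD Dz) (pdfam D' id 1 F) = pderiv F 1 (tau z) by apply: mksfE; exact: tauD.
  by congr (_ + _); rewrite mulrC.
have projE (y : 'rV[R]_2) k (h : R) : id (h *: delta_mx 0 (id k) + y) = h *: delta_mx 0 k + id y by [].
rewrite -[x in LHS]/(id x) (rep_gauss projE uG rG Dx) -[tau x]/(id (tau x)) (rep_gauss projE uH rH (tauD Dx)).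
by rewrite (gau_change dk dJ uJ uG uH sH (unit2 D') GE) ev_comp.
Qed.
End Pullback.

(** * Products of charted spaces *)

Lemma metric_entry_sym (R : realType) n (M : charted R n) (g : metric_comp M) i x : is_metric g ->
  chart_im i x -> forall a b, g i x a b = g i x b a.
Proof.
by case=> + _ => /(_ i)[_ s _] ix a b; rewrite -{1}(s _ ix) mxE.
Qed.

(* Needed because the Einstein and Weyl hypotheses may refer to different charts at the point. *)
Lemma gauss_chart (R : realType) (M : charted R 2) (g : metric_comp M) i j p :
  riemannian_manifold g -> chart_dom i p -> chart_dom j p ->
  gauss (g i) (chart_map i p) = gauss (g j) (chart_map j p).
Proof.
case=> [[_ [_ ch tr]] mg] ip jp; have [mgc pb] := mg.
have [oi oii invi _ _] := ch i; have [oj oij _ _ _] := ch j.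
have ne : (chart_map i @` (chart_dom i `&` chart_dom j)) (chart_map i p) by exists p.
pose D := Odom (chart_image_open (ch i) oj) (ex_intro _ _ ne).
pose D' : odom R 2 := Odom oij (ex_intro _ (chart_map j p) (ex_intro2 _ _ p jp erefl)).
have Dim x : dom D x -> chart_im i x by case=> q [iq _] <-; exists q.
have DD' x : dom D x -> dom D' ((chart_map j \o chart_inv i) x).
  by case=> q [iq jq] <-; rewrite /= invi //; exists q.
rewrite -[in RHS](invi _ ip) -[chart_map j _]/((chart_map j \o chart_inv i) (chart_map i p)).
apply: (@gauss_pullback R D D' (chart_map j \o chart_inv i) _ DD' (g i) (g j)) => //.
- exact: tr.
- by move=> r; have [sg _ _] := mgc i; exact: smooth_upto_subset Dim (sg r).
- by have [] := mgc j.
- by move=> x; exact: metric_entry_sym.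
- by move=> x /Dim; exact: metric_entry_sym.
- by have [] := mgc j.
- by move=> x /Dim; have [_ _ +] := mgc i; apply.
- move=> x [q [iq jq] <-]; apply: (pb i j); by exists q.
Qed.

Lemma smooth_row_mx (R : realType) m n p (D : set 'rV[R]_m) (f : 'rV[R]_m -> 'rV[R]_n) (g : 'rV[R]_m -> 'rV[R]_p) :
  open D -> smooth_on D f -> smooth_on D g -> smooth_on D (fun z => row_mx (f z) (g z)).
Proof.
move=> oD sf sg r; apply: (smooth_upto_mx oD r (fun z => row_mx (f z) (g z))).1 => i j; rewrite (ord1 i).
have [k ->|k ->] := split_ordP j.
  have -> : (fun y => row_mx (f y) (g y) 0 (lshift p k)) = (fun y => f y 0 k).
    by apply/funext => y; rewrite row_mxEl.
  exact: ((smooth_upto_mx oD r f).2 (sf r)).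
have -> : (fun y => row_mx (f y) (g y) 0 (rshift n k)) = (fun y => g y 0 k).
  by apply/funext => y; rewrite row_mxEr.
exact: ((smooth_upto_mx oD r g).2 (sg r)).
Qed.

Lemma smooth_comp (R : realType) m n p (D : set 'rV[R]_m) (D' : set 'rV[R]_n)
    (h : 'rV[R]_n -> 'rV[R]_p) (f : 'rV[R]_m -> 'rV[R]_n) :
  open D -> open D' -> (forall x, D x -> D' (f x)) ->
  smooth_on D' h -> smooth_on D f -> smooth_on D (h \o f).
Proof.
move=> oD oD' fD sh sf r; apply: (smooth_upto_mx oD r (h \o f)).1 => i j.
apply: (smooth_upto_comp (h := fun x => h x i j) oD oD' fD _ (sf r)).
exact: ((smooth_upto_mx oD' r h).2 (sh r)).
Qed.

Lemma open_setX (T U : topologicalType) (A : set T) (B : set U) : open A -> open B -> open (A `*` B).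
Proof.
move=> oA oB; rewrite openE => -[a b] [/= Aa Bb].
by exists (A, B) => //; split; apply: open_nbhs_nbhs.
Qed.

Lemma continuous_row_mx (R : realType) (T : topologicalType) m n (f : T -> 'rV[R]_m) (g : T -> 'rV[R]_n) x :
  {for x, continuous f} -> {for x, continuous g} ->
  {for x, continuous (fun t => row_mx (f t) (g t))}.
Proof.
move=> cf cg; apply/cvg_ballP => e e0.
have nf : \forall t \near x, ball (f x) e (f t) by move/cvg_ballP: cf; exact.
have ng : \forall t \near x, ball (g x) e (g t) by move/cvg_ballP: cg; exact.
by near=> t; apply/ball_box; rewrite !row_mxKl !row_mxKr; split; near: t.
Unshelve. all: by end_near. Qed.

Lemma block_sandwich (S : comNzRingType) m n (A G : 'M[S]_m) (B H : 'M[S]_n) :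
  block_mx A 0 0 B *m block_mx G 0 0 H *m (block_mx A 0 0 B)^T =
  block_mx (A *m G *m A^T) 0 0 (B *m H *m B^T).
Proof.
by rewrite tr_block_mx !trmx0 !mulmx_block !(mulmx0, mul0mx, addr0, add0r).
Qed.

Section ProductCharts.
Context {R : realType} {Mh Mt : charted R 2}.
Hypotheses (ch : forall i : chart_index Mh, is_chart i) (ct : forall i : chart_index Mt, is_chart i).
Hypothesis trh : forall i j : chart_index Mh,
  smooth_on (chart_map i @` (chart_dom i `&` chart_dom j)) (chart_map j \o chart_inv i).
Hypothesis trt : forall i j : chart_index Mt,
  smooth_on (chart_map i @` (chart_dom i `&` chart_dom j)) (chart_map j \o chart_inv i).
Local Notation M := (prod_charted Mh Mt).
Implicit Types I J : chart_index M.

Lemma prod_chart_im I z : chart_im I z <-> chart_im I.1 (lsubmx z) /\ chart_im I.2 (rsubmx z).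
Proof.
split=> [[p [p1 p2] <-]|[[p1 d1 e1] [p2 d2 e2]]].
  by rewrite row_mxKl row_mxKr; split; [exists p.1|exists p.2].
by exists (p1, p2) => //=; rewrite e1 e2 hsubmxK.
Qed.

Lemma prod_transition_dom I J : chart_map I @` (chart_dom I `&` chart_dom J) =
  [set z | (chart_map I.1 @` (chart_dom I.1 `&` chart_dom J.1)) (lsubmx z) /\
           (chart_map I.2 @` (chart_dom I.2 `&` chart_dom J.2)) (rsubmx z)].
Proof.
apply/seteqP; split=> z /=.
  by case=> p [[a1 a2] [b1 b2]] <-; rewrite row_mxKl row_mxKr; split; [exists p.1|exists p.2].
by case=> [[p1 [a1 a2] e1] [p2 [b1 b2] e2]]; exists (p1, p2) => //=; rewrite e1 e2 hsubmxK.
Qed.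

Lemma prod_is_chart I : is_chart I.
Proof.
have [oh oih invh _ _] := ch I.1; have [ot oit invt _ _] := ct I.2.
have od : open (chart_dom (c := M) I) by exact: open_setX.
have oi : open (chart_im I).
  have -> : chart_im I = [set z | chart_im I.1 (lsubmx z) /\ chart_im I.2 (rsubmx z)].
    by apply/seteqP; split => z /prod_chart_im.
  exact: open_preim_box.
split=> //.
- by move=> [p1 p2] [/= d1 d2]; rewrite /= row_mxKl row_mxKr invh // invt.
- rewrite continuous_open_subspace // => -[p1 p2]; rewrite inE /= => -[/= d1 d2].
  have c1 := chart_map_continuous (ch I.1) d1; have c2 := chart_map_continuous (ct I.2) d2.
  apply: (@continuous_row_mx R (Mh * Mt)%type 2 2 (fun q => chart_map I.1 q.1) (fun q => chart_map I.2 q.2) (p1, p2)).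
    by apply: (@continuous_comp _ _ _ fst (chart_map I.1)) => //; exact: cvg_fst.
  by apply: (@continuous_comp _ _ _ snd (chart_map I.2)) => //; exact: cvg_snd.
- rewrite continuous_open_subspace // => z; rewrite inE => /prod_chart_im[z1 z2].
  have c1 : {for z, continuous (chart_inv I.1 \o @lsubmx R 1 2 2)}.
    apply: continuous_comp; last exact: chart_inv_continuous.
    exact: (smooth_continuous (smooth_lsub setT)).
  have c2 : {for z, continuous (chart_inv I.2 \o @rsubmx R 1 2 2)}.
    apply: continuous_comp; last exact: chart_inv_continuous.
    exact: (smooth_continuous (smooth_rsub setT)).
  exact: (cvg_pair c1 c2).
Qed.

Lemma prod_transition_smooth I J :
  smooth_on (chart_map I @` (chart_dom I `&` chart_dom J)) (chart_map J \o chart_inv I).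
Proof.
have [oh _ _ _ _] := ch J.1; have [ot _ _ _ _] := ct J.2.
have o1 := chart_image_open (ch I.1) oh; have o2 := chart_image_open (ct I.2) ot.
rewrite prod_transition_dom; set D := [set z | _]; have oD : open D by exact: open_preim_box.
apply: smooth_row_mx => //.
- apply: (@smooth_comp _ _ _ _ _ _ (chart_map J.1 \o chart_inv I.1) (@lsubmx R 1 2 2) oD o1) => //.
  + by move=> z [].
  + exact: smooth_lsub.
- apply: (@smooth_comp _ _ _ _ _ _ (chart_map J.2 \o chart_inv I.2) (@rsubmx R 1 2 2) oD o2) => //.
  + by move=> z [].
  + exact: smooth_rsub.
Qed.

Variables (gh : metric_comp Mh) (gt : metric_comp Mt) (psi : M -> R).
Hypotheses (ph : pullback_on [set: Mh] idfun gh gh) (pt : pullback_on [set: Mt] idfun gt gt).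

Lemma pderiv_lsub (f : 'rV[R]_2 -> R) (z : 'rV[R]_(2 + 2)) k :
  pderiv (fun y => f (lsubmx y)) (lshift 2 k) z = pderiv f k (lsubmx z).
Proof.
have E : (fun h : R => h^-1 *: (((fun y => f (lsubmx y)) \o shift z) (h *: (delta_mx 0 (lshift 2 k) : 'rV[R]_(2 + 2))) - f (lsubmx z))) =
  (fun h : R => h^-1 *: ((f \o shift (lsubmx z)) (h *: delta_mx 0 k) - f (lsubmx z))).
  by apply/funext => h /=; rewrite lsub_lshift.
by rewrite /pderiv /derive E.
Qed.

Lemma pderiv_rsub (f : 'rV[R]_2 -> R) (z : 'rV[R]_(2 + 2)) k :
  pderiv (fun y => f (rsubmx y)) (rshift 2 k) z = pderiv f k (rsubmx z).
Proof.
have E : (fun h : R => h^-1 *: (((fun y => f (rsubmx y)) \o shift z) (h *: (delta_mx 0 (rshift 2 k) : 'rV[R]_(2 + 2))) - f (rsubmx z))) =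
  (fun h : R => h^-1 *: ((f \o shift (rsubmx z)) (h *: delta_mx 0 k) - f (rsubmx z))).
  by apply/funext => h /=; rewrite rsub_rshift.
by rewrite /pderiv /derive E.
Qed.

Lemma prod_jacobian (t1 t2 : 'rV[R]_2 -> 'rV[R]_2) (z : 'rV[R]_(2 + 2)) :
  differentiable t1 (lsubmx z) -> differentiable t2 (rsubmx z) ->
  differentiable (fun z : 'rV[R]_(2 + 2) => row_mx (t1 (lsubmx z)) (t2 (rsubmx z))) z ->
  jacobian (fun z => row_mx (t1 (lsubmx z)) (t2 (rsubmx z))) z =
  block_mx (jacobian t1 (lsubmx z)) 0 0 (jacobian t2 (rsubmx z)).
Proof.
move=> d1 d2 d12; apply/matrixP => i j; rewrite jacobian_entry //.
have el k : (fun y : 'rV[R]_(2 + 2) => row_mx (t1 (lsubmx y)) (t2 (rsubmx y)) 0 (lshift 2 k)) =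
    (fun y => t1 (lsubmx y) 0 k) by apply/funext => y; rewrite row_mxEl.
have er k : (fun y : 'rV[R]_(2 + 2) => row_mx (t1 (lsubmx y)) (t2 (rsubmx y)) 0 (rshift 2 k)) =
    (fun y => t2 (rsubmx y) 0 k) by apply/funext => y; rewrite row_mxEr.
have [a ->|a ->] := split_ordP i; have [b ->|b ->] := split_ordP j; rewrite ?el ?er.
- by rewrite block_mxEul jacobian_entry // (pderiv_lsub (fun x => t1 x 0 b)).
- by rewrite block_mxEur mxE; apply: pderiv_indep => h; rewrite rsub_lshift.
- by rewrite block_mxEdl mxE; apply: pderiv_indep => h; rewrite lsub_rshift.
- by rewrite block_mxEdr jacobian_entry // (pderiv_rsub (fun x => t2 x 0 b)).
Qed.

(** The Jacobian of a transition map is block diagonal, so each factor transforms by its own law;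
    the conformal factor is a function on the manifold and has the same value in both charts. *)
Lemma prod_pullback : pullback_on [set: M] idfun (conformal_prod gh gt psi) (conformal_prod gh gt psi).
Proof.
move=> I J z [[p1 p2] [[_ [d1 d2]] [e1 e2]] <-] f.
rewrite /= in d1 d2 e1 e2.
have [_ _ invI1 _ _] := ch I.1; have [_ _ invI2 _ _] := ct I.2.
have [_ _ invJ1 _ _] := ch J.1; have [_ _ invJ2 _ _] := ct J.2.
set x := chart_map I.1 p1; set y := chart_map I.2 p2; set zz := row_mx x y.
pose t1 := chart_map J.1 \o chart_inv I.1; pose t2 := chart_map J.2 \o chart_inv I.2.
have dd1 : differentiable t1 x by apply: (trh _ _ 0).1; exists p1.
have dd2 : differentiable t2 y by apply: (trt _ _ 0).1; exists p2.
have fE : f = fun z => row_mx (t1 (lsubmx z)) (t2 (rsubmx z)) by [].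
have df : differentiable f zz.
  by apply: (prod_transition_smooth I J 0).1; exists (p1, p2).
have jE : jacobian f zz = block_mx (jacobian t1 x) 0 0 (jacobian t2 y).
  by rewrite fE prod_jacobian /zz ?row_mxKl ?row_mxKr // -/zz -fE.
have pE1 : gh I.1 x = jacobian t1 x *m gh J.1 (t1 x) *m (jacobian t1 x)^T by apply: ph; exists p1.
have pE2 : gt I.2 y = jacobian t2 y *m gt J.2 (t2 y) *m (jacobian t2 y)^T by apply: pt; exists p2.
have fz : f zz = row_mx (t1 x) (t2 y) by rewrite fE /zz row_mxKl row_mxKr.
rewrite jE /conformal_prod fz /zz !row_mxKl !row_mxKr.
have -> : chart_inv (c := M) I (row_mx x y) = (p1, p2).
  by rewrite /= row_mxKl row_mxKr /x /y invI1 // invI2.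
have -> : chart_inv (c := M) J (row_mx (t1 x) (t2 y)) = (p1, p2).
  by rewrite /= row_mxKl row_mxKr /t1 /t2 /x /y /= invI1 // invI2 // invJ1 // invJ2.
rewrite -scalemxAr -scalemxAl; congr (_ *: _).
by rewrite block_sandwich -pE1 -pE2.
Qed.
End ProductCharts.

(** * The ball as a manifold *)

Lemma row_second_countable (R : realType) n : @second_countable 'rV[R]_n.
Proof.
pose b (p : 'rV[rat]_n * rat) : set 'rV[R]_n := ball (map_mx (ratr : rat -> R) p.1 : 'rV[R]_n) (ratr p.2).
exists (range b).
  by apply: card_le_trans (card_image_le _ _) _; exact: countableP.
split=> [_ [p _ <-]|x A /nbhs_ballP[e /= e0 xA]]; first exact: ball_open.
(* With s < e / 2 and a rational center at distance less than s from x, the ball of radius s around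
   the center contains x and lies in the ball of radius e around x. *)
have [s] := rat_in_itvoo (divr_gt0 e0 (ltr0n R 2)); rewrite in_itv /= => /andP[s0 se].
have [q qP] : exists q : 'rV[rat]_n, forall k, `|ratr (q 0 k) - x 0 k| < ratr s :> R.
  have ex k : exists q : rat, `|ratr q - x 0 k| < ratr s :> R.
    have lt : x 0 k < x 0 k + ratr s by rewrite ltrDl.
    have [q] := rat_in_itvoo lt.
    rewrite in_itv /= => /andP[q1 q2]; exists q.
    by rewrite ger0_norm ?subr_ge0 1?ltW // ltrBlDr addrC.
  exists (\row_k projT1 (cid (ex k))) => k; rewrite mxE; exact: projT2 (cid (ex k)).
exists (b (q, s)); last first.
  move=> y /ball_rowP[_ h]; apply: xA; apply/ball_rowP; split => // k.
  have := h k; rewrite mxE /= => hk; have := qP k; rewrite distrC => hq.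
  have -> : x 0 k - y 0 k = (x 0 k - ratr (q 0 k)) + (ratr (q 0 k) - y 0 k) by ring.
  apply: le_lt_trans (ler_normD _ _) _; rewrite ltr_pdivlMr // in se; lra.
split; first by exists (q, s).
by apply/ball_rowP; split => // k; rewrite mxE /=.
Qed.

(** The space is the union of the segments issuing from 0. *)
Lemma row_connected (R : realType) n : connected [set: 'rV[R]_n].
Proof.
have -> : [set: 'rV[R]_n] = \bigcup_(v in [set: 'rV[R]_n]) ((fun t : R => t *: v) @` `[0, 1]).
  apply/seteqP; split=> v // _; exists v => //; exists 1; rewrite ?scale1r //=.
  by rewrite in_itv /= ler01 lexx.
apply: bigcup_connected.
  by exists 0 => v _; exists 0; rewrite ?scale0r //= in_itv /= lexx ler01.
move=> v _; apply: connected_continuous_connected; first exact: segment_connected.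
by apply: continuous_subspaceT => t; exact: scalel_continuous.
Qed.

Section Disc.
Context {R : realType} (x0 : 'rV[R]_2) (r : R).
Hypothesis r0 : 0 < r.

(* A homeomorphism of the plane onto the ball. Being the only chart, it need not be smooth. *)
Definition disc_map (v : 'rV[R]_2) : 'rV[R]_2 := x0 + (r / (1 + `|v|)) *: v.
Definition disc_inv (x : 'rV[R]_2) : 'rV[R]_2 := (r - `|x - x0|)^-1 *: (x - x0).

Let ballE x : ball x0 r x = (`|x - x0| < r) :> Prop.
Proof. by rewrite mx_norm_ball /ball_ /= distrC. Qed.

Let n1 (v : 'rV[R]_2) : 0 < 1 + `|v|.
Proof. by rewrite ltr_pwDl. Qed.

Let disc_norm v : `|disc_map v - x0| = r * `|v| / (1 + `|v|).
Proof.
rewrite /disc_map addrAC subrr add0r normrZ ger0_norm; first by rewrite mulrAC.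
by rewrite divr_ge0 // ltW.
Qed.

Lemma disc_map_ball v : ball x0 r (disc_map v).
Proof.
by rewrite ballE disc_norm ltr_pdivrMr // ltr_pM2l // ltrDr.
Qed.

Lemma disc_mapK v : disc_inv (disc_map v) = v.
Proof.
rewrite /disc_inv disc_norm /disc_map addrAC subrr add0r scalerA.
have n0 : 1 + `|v| != 0 by rewrite gt_eqF.
have -> : r - r * `|v| / (1 + `|v|) = r / (1 + `|v|) by field.
by rewrite mulVf ?scale1r // mulf_neq0 ?invr_neq0 // gt_eqF.
Qed.

Lemma disc_invK x : ball x0 r x -> disc_map (disc_inv x) = x.
Proof.
rewrite ballE => xr; have rx : 0 < r - `|x - x0| by rewrite subr_gt0.
rewrite /disc_map /disc_inv normrZ ger0_norm ?invr_ge0 ?ltW // scalerA.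
have n0 : r - `|x - x0| != 0 by rewrite gt_eqF.
have -> : r / (1 + (r - `|x - x0|)^-1 * `|x - x0|) / (r - `|x - x0|) = 1.
  field; rewrite n0 /= -[X in X != 0]/(_ + _) subrK.
  by rewrite gt_eqF.
by rewrite scale1r addrC subrK.
Qed.

Lemma disc_map_continuous : continuous disc_map.
Proof.
move=> v.
have c1 : {for v, continuous (fun u : 'rV[R]_2 => (1 : R) + `|u|)}.
  by apply: (@continuousD R R _ (fun=> 1) (fun u => `|u|) v); [exact: cst_continuous|exact: norm_continuous].
have c2 : {for v, continuous (fun u : 'rV[R]_2 => (1 + `|u|)^-1)}.
  by apply: (continuousV _ c1); rewrite gt_eqF.
have c3 : {for v, continuous (fun u : 'rV[R]_2 => r / (1 + `|u|))}.
  by apply: (@continuousM R _ (fun=> r) (fun u => (1 + `|u|)^-1) v) c2; exact: cst_continuous.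
have c4 : {for v, continuous (fun u : 'rV[R]_2 => (r / (1 + `|u|)) *: u)}.
  by apply: (continuousZ c3); exact: cvg_id.
apply: (@continuousD R 'rV[R]_2 _ (fun=> x0) (fun u => (r / (1 + `|u|)) *: u) v) => //.
exact: cst_continuous.
Qed.

Lemma disc_inv_continuous (x : 'rV[R]_2) : ball x0 r x -> {for x, continuous disc_inv}.
Proof.
rewrite ballE => xr; have c : {for x, continuous (fun y : 'rV[R]_2 => y - x0)}.
  apply: (@continuousB R 'rV[R]_2 _ (fun y => y) (fun=> x0) x); last exact: cst_continuous.
  exact: cvg_id.
have cn : {for x, continuous (fun y : 'rV[R]_2 => `|y - x0|)}.
  by apply: (@continuous_comp _ _ _ (fun y : 'rV[R]_2 => y - x0) (fun u : 'rV[R]_2 => `|u|)) => //; exact: norm_continuous.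
have c1 : {for x, continuous (fun y : 'rV[R]_2 => r - `|y - x0|)}.
  by apply: (@continuousB R R _ (fun=> r) (fun y : 'rV[R]_2 => `|y - x0|) x); [exact: cst_continuous|exact: cn].
have c2 : {for x, continuous (fun y : 'rV[R]_2 => (r - `|y - x0|)^-1)}.
  by apply: (continuousV _ c1); rewrite subr_eq0 gt_eqF.
exact: (continuousZ c2 c).
Qed.

(** The ball as a manifold. Its points are those of the plane, whose topology is Hausdorff, second
    countable and connected; the single chart has the ball as its image, so functions and metrics on
    the ball are chart expressions as they stand. *)
Definition disc : charted R 2 :=
  {| carrier := 'rV[R]_2 : topologicalType;
     chart_index := unit;
     chart_dom := fun _ => setT;
     chart_map := fun _ => disc_map;
     chart_inv := fun _ => disc_inv |}.

Lemma disc_chart_im (i : chart_index disc) : chart_im i = ball x0 r.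
Proof.
apply/seteqP; split=> [_ [v _ <-]|x xr]; first exact: disc_map_ball.
by exists (disc_inv x) => //; exact: disc_invK.
Qed.

Lemma disc_manifold : is_manifold disc.
Proof.
split.
  split; [exact: norm_hausdorff|exact: row_second_countable|exact: row_connected].
have oi i : open (chart_im (M := disc) i) by rewrite disc_chart_im; exact: ball_open.
split=> [p|i|i j]; first by exists tt.
- split=> //.
  + exact: openT.
  + by move=> p _; exact: disc_mapK.
  + by apply: continuous_subspaceT; exact: disc_map_continuous.
  + rewrite continuous_open_subspace // => x; rewrite inE disc_chart_im.
    exact: disc_inv_continuous.
- move=> k; have -> : chart_map i @` (chart_dom i `&` chart_dom j) = ball x0 r.
    by rewrite -(disc_chart_im i) /chart_im setIT.
  apply: (@smooth_upto_eq _ _ _ (@ball_open _ _ x0 r) _ k (fun y => \row_j y 0 (id j))).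
    move=> y yr; rewrite [RHS]disc_invK //.
    by apply/rowP => l; rewrite mxE.
  exact: smooth_rows.
Qed.

Lemma jacobian_id (f : 'rV[R]_2 -> 'rV[R]_2) (D : set 'rV[R]_2) x : open D ->
  (forall y, D y -> f y = y) -> D x -> jacobian f x = 1%:M.
Proof.
move=> oD fD Dx.
have df : differentiable f x.
  by apply: (@differentiable_near _ _ _ (fun y => y)) => //; apply: open_near_eq oD _ Dx => y /fD.
apply/matrixP => k a; rewrite jacobian_entry //.
rewrite (@pderiv_eq_on _ _ _ oD _ _ (fun y => y 0 a)) //; last by move=> y /fD ->.
rewrite -(@pderiv_entry _ _ _ _ (fun y : 'rV[R]_2 => y)) // /pderiv derive_id !mxE eqxx.
by rewrite eq_sym.
Qed.

(** The only transition map is the identity on the ball, so the transformation law holds for every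
    choice of components. *)
Lemma disc_metric (g : 'rV[R]_2 -> 'M[R]_2) : smooth_on (ball x0 r) g ->
  (forall x, ball x0 r x -> (g x)^T = g x) ->
  (forall x, ball x0 r x -> forall v : 'rV[R]_2, v != 0 -> 0 < (v *m g x *m v^T) 0 0) ->
  is_metric (M := disc) (fun _ => g).
Proof.
move=> sg yg pg; split; first by move=> i; rewrite disc_chart_im.
move=> i j x [v _ <-] f; rewrite -[chart_map i v]/(disc_map v).
have fE y : ball x0 r y -> f y = y by exact: disc_invK.
have vb := disc_map_ball v.
by rewrite (jacobian_id (@ball_open _ _ x0 r) fE vb) fE // mul1mx trmx1 mulmx1.
Qed.
End Disc.

(** * The isometry *)

Section PdeCongruence.
Context {R : realType} (B : set 'rV[R]_2) (oB : open B) (g : 'rV[R]_2 -> 'M[R]_2).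
Variables (h k : 'rV[R]_2 -> R).
Hypothesis hk : forall x, B x -> h x = k x.

Lemma hessian_eq_on x : B x -> hessian g h x = hessian g k x.
Proof.
move=> Bx; apply/matrixP => i j; rewrite [LHS]mxE [RHS]mxE.
have e1 : pderiv (pderiv h j) i x = pderiv (pderiv k j) i x.
  by apply: (pderiv_eq_on oB) Bx => y By; exact: (pderiv_eq_on oB j hk By).
rewrite e1; congr (_ + - _); apply: eq_bigr => l _.
by rewrite (pderiv_eq_on oB l hk Bx).
Qed.

Lemma laplacian_eq_on x : B x -> laplacian g h x = laplacian g k x.
Proof. by move=> Bx; rewrite /laplacian hessian_eq_on. Qed.

Lemma grad_sqr_eq_on x : B x -> grad_sqr g h x = grad_sqr g k x.
Proof.
move=> Bx; apply: eq_bigr => i _; apply: eq_bigr => j _.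
by rewrite (pderiv_eq_on oB i hk Bx) (pderiv_eq_on oB j hk Bx).
Qed.
End PdeCongruence.

(** Used to replace u by the coordinate expression of its transport to the disc; the two agree on
    the ball only. *)
Lemma pde_eq_on (R : realType) (B : set 'rV[R]_2) (g : 'rV[R]_2 -> 'M[R]_2) (h k : 'rV[R]_2 -> R) c :
  open B -> (forall x, B x -> h x = k x) -> pde g h c B -> pde g k c B.
Proof.
move=> oB hk [H|H]; [left|right] => x Bx; have [H1 H2] := H x Bx.
  have hk' y : B y -> (h y)^-1 = (k y)^-1 by move=> /hk ->.
  by rewrite -(laplacian_eq_on oB g hk' Bx) -(grad_sqr_eq_on oB g hk Bx) -hk.
by rewrite -(laplacian_eq_on oB g hk Bx) -(grad_sqr_eq_on oB g hk Bx) -(hessian_eq_on oB g hk Bx) -hk.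
Qed.

(** Both sums are reindexed by s. This is how a permutation of the target coordinates acts on a
    pulled back metric. *)
Lemma perm_sandwich (S : comNzRingType) n (s : 'I_n -> 'I_n) (J J' A N : 'M[S]_n) : involutive s ->
  (forall k a, J' k a = J k (s a)) -> (forall a b, A a b = N (s a) (s b)) ->
  J *m A *m J^T = J' *m N *m J'^T.
Proof.
move=> sK JE AE; apply/matrixP => k l; rewrite [LHS]mxE [RHS]mxE.
rewrite (reindex_inj (inv_inj sK)); apply: eq_bigr => b _ /=.
rewrite [in LHS]mxE [X in _ * X = _]mxE [in RHS]mxE [X in _ = _ * X]mxE JE; congr (_ * _).
rewrite (reindex_inj (inv_inj sK)); apply: eq_bigr => a _ /=.
by rewrite AE !sK JE.
Qed.

Section DiscChart.
Context {R : realType} (M : charted R (2 + 2)) (gb : metric_comp M).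
Hypothesis chM : forall I : chart_index M, is_chart I.
Hypothesis trM : forall I J : chart_index M,
  smooth_on (chart_map I @` (chart_dom I `&` chart_dom J)) (chart_map J \o chart_inv I).
Hypothesis pbM : pullback_on [set: M] idfun gb gb.
Variables (I0 : chart_index M) (z0 : 'rV[R]_(2 + 2)) (r : R) (s : 'I_(2 + 2) -> 'I_(2 + 2)).
Hypotheses (r0 : 0 < r) (ball_im : ball z0 r `<=` chart_im I0) (sK : involutive s).

(** The involution [s] is the identity or the exchange of the two factors: one construction then
    serves both cases, with the factor on which psi depends placed first. *)
Definition permute (z : 'rV[R]_(2 + 2)) : 'rV[R]_(2 + 2) := \row_k z 0 (s k).
Local Notation P := permute.

Variables (g1 g2 : 'rV[R]_2 -> 'M[R]_2) (u : 'rV[R]_2 -> R).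
Hypothesis form : forall z, ball z0 r z -> forall a b,
  gb I0 z a b = (u (lsubmx (P z)) ^- 2 *:
    block_mx (g1 (lsubmx (P z))) 0 0 (g2 (rsubmx (P z)))) (s a) (s b).

Let x0 : 'rV[R]_2 := lsubmx (P z0).
Let y0 : 'rV[R]_2 := rsubmx (P z0).
Let Sigma := disc x0 r.
Let Pi := disc y0 r.
Let U : set M := chart_dom I0 `&` chart_map I0 @^-1` ball z0 r.
Let F (q : M) : prod_charted Sigma Pi :=
  (disc_inv x0 r (lsubmx (P (chart_map I0 q))), disc_inv y0 r (rsubmx (P (chart_map I0 q)))).
Let G (st : prod_charted Sigma Pi) : M :=
  chart_inv I0 (P (row_mx (disc_map x0 r st.1) (disc_map y0 r st.2))).

Let PK z : P (P z) = z.
Proof. by apply/rowP => k; rewrite !mxE sK. Qed.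

Let ballP z : ball (P z0) r (P z) <-> ball z0 r z.
Proof.
split=> /ball_rowP[_ h]; apply/ball_rowP; split=> // k.
  by have := h (s k); rewrite !mxE sK.
by rewrite !mxE.
Qed.

Let ballP' z : ball z0 r (P z) <-> ball (P z0) r z.
Proof. by rewrite -ballP PK. Qed.

Let smooth_P D : smooth_on D P.
Proof. exact: smooth_rows. Qed.

Let row_ball a b : ball x0 r a -> ball y0 r b -> ball z0 r (P (row_mx a b)).
Proof. by move=> ha hb; apply/ballP'/ball_box; rewrite row_mxKl row_mxKr. Qed.

Let inv_box z : ball (P z0) r z ->
  row_mx (disc_map x0 r (disc_inv x0 r (lsubmx z))) (disc_map y0 r (disc_inv y0 r (rsubmx z))) = z.
Proof. by move=> /ball_box[h1 h2]; rewrite !disc_invK // hsubmxK. Qed.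

Let ball_inv z : ball z0 r z -> chart_dom I0 (chart_inv I0 z) /\ chart_map I0 (chart_inv I0 z) = z.
Proof. by move=> /ball_im; exact: chart_im_inv. Qed.

Let open_U : open U.
Proof.
have [od _ _ _ _] := chM I0; rewrite openE => q [dq bq].
have c := chart_map_continuous (chM I0) dq.
have nb : \forall p \near q, ball z0 r (chart_map I0 p).
  by apply: c; apply: open_nbhs_nbhs; split => //; exact: ball_open.
have nd : \forall p \near q, chart_dom I0 p by apply: open_nbhs_nbhs.
by near=> p; split; near: p.
Unshelve. all: by end_near. Qed.

Let GF p : U p -> G (F p) = p.
Proof.
move=> [dp bp]; rewrite /G /F /= inv_box ?PK; last exact/ballP.
by have [_ _ + _ _] := chM I0; apply.
Qed.

Let UG st : U (G st).
Proof.
have b := row_ball (disc_map_ball _ r0 st.1) (disc_map_ball _ r0 st.2).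
by have [d e] := ball_inv b; split => //=; rewrite e.
Qed.

Let map_G st : chart_map I0 (G st) = P (row_mx (disc_map x0 r st.1) (disc_map y0 r st.2)).
Proof.
have b := row_ball (disc_map_ball _ r0 st.1) (disc_map_ball _ r0 st.2).
by have [_ ->] := ball_inv b.
Qed.

Let FG st : F (G st) = st.
Proof.
rewrite /F map_G PK row_mxKl row_mxKr !disc_mapK //.
by case: st.
Qed.

Let W (I : chart_index M) := chart_map I @` (chart_dom I `&` U).

Let open_W I : open (W I).
Proof. exact: chart_image_open. Qed.

Let T (I : chart_index M) := chart_map I0 \o chart_inv I.

Let W_ball I z : W I z -> ball z0 r (T I z).
Proof.
by case=> q [dq [_ bq]] <-; rewrite /T /=; have [_ _ -> //] := chM I.
Qed.

Let W_smooth I : smooth_on (W I) (T I).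
Proof.
by move=> k; apply: smooth_upto_subset (trM I I0 k) => _ [q [dq [d0 _]] <-]; exists q.
Qed.

(** The chart of each disc undoes [disc_inv]. The homeomorphisms, merely continuous, thus drop out
    of the coordinate expression, which is a transition map followed by the permutation. *)
Let F_expr I (J : chart_index (prod_charted Sigma Pi)) z : W I z ->
  (chart_map J \o F \o chart_inv I) z = P (T I z).
Proof. by move=> /W_ball /ballP bz; rewrite /= inv_box. Qed.

Let overlap_F I J : overlap U F I J `<=` W I.
Proof. by move=> _ [q [[Uq dq] _] <-]; exists q. Qed.

Let smooth_PT I : smooth_on (W I) (P \o T I).
Proof.
apply: (@smooth_comp _ _ _ _ (W I) setT) => //; exact: openT.
Qed.

Let smooth_F : smooth_map_on U F.
Proof.
split=> [p [dp bp]|I J k]; last first.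
  apply: smooth_upto_subset (@overlap_F I J) _.
  apply: (smooth_upto_eq (@open_W I)) (@smooth_PT I k) => z Wz.
  by rewrite F_expr.
have cP : {for p, continuous (P \o chart_map I0)}.
  apply: continuous_comp; first exact: chart_map_continuous.
  exact: (smooth_continuous (smooth_P setT)).
have [b1 b2] := (ball_box (P z0) (P (chart_map I0 p)) r).1 ((ballP _).2 bp).
have c1 : {for p, continuous (disc_inv x0 r \o (@lsubmx R 1 2 2 \o (P \o chart_map I0)))}.
  apply: continuous_comp; last exact: disc_inv_continuous.
  by apply: continuous_comp; [exact: cP|exact: (smooth_continuous (smooth_lsub setT))].
have c2 : {for p, continuous (disc_inv y0 r \o (@rsubmx R 1 2 2 \o (P \o chart_map I0)))}.
  apply: continuous_comp; last exact: disc_inv_continuous.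
  by apply: continuous_comp; [exact: cP|exact: (smooth_continuous (smooth_rsub setT))].
exact: (cvg_pair c1 c2).
Qed.

Let smooth_G : smooth_map_on [set: prod_charted Sigma Pi] G.
Proof.
split=> [[a b] _|I J k].
  have c1 : {for (a, b), continuous (fun st : 'rV[R]_2 * 'rV[R]_2 => disc_map x0 r st.1)}.
    apply: (@continuous_comp _ _ _ fst (disc_map x0 r)); first exact: cvg_fst.
    exact: disc_map_continuous.
  have c2 : {for (a, b), continuous (fun st : 'rV[R]_2 * 'rV[R]_2 => disc_map y0 r st.2)}.
    apply: (@continuous_comp _ _ _ snd (disc_map y0 r)); first exact: cvg_snd.
    exact: disc_map_continuous.
  have c3 := continuous_row_mx c1 c2.
  have c4 : {for (a, b), continuous (P \o (fun st : 'rV[R]_2 * 'rV[R]_2 =>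
      row_mx (disc_map x0 r st.1) (disc_map y0 r st.2)))}.
    by apply: continuous_comp; [exact: c3|exact: (smooth_continuous (smooth_P setT))].
  have c5 : {for (a, b), continuous (chart_inv I0 \o (P \o (fun st : 'rV[R]_2 * 'rV[R]_2 =>
      row_mx (disc_map x0 r st.1) (disc_map y0 r st.2))))}.
    apply: continuous_comp; first exact: c4.
    apply: chart_inv_continuous; first exact: chM.
    apply: ball_im.
    exact: row_ball (disc_map_ball _ r0 _) (disc_map_ball _ r0 _).
  exact: c5.
have [oJ _ _ _ _] := chM J; have [_ _ inv0 _ _] := chM I0.
(* [V] consists of the coordinates, in [I0], of the points of [U] in the domain of [J]. On its
   preimage under the permutation, the expression of [G] is the permutation followed by the
   transition map from [I0] to [J]. *)
pose V := chart_map I0 @` (chart_dom I0 `&` (U `&` chart_dom J)).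
have oV : open V by apply: chart_image_open => //; exact: openI.
have oPV : open (P @^-1` V).
  by apply: open_comp; [move=> z _; exact: (smooth_continuous (smooth_P setT))|exact: oV].
have sub : overlap [set: prod_charted Sigma Pi] G I J `<=` P @^-1` V.
  move=> _ [st [_ GJ] <-]; exists (G st); last by rewrite map_G.
  by have [d b] := UG st; split.
apply: smooth_upto_subset sub _.
have sm : smooth_on (P @^-1` V) ((chart_map J \o chart_inv I0) \o P).
  apply: (@smooth_comp _ _ _ _ (P @^-1` V) V) => //.
  by move=> m; apply: smooth_upto_subset (trM I0 J m) => _ [q [d [_ dJ]] <-]; exists q.
apply: (smooth_upto_eq oPV) (sm k) => z [q [dq [[_ bq] _]] qE].
have bz : ball (P z0) r z by apply/ballP'; rewrite -qE.
by rewrite /= /G /= inv_box.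
Qed.

Let phi (v : Sigma) : R := u (disc_map x0 r v).

Let pullback_F : pullback_on U F gb (@conformal_prod _ _ _ Sigma Pi (fun _ => g1) (fun _ => g2) (fun z => phi z.1)).
Proof.
move=> I J z oz f; have Wz := overlap_F oz.
have bz := W_ball Wz; have fE y : W I y -> f y = P (T I y) by exact: F_expr.
clearbody f.
have dT : differentiable (T I) z by apply: (@W_smooth I 0).1.
have dPT : differentiable (P \o T I) z by apply: (@smooth_PT I 0).1.
have df : differentiable f z.
  by apply: differentiable_near dPT; apply: open_near_eq (@open_W I) _ Wz => y /fE.
have gE : gb I z = jacobian (T I) z *m gb I0 (T I z) *m (jacobian (T I) z)^T.
  apply: (pbM (i := I) (j := I0)); case: Wz => q [dq [d0 _]] qE.
  by exists q.
have jE k a : jacobian f z k a = jacobian (T I) z k (s a).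
  apply: etrans (jacobian_entry k a df) _; apply: etrans _ (esym (jacobian_entry k (s a) dT)).
  by apply: (pderiv_eq_on (@open_W I)) Wz => y /fE ->; rewrite [LHS]mxE.
rewrite gE; apply: (perm_sandwich sK jE) => a b; rewrite (form bz) (fE z Wz).
have e : disc_map x0 r (disc_inv x0 r (lsubmx (P (T I z)))) = lsubmx (P (T I z)).
  by rewrite disc_invK //; have /ballP/ball_box[] := bz.
by rewrite /conformal_prod /phi /= e.
Qed.

Lemma disc_chart p : chart_dom I0 p -> chart_map I0 p = z0 ->
  exists (V : set M) (F' : M -> prod_charted Sigma Pi) (G' : prod_charted Sigma Pi -> M),
  [/\ open V, V p & isometry_onto V gb
    (@conformal_prod _ _ _ Sigma Pi (fun _ => g1) (fun _ => g2) (fun z => u (disc_map x0 r z.1))) F' G'].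
Proof.
move=> dp pz; exists U, F, G; split.
- exact: open_U.
- by split=> //=; rewrite pz; exact: ballxx.
split; [exact: GF| |exact: smooth_F|exact: smooth_G|exact: pullback_F].
by move=> st; split; [exact: UG|exact: FG].
Qed.
End DiscChart.

Lemma permute_id (R : realType) (z : 'rV[R]_(2 + 2)) : permute id z = z.
Proof. by apply/rowP => k; rewrite mxE. Qed.

Definition swap_factors (k : 'I_(2 + 2)) : 'I_(2 + 2) :=
  match fintype.split k with inl a => rshift 2 a | inr b => lshift 2 b end.

Lemma swap_lshift a : swap_factors (lshift 2 a) = rshift 2 a.
Proof. by rewrite /swap_factors -/(unsplit (inl a)) unsplitK. Qed.

Lemma swap_rshift a : swap_factors (rshift 2 a) = lshift 2 a.
Proof. by rewrite /swap_factors -/(unsplit (inr a)) unsplitK. Qed.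

Lemma swap_factorsK : involutive swap_factors.
Proof.
by move=> k; have [a ->|a ->] := split_ordP k; rewrite ?(swap_lshift, swap_rshift).
Qed.

Lemma lsub_swap (R : realType) (z : 'rV[R]_(2 + 2)) : lsubmx (permute swap_factors z) = rsubmx z.
Proof. by apply/rowP => k; rewrite !mxE swap_lshift. Qed.

Lemma rsub_swap (R : realType) (z : 'rV[R]_(2 + 2)) : rsubmx (permute swap_factors z) = lsubmx z.
Proof. by apply/rowP => k; rewrite !mxE swap_rshift. Qed.

Lemma block_swap (R : realType) (A B : 'M[R]_2) a b :
  block_mx A 0 0 B a b = block_mx B 0 0 A (swap_factors a) (swap_factors b).
Proof.
have [i ->|i ->] := split_ordP a; have [j ->|j ->] := split_ordP b;
by rewrite ?(swap_lshift, swap_rshift) ?(block_mxEul, block_mxEur, block_mxEdl, block_mxEdr).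
Qed.

Section DiscFactors.
Context {R : realType} (x0 y0 : 'rV[R]_2) (r c : R) (g1 g2 : 'rV[R]_2 -> 'M[R]_2) (u : 'rV[R]_2 -> R).
Hypothesis r0 : 0 < r.
Hypotheses (s1 : smooth_on (ball x0 r) g1) (s2 : smooth_on (ball y0 r) g2).
Hypotheses (y1 : forall x, ball x0 r x -> (g1 x)^T = g1 x) (y2 : forall x, ball y0 r x -> (g2 x)^T = g2 x).
Hypothesis p1 : forall x, ball x0 r x -> forall v : 'rV[R]_2, v != 0 -> 0 < (v *m g1 x *m v^T) 0 0.
Hypothesis p2 : forall x, ball y0 r x -> forall v : 'rV[R]_2, v != 0 -> 0 < (v *m g2 x *m v^T) 0 0.
Hypothesis gc : forall y, ball y0 r y -> gauss g2 y = c.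
Hypotheses (su : smooth_on (ball x0 r) u) (u0 : forall x, ball x0 r x -> u x != 0).
Hypothesis eq_u : pde g1 u c (ball x0 r).
Local Notation Sigma := (disc x0 r).
Local Notation Pi := (disc y0 r).
Let phi (v : Sigma) : R := u (disc_map x0 r v).

Let phiE x : ball x0 r x -> u x = phi (disc_inv x0 r x).
Proof. by move=> bx; rewrite /phi disc_invK. Qed.

Lemma disc_factors :
  [/\ @riemannian_manifold _ _ Sigma (fun _ => g1), @riemannian_manifold _ _ Pi (fun _ => g2),
      @gauss_constant _ Pi (fun _ => g2) c,
      smooth_fun phi & forall s, phi s != 0].
Proof.
split.
- by split; [exact: disc_manifold|exact: disc_metric].
- by split; [exact: disc_manifold|exact: disc_metric].
- by move=> i x; rewrite disc_chart_im //; exact: gc.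
- move=> i; rewrite disc_chart_im // => k.
  exact: (smooth_upto_eq (@ball_open _ _ x0 r) phiE (su k)).
- by move=> s; apply: u0; exact: disc_map_ball.
Qed.

Lemma disc_pde :
  (forall (i : chart_index Sigma) (x : 'rV[R]_2), chart_im i x ->
      let f := phi \o chart_inv i in
      laplacian g1 (fun y => (f y)^-1) x = 0 /\
      2 * grad_sqr g1 f x = (c - gauss g1 x) * f x ^+ 2)
  \/
  (forall (i : chart_index Sigma) (x : 'rV[R]_2), chart_im i x ->
      let f := phi \o chart_inv i in
      2 *: hessian g1 f x = laplacian g1 f x *: g1 x /\
      (gauss g1 x + c) * f x ^+ 2 + f x * laplacian g1 f x = 2 * grad_sqr g1 f x).
Proof.
by have [H|H] := pde_eq_on (@ball_open _ _ x0 r) phiE eq_u; [left|right] => i x;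
  rewrite disc_chart_im //; exact: H.
Qed.
End DiscFactors.

Lemma smooth_row_slice (R : realType) (D : set 'rV[R]_(2 + 2)) (B : set 'rV[R]_2) (w : 'rV[R]_(2 + 2) -> R) f :
  open D -> open B -> (forall x, B x -> D (f x)) -> smooth_on D w -> smooth_on B f -> smooth_on B (w \o f).
Proof. by move=> oD oB BD sw sf k; exact: smooth_upto_comp oB oD BD (sw k) (sf k). Qed.

Lemma smooth_id (R : realType) n (D : set 'rV[R]_n) : smooth_on D (fun x => x).
Proof.
have -> : (fun x : 'rV[R]_n => x) = (fun x => \row_j x 0 (id j)); last exact: smooth_rows.
by apply/funext => x; apply/rowP => j; rewrite mxE.
Qed.

Theorem theorem16p1 (R : realType) (Mh Mt : charted R 2)
  (gh : metric_comp Mh) (gt : metric_comp Mt)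
  (psi : prod_charted Mh Mt -> R) :
  riemannian_manifold gh -> riemannian_manifold gt ->
  smooth_fun psi -> (forall z, psi z != 0) ->
  weakly_einstein (conformal_prod gh gt psi) ->
  forall p : prod_charted Mh Mt,
  einstein_nonzero_at (conformal_prod gh gt psi) p ->
  weyl_nonzero_at (conformal_prod gh gt psi) p ->
  exists (Sigma Pi : charted R 2) (g : metric_comp Sigma) (h : metric_comp Pi)
         (c : R) (phi : Sigma -> R),
  [/\ riemannian_manifold g, riemannian_manifold h, gauss_constant h c,
      smooth_fun phi & forall s, phi s != 0] /\
  (exists (U : set (prod_charted Mh Mt))
          (F : prod_charted Mh Mt -> prod_charted Sigma Pi)
          (G : prod_charted Sigma Pi -> prod_charted Mh Mt),
     [/\ open U, U p &
         isometry_onto U (conformal_prod gh gt psi)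
           (conformal_prod g h (fun z => phi z.1)) F G]) /\
  ((forall (i : chart_index Sigma) (x : 'rV[R]_2), chart_im i x ->
      let f := phi \o chart_inv i in
      laplacian (g i) (fun y => (f y)^-1) x = 0 /\
      2 * grad_sqr (g i) f x = (c - gauss (g i) x) * f x ^+ 2)
   \/
   (forall (i : chart_index Sigma) (x : 'rV[R]_2), chart_im i x ->
      let f := phi \o chart_inv i in
      2 *: hessian (g i) f x = laplacian (g i) f x *: g i x /\
      (gauss (g i) x + c) * f x ^+ 2 + f x * laplacian (g i) f x
        = 2 * grad_sqr (g i) f x)).
Proof.
move=> rgh rgt spsi psi0 [lam [_ weak]] [p1 p2] [I [[d1 d2] [a [b e0]]]] [J [[e1 e2] [a' [b' [c' [f' w0]]]]]].
rewrite /= in d1 d2 e1 e2.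
have [[_ [_ ch trh]] mgh] := rgh; have [[_ [_ ct trt]] mgt] := rgt.
have [mh pbh] := mgh; have [mt pbt] := mgt.
have chM := prod_is_chart ch ct.
have imE (K : chart_index (prod_charted Mh Mt)) : chart_im K = [set z | chart_im K.1 (lsubmx z) /\ chart_im K.2 (rsubmx z)].
  by apply/seteqP; split => z /prod_chart_im.
have sp (K : chart_index (prod_charted Mh Mt)) : smooth_on [set z | chart_im K.1 (lsubmx z) /\ chart_im K.2 (rsubmx z)] (psi \o chart_inv K).
  by rewrite -imE; exact: spsi.
have oh i : open (chart_im (M := Mh) i) by have [] := ch i.
have ot i : open (chart_im (M := Mt) i) by have [] := ct i.
have smh i : smooth_on (chart_im i) (gh i) by have [] := mh i.
have smt i : smooth_on (chart_im i) (gt i) by have [] := mt i.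
have ph i x : chart_im i x -> forall v : 'rV[R]_2, v != 0 -> 0 < (v *m gh i x *m v^T) 0 0.
  by have [_ _ +] := mh i; apply.
have pt i x : chart_im i x -> forall v : 'rV[R]_2, v != 0 -> 0 < (v *m gt i x *m v^T) 0 0.
  by have [_ _ +] := mt i; apply.
have symh i x : chart_im i x -> forall k l, gh i x k l = gh i x l k by exact: metric_entry_sym.
have symt i x : chart_im i x -> forall k l, gt i x k l = gt i x l k by exact: metric_entry_sym.
have nz (K : chart_index (prod_charted Mh Mt)) z : [set z | chart_im K.1 (lsubmx z) /\ chart_im K.2 (rsubmx z)] z -> (psi \o chart_inv K) z != 0 by move=> _; exact: psi0.
have im (K : chart_index (prod_charted Mh Mt)) : chart_dom K.1 p1 -> chart_dom K.2 p2 ->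
    [set z | chart_im K.1 (lsubmx z) /\ chart_im K.2 (rsubmx z)] (chart_map K (p1, p2)).
  by move=> k1 k2; rewrite -imE; exists (p1, p2).
(* The Weyl tensor is nonzero in the chart [J], the Einstein tensor in [I]; the sum of the
   curvatures is carried from [J] to [I]. *)
have g0 : gauss (gh I.1) (lsubmx (chart_map I (p1, p2))) + gauss (gt I.2) (rsubmx (chart_map I (p1, p2))) != 0.
  have := chart_weyl (oh J.1) (ot J.2) (smh J.1) (smt J.2) (sp J) (@nz J) (@symh J.1) (@symt J.2)
    (@ph J.1) (@pt J.2) (im J e1 e2) w0.
  rewrite /= !row_mxKl !row_mxKr (gauss_chart rgh e1 d1) (gauss_chart rgt e2 d2).
  by [].
have wk z : [set z | chart_im I.1 (lsubmx z) /\ chart_im I.2 (rsubmx z)] z -> forall k l,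
    riemann_square (conf_metric (gh I.1) (gt I.2) (psi \o chart_inv I)) k l z =
    lam (chart_inv I z) * conf_metric (gh I.1) (gt I.2) (psi \o chart_inv I) z k l.
  by rewrite -imE => iz k l; exact: weak.
have := chart_theorem (oh I.1) (ot I.2) (smh I.1) (smt I.2) (sp I) (@nz I) (@symh I.1) (@symt I.2)
    (@ph I.1) (@pt I.2) (im I d1 d2) wk e0 g0.
(* An opaque name for the coordinates of the point, so that they do not unfold into a pair of
   rows. *)
have [z0 z0E] : exists z0, chart_map I (p1, p2) = z0 by eexists.
rewrite z0E.
move=> [r [r0 bh bt cases]].
have bI : ball z0 r `<=` chart_im I by move=> z /ball_box[/bh ? /bt ?]; rewrite imE.
have trM := prod_transition_smooth ch ct trh trt.
have pbM := prod_pullback ch ct trh trt psi pbh pbt.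
have smh' : smooth_on (ball (lsubmx z0) r) (gh I.1) by move=> k; exact: smooth_upto_subset bh (smh I.1 k).
have smt' : smooth_on (ball (rsubmx z0) r) (gt I.2) by move=> k; exact: smooth_upto_subset bt (smt I.2 k).
have yh x : ball (lsubmx z0) r x -> (gh I.1 x)^T = gh I.1 x by move=> /bh; have [_ + _] := mh I.1; apply.
have yt x : ball (rsubmx z0) r x -> (gt I.2 x)^T = gt I.2 x by move=> /bt; have [_ + _] := mt I.2; apply.
have oI : open (chart_im I) by have [] := chM I.
have sI : smooth_on (chart_im I) (psi \o chart_inv I) by exact: spsi.
have bl x : ball (lsubmx z0) r x -> ball z0 r (row_mx x (rsubmx z0)).
  by move=> h; apply/ball_box; rewrite row_mxKl row_mxKr; split => //; exact: ballxx.
have br y : ball (rsubmx z0) r y -> ball z0 r (row_mx (lsubmx z0) y).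
  by move=> h; apply/ball_box; rewrite row_mxKl row_mxKr; split => //; exact: ballxx.
have dI : chart_dom (c := prod_charted Mh Mt) I (p1, p2) by split.
case: cases => -[psiE gE eqn].
(* Here psi depends on the first factor only, and [Sigma] is a disc of that factor. *)
- pose u x := (psi \o chart_inv I) (row_mx x (rsubmx z0)).
  have form z : ball z0 r z -> forall k l, conformal_prod gh gt psi I z k l =
      (u (lsubmx (permute id z)) ^- 2 *:
       block_mx (gh I.1 (lsubmx (permute id z))) 0 0 (gt I.2 (rsubmx (permute id z)))) (id k) (id l).
    by move=> bz k l; rewrite permute_id /u -psiE.
  have su : smooth_on (ball (lsubmx z0) r) u.
    apply: (smooth_row_slice oI (@ball_open _ _ _ _) _ sI) => [x /bl/bI //|].
    apply: smooth_row_mx; [exact: ball_open|exact: smooth_id|by move=> k; exact: smooth_upto_cst].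
  have [V [F [G H]]] := disc_chart chM trM pbM r0 bI (fun k => erefl) form dI z0E.
  rewrite permute_id in F G H.
  exists (disc (lsubmx z0) r), (disc (rsubmx z0) r), (fun _ => gh I.1), (fun _ => gt I.2).
  exists (gauss (gt I.2) (rsubmx z0)), (fun v => u (disc_map (lsubmx z0) r v)); split; last split.
  + exact: (disc_factors r0 smh' smt' yh yt (fun x h => ph _ x (bh x h)) (fun x h => pt _ x (bt x h)) gE su (fun x _ => psi0 _)).
  + by exists V, F, G.
  + exact: disc_pde.
(* Here psi depends on the second factor only; that factor becomes [Sigma], and the isometry
   exchanges the two. *)
- pose u x := (psi \o chart_inv I) (row_mx (lsubmx z0) x).
  have form z : ball z0 r z -> forall k l, conformal_prod gh gt psi I z k l =
      (u (lsubmx (permute swap_factors z)) ^- 2 *: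
       block_mx (gt I.2 (lsubmx (permute swap_factors z))) 0 0
         (gh I.1 (rsubmx (permute swap_factors z)))) (swap_factors k) (swap_factors l).
    move=> bz k l; rewrite lsub_swap rsub_swap /u -psiE // /conformal_prod [LHS]mxE [RHS]mxE.
    by rewrite block_swap.
  have su : smooth_on (ball (rsubmx z0) r) u.
    apply: (smooth_row_slice oI (@ball_open _ _ _ _) _ sI) => [x /br/bI //|].
    apply: smooth_row_mx; [exact: ball_open|by move=> k; exact: smooth_upto_cst|exact: smooth_id].
  have [V [F [G H]]] := disc_chart chM trM pbM r0 bI swap_factorsK form dI z0E.
  rewrite lsub_swap rsub_swap in F G H.
  exists (disc (rsubmx z0) r), (disc (lsubmx z0) r), (fun _ => gt I.2), (fun _ => gh I.1).
  exists (gauss (gh I.1) (lsubmx z0)), (fun v => u (disc_map (rsubmx z0) r v)); split; last split.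
  + exact: (disc_factors r0 smt' smh' yt yh (fun x h => pt _ x (bt x h)) (fun x h => ph _ x (bh x h)) gE su (fun x _ => psi0 _)).
  + by exists V, F, G.
  + exact: disc_pde.
Qed.
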